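(* Let $\alpha\in[0,1]$ and consider on $\mathbb{T}^2\times(0,\infty)$ the problem $$\partial_t\theta+u\cdot\nabla\theta=0,\qquad u=(-\Delta)^{\alpha/2}\mathbf{I}\theta,\qquad \theta(\mathbf{x},0)=\theta_0(\mathbf{x}).$$ Fix $r>3$ and $K_0>0$. (i) If $\alpha\in(0,1]$, fix $s\in[1,\frac1\alpha]$. Let $\theta_0\in G^s$ with radius $\tau_0>0$ and $\|(-\Delta)^{r/2}e^{\tau_0(-\Delta)^{1/(2s)}}\theta_0\|_{L^2}\le K_0$. Then there exist $T_*=T_*(\tau_0,K_0)>0$ and a unique solution in $G^s$ on $[0,T_* )$. (ii) If $\alpha=0$, then for all $s\ge1$ and such $\theta_0\in G^s$ (radius $\tau_0$, bound $K_0$), there exist $T_*=T_*(\tau_0,K_0)>0$ and a unique solution in $G^s$ on $[0,T_* )$.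
   Context: $\mathbb{T}^2=[0,2\pi]^2$ periodic; functions mean-free. $\mathbf{I}=(\mathbf{I}_1,\mathbf{I}_2)$ is the Fourier multiplier with symbols $\widehat{\mathbf{I}}_1(\mathbf{k})=\frac{-k_1k_2}{k_1^2+k_2^2}$, $\widehat{\mathbf{I}}_2(\mathbf{k})=\frac{k_1^2}{k_1^2+k_2^2}$ for $\mathbf{k}\in\mathbb{Z}^2\setminus\{0\}$ and $\widehat{\mathbf{I}}(0,0)=0$ (incompressible porous media law); $(-\Delta)^{\alpha/2}$ has symbol $|\mathbf{k}|^\alpha$. For fixed $r>3$, $s\ge1$, $\tau>0$: $\|\theta\|_{G^s_\tau}^2=\sum_{\mathbf{k}\ne0}|\mathbf{k}|^{2r}e^{2\tau|\mathbf{k}|^{1/s}}|\widehat\theta(\mathbf{k})|^2$, $G^s_\tau$ the space with finite norm ($\tau$ the radius), $G^s=\bigcup_{\tau>0}G^s_\tau$. *)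

(* Defs.v *)
From Stdlib Require Import Reals ZArith List.
From Coquelicot Require Import Coquelicot.
Open Scope R_scope.

(** Fourier side: a (mean-free, real) function on T^2 = [0,2pi]^2 is represented
    by its Fourier coefficients k |-> theta_hat(k), k in Z^2. *)
Definition Z2 : Type := (Z * Z)%type.
Definition coeffs : Type := Z2 -> C.

Definition zero_mode (k : Z2) : bool := (Z.eqb (fst k) 0 && Z.eqb (snd k) 0)%bool.

Definition knorm (k : Z2) : R := sqrt (IZR (fst k) ^ 2 + IZR (snd k) ^ 2).

Definition I1hat (k : Z2) : R :=
  if zero_mode k then 0
  else - (IZR (fst k) * IZR (snd k)) / (IZR (fst k) ^ 2 + IZR (snd k) ^ 2).
Definition I2hat (k : Z2) : R :=
  if zero_mode k then 0
  else IZR (fst k) ^ 2 / (IZR (fst k) ^ 2 + IZR (snd k) ^ 2).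

(** symbol |k|^a of (-Delta)^{a/2} (on mean-free functions; value at k = 0
    is irrelevant since I(0,0) = 0) *)
Definition lap_symbol (a : R) (k : Z2) : R :=
  if zero_mode k then 0 else Rpower (knorm k) a.

Definition u1hat (alpha : R) (th : coeffs) (k : Z2) : C :=
  Cmult (RtoC (lap_symbol alpha k * I1hat k)) (th k).
Definition u2hat (alpha : R) (th : coeffs) (k : Z2) : C :=
  Cmult (RtoC (lap_symbol alpha k * I2hat k)) (th k).

Definition zrange (N : nat) : list Z :=
  map (fun n => (Z.of_nat n - Z.of_nat N)%Z) (seq 0 (2 * N + 1)).
Definition box (N : nat) : list Z2 :=
  flat_map (fun a => map (fun b => (a, b)) (zrange N)) (zrange N).
Definition boxsumR (N : nat) (f : Z2 -> R) : R :=
  fold_right (fun k acc => f k + acc) 0 (box N).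
Definition boxsumC (N : nat) (f : Z2 -> C) : C :=
  fold_right (fun k acc => Cplus (f k) acc) (RtoC 0) (box N).
Definition zsumC (f : Z2 -> C) : C :=
  (real (Lim_seq (fun N => Re (boxsumC N f))),
   real (Lim_seq (fun N => Im (boxsumC N f)))).

Definition Z2sub (k l : Z2) : Z2 := (fst k - fst l, snd k - snd l)%Z.

(** Fourier coefficient at k of u . grad theta :
    sum_{l in Z^2} (u_hat(k-l) . (i l)) theta_hat(l) *)
Definition transport (alpha : R) (th : coeffs) (k : Z2) : C :=
  zsumC (fun l =>
    Cmult (Cmult Ci (Cplus (Cmult (u1hat alpha th (Z2sub k l)) (RtoC (IZR (fst l))))
                           (Cmult (u2hat alpha th (Z2sub k l)) (RtoC (IZR (snd l))))))
          (th l)).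

Definition gterm (r s tau : R) (th : coeffs) (k : Z2) : R :=
  if zero_mode k then 0
  else Rpower (knorm k) (2 * r) * exp (2 * tau * Rpower (knorm k) (1 / s))
       * (Cmod (th k)) ^ 2.
Definition Gnorm_sq (r s tau : R) (th : coeffs) : Rbar :=
  Lim_seq (fun N => boxsumR N (gterm r s tau th)).

Definition real_meanfree (th : coeffs) : Prop :=
  th (0%Z, 0%Z) = RtoC 0 /\
  forall k : Z2, th ((- fst k)%Z, (- snd k)%Z) = Cconj (th k).

Definition IPM_solution (alpha r s T : R) (th0 : coeffs) (th : R -> coeffs) : Prop :=
  th 0 = th0 /\
  (forall t, 0 <= t < T -> real_meanfree (th t)) /\
  (forall T', 0 <= T' < T ->
     exists tau, 0 < tau /\ exists M : R,
       forall t, 0 <= t <= T' -> Rbar_le (Gnorm_sq r s tau (th t)) (Finite M)) /\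
  (forall k, filterlim (fun t => th t k) (at_right 0) (locally (th0 k))) /\
  (forall k t, 0 < t < T ->
     is_derive (fun t' => th t' k) t (Copp (transport alpha (th t) k))).

(* Main.v *)
(** Write g = 1/s and lam(k) = |k|^g. The equation is d/dt theta_k = - sum_l i kap(k-l,l)
    theta_(k-l) theta_l with kap(j,l) = m(j).l, where m(j) is orthogonal to j and even in j.
    In the energy E = sum W^2 |theta|^2, W = |k|^4 exp(tau lam), these two facts and the reality
    of theta turn the transport term into a commutator with kernel kap (W_k^2 - W_l^2).  A
    difference of weights gains a full derivative at the price of lam on the smaller frequency,
    and the loss |j|^alpha <= lam(j) in the velocity is of the same size; so the flux is at most
    C (1 + E) Y with Y = sum lam W^2 |theta|^2.  Letting tau decrease linearly in time produces
    - 2 beta Y, which absorbs it.  This bounds the Galerkin truncations uniformly; the same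
    estimate for the difference of two solutions gives uniqueness and makes the truncations a
    Cauchy sequence. *)

Require Import Defs.
From Stdlib Require Import Reals ZArith List Lra Lia FinFun Permutation.
From Stdlib Require Import IndefiniteDescription FunctionalExtensionality.
From Coquelicot Require Import Coquelicot.
Open Scope R_scope.

(** * Sums over the lattice *)

(** Only finitely many modes are differentiated in time: the energies run over a box, so that no
    interchange of derivative and series has to be justified. The price is the coupling with
    frequencies outside the box. In a single Galerkin truncation these modes vanish; in the
    difference of two solutions they act as a source of size exp(-(sig/2) n^g), negligible for large
    boxes. A truncation of order p >= n solves the full equation for the modes of the box of size n,
    which is why one stability statement serves twice. Regularity is handed from step to step as a
    pointwise bound |theta_k| <= M exp(-sig lam(k)). Polynomial factors, |k|^(2r) in the norm
    included, and summations over the lattice are paid with part of sig; this is how one energy with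
    the fixed power |k|^4 handles every r. The Galerkin field is quadratic, hence not globally
    Lipschitz; it is clamped, and a barrier argument for the energy shows that the clamp is never
    active. For uniqueness, a solution has uniform bounds only on [0, T'] with T' < T, so the
    stability step must have a length that depends on the bounds alone and is then iterated. *)

Definition lsum {A : Type} (L : list A) (f : A -> R) : R :=
  fold_right (fun k acc => f k + acc) 0 L.

Section ListSums.
Context {A B : Type}.
Implicit Types (L : list A) (f h : A -> R).

Lemma lsum_cons (a : A) L f : lsum (a :: L) f = f a + lsum L f.
Proof. reflexivity. Qed.

Lemma lsum_ext L f h : (forall k, In k L -> f k = h k) -> lsum L f = lsum L h.
Proof.
  induction L as [|a L IH]; intros H; [reflexivity|]. simpl.
  rewrite (H a) by now left. f_equal. apply IH. intros; apply H; now right.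
Qed.

Lemma lsum_le L f h : (forall k, In k L -> f k <= h k) -> lsum L f <= lsum L h.
Proof.
  induction L as [|a L IH]; intros H; simpl; [lra|].
  apply Rplus_le_compat; [apply H; now left|]. apply IH; intros; apply H; now right.
Qed.

Lemma lsum_zero L f : (forall k, In k L -> f k = 0) -> lsum L f = 0.
Proof.
  induction L as [|a L IH]; intros H; simpl; [reflexivity|].
  rewrite (H a) by now left. rewrite IH; [lra|]. intros; apply H; now right.
Qed.

Lemma lsum_nonneg L f : (forall k, In k L -> 0 <= f k) -> 0 <= lsum L f.
Proof.
  intros H. rewrite <- (lsum_zero L (fun _ => 0)) by reflexivity. now apply lsum_le.
Qed.

Lemma lsum_plus L f h : lsum L (fun k => f k + h k) = lsum L f + lsum L h.
Proof. induction L; simpl; [lra|]. rewrite IHL. lra. Qed.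

Lemma lsum_minus L f h : lsum L (fun k => f k - h k) = lsum L f - lsum L h.
Proof. induction L; simpl; [lra|]. rewrite IHL. lra. Qed.

Lemma lsum_scal L (c : R) f : lsum L (fun k => c * f k) = c * lsum L f.
Proof. induction L; simpl; [lra|]. rewrite IHL. lra. Qed.

Lemma lsum_app L L' f : lsum (L ++ L') f = lsum L f + lsum L' f.
Proof. induction L; simpl; [lra|]. rewrite IHL. lra. Qed.

Lemma lsum_map (u : B -> A) (L : list B) f : lsum (map u L) f = lsum L (fun k => f (u k)).
Proof. induction L; simpl; [lra|]. now rewrite IHL. Qed.

End ListSums.

Lemma lsum_swap {A B : Type} (L : list A) (L' : list B) (f : A -> B -> R) :
  lsum L (fun k => lsum L' (fun l => f k l)) = lsum L' (fun l => lsum L (fun k => f k l)).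
Proof.
  induction L as [|a L IH]; simpl.
  - symmetry; now apply lsum_zero.
  - rewrite IH. symmetry; apply lsum_plus.
Qed.

Lemma lsum_abs {A : Type} (L : list A) (f : A -> R) :
  Rabs (lsum L f) <= lsum L (fun k => Rabs (f k)).
Proof.
  induction L as [|a L IH]; simpl; [rewrite Rabs_R0; lra|].
  eapply Rle_trans; [apply Rabs_triang|]. lra.
Qed.

Lemma lsum_term_le {A : Type} (L : list A) (f : A -> R) (a : A) :
  (forall k, In k L -> 0 <= f k) -> In a L -> f a <= lsum L f.
Proof.
  induction L as [|b L IH]; intros H Ha; [easy|]. simpl.
  destruct Ha as [->|Ha].
  - assert (0 <= lsum L f) by (apply lsum_nonneg; intros; apply H; now right). lra.
  - assert (0 <= f b) by (apply H; now left).
    assert (f a <= lsum L f) by (apply IH; auto; intros; apply H; now right). lra.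
Qed.

(** Cutting one occurrence of the head of [L] out of [L'] leaves the rest of [L] covered, because
    the head does not recur in [L]. *)
Lemma lsum_cover {A : Type} (L L' : list A) (f : A -> R) :
  NoDup L -> (forall k, In k L -> In k L' \/ f k = 0) -> (forall k, In k L' -> 0 <= f k) ->
  lsum L f <= lsum L' f.
Proof.
  revert L'; induction L as [|a L IH]; intros L' Hn Hi Hp; simpl.
  - now apply lsum_nonneg.
  - inversion Hn; subst. destruct (Hi a (or_introl eq_refl)) as [Ha|Ha].
    + destruct (in_split a L' Ha) as [l1 [l2 ->]].
      assert (Hle : lsum L f <= lsum (l1 ++ l2) f).
      { apply IH; auto.
        - intros x Hx. destruct (Hi x (or_intror Hx)) as [Hx'|]; [left|now right].
          apply in_app_or in Hx'. apply in_or_app.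
          destruct Hx' as [|[->|]]; auto. contradiction.
        - intros k Hk. apply Hp. apply in_or_app. apply in_app_or in Hk.
          destruct Hk; [now left | right; now right]. }
      rewrite lsum_app in Hle |- *. simpl. lra.
    + rewrite Ha, Rplus_0_l. apply IH; auto. intros x Hx. apply Hi. now right.
Qed.

Lemma lsum_incl {A : Type} (L L' : list A) (f : A -> R) :
  NoDup L -> incl L L' -> (forall k, In k L' -> 0 <= f k) -> lsum L f <= lsum L' f.
Proof. intros HL Hi. apply lsum_cover; auto. Qed.

Lemma lsum_flat_map {A B : Type} (L : list B) (u : B -> list A) (f : A -> R) :
  lsum (flat_map u L) f = lsum L (fun a => lsum (u a) f).
Proof. induction L; simpl; [reflexivity|]. now rewrite lsum_app, IHL. Qed.

Lemma in_zrange (N : nat) (a : Z) : In a (zrange N) <-> (Z.abs a <= Z.of_nat N)%Z.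
Proof.
  unfold zrange. rewrite in_map_iff. split.
  - intros [n [<- Hn]]. apply in_seq in Hn. lia.
  - intros H. exists (Z.to_nat (a + Z.of_nat N)). split; [lia|]. apply in_seq. lia.
Qed.

Lemma in_box (N : nat) (k : Z2) :
  In k (box N) <-> (Z.abs (fst k) <= Z.of_nat N /\ Z.abs (snd k) <= Z.of_nat N)%Z.
Proof.
  unfold box. rewrite in_flat_map. split.
  - intros [a [Ha H]]. apply in_map_iff in H. destruct H as [b [<- Hb]].
    apply in_zrange in Ha. apply in_zrange in Hb. simpl; lia.
  - intros [Ha Hb]. exists (fst k). split; [now apply in_zrange|].
    apply in_map_iff. exists (snd k). split; [now destruct k|now apply in_zrange].
Qed.

Lemma NoDup_zrange (N : nat) : NoDup (zrange N).
Proof.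
  unfold zrange. apply Injective_map_NoDup; [|apply seq_NoDup].
  intros a b H. lia.
Qed.

Lemma NoDup_box (N : nat) : NoDup (box N).
Proof.
  unfold box.
  enough (H : forall L : list Z, NoDup L ->
    NoDup (flat_map (fun a => map (fun b => (a, b)) (zrange N)) L))
    by apply H, NoDup_zrange.
  induction L as [|a L IH]; intros H; simpl; [constructor|].
  inversion H; subst. apply NoDup_app; auto.
  - apply Injective_map_NoDup; [|apply NoDup_zrange]. intros x y E; congruence.
  - intros x Hx Hx'. apply in_map_iff in Hx. destruct Hx as [b [<- _]].
    apply in_flat_map in Hx'. destruct Hx' as [c [Hc Hx']].
    apply in_map_iff in Hx'. destruct Hx' as [d [E _]]. congruence.
Qed.

Lemma box_mono (N M : nat) : (N <= M)%nat -> incl (box N) (box M).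
Proof. intros H k. rewrite !in_box. lia. Qed.

Definition zsize (k : Z2) : nat := Z.to_nat (Z.abs (fst k) + Z.abs (snd k)).

Lemma in_box_zsize (k : Z2) (N : nat) : (zsize k <= N)%nat -> In k (box N).
Proof. unfold zsize. rewrite in_box. lia. Qed.

Lemma incl_box (L : list Z2) : exists N, incl L (box N).
Proof.
  induction L as [|a L [N HN]]; [exists O; easy|].
  exists (Nat.max N (zsize a)). intros k [<-|Hk].
  - apply in_box_zsize. lia.
  - apply (box_mono N); [lia|auto].
Qed.

(** * Frequencies and their Euclidean length *)

Lemma Z2_eq_dec (k l : Z2) : {k = l} + {k <> l}.
Proof. decide equality; apply Z.eq_dec. Qed.

Definition Z2opp (k : Z2) : Z2 := (- fst k, - snd k)%Z.

Lemma zero_mode_spec (k : Z2) : zero_mode k = true <-> k = (0, 0)%Z.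
Proof.
  unfold zero_mode. destruct k as [a b]; simpl.
  rewrite Bool.andb_true_iff, !Z.eqb_eq. split; [intros [-> ->]; auto|].
  intros E; inversion E; auto.
Qed.

Lemma zero_mode_false (k : Z2) : zero_mode k = false <-> k <> (0, 0)%Z.
Proof. rewrite <- zero_mode_spec. symmetry. apply Bool.not_true_iff_false. Qed.

Lemma knorm_nonneg (k : Z2) : 0 <= knorm k.
Proof. apply sqrt_pos. Qed.

Lemma knorm_sqr (k : Z2) : knorm k ^ 2 = IZR (fst k) ^ 2 + IZR (snd k) ^ 2.
Proof.
  unfold knorm. rewrite pow2_sqrt; [reflexivity|].
  apply Rplus_le_le_0_compat; apply pow2_ge_0.
Qed.

Lemma knorm_zero : knorm (0, 0)%Z = 0.
Proof. unfold knorm; simpl. transitivity (sqrt 0); [f_equal; ring|apply sqrt_0]. Qed.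

Lemma IZR_sqr_ge1 (a : Z) : a <> 0%Z -> 1 <= IZR a ^ 2.
Proof.
  intros H. replace (IZR a ^ 2) with (IZR (a * a)) by (rewrite mult_IZR; ring).
  apply IZR_le. nia.
Qed.

Lemma knorm_ge1 (k : Z2) : k <> (0, 0)%Z -> 1 <= knorm k.
Proof.
  intros H. assert (1 <= knorm k ^ 2).
  { rewrite knorm_sqr. destruct (Z.eq_dec (fst k) 0) as [E|E].
    - assert (snd k <> 0%Z) by (intros E'; apply H; rewrite (surjective_pairing k), E, E'; reflexivity).
      pose proof (IZR_sqr_ge1 _ H0). nra.
    - pose proof (IZR_sqr_ge1 _ E). nra. }
  pose proof (knorm_nonneg k). nra.
Qed.

Lemma knorm_opp (k : Z2) : knorm (Z2opp k) = knorm k.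
Proof. unfold knorm, Z2opp; simpl. rewrite !opp_IZR. f_equal. ring. Qed.

Lemma Z2sub_opp (k l : Z2) : Z2sub l k = Z2opp (Z2sub k l).
Proof. unfold Z2sub, Z2opp; simpl. f_equal; lia. Qed.

Lemma knorm_sub_sym (k l : Z2) : knorm (Z2sub l k) = knorm (Z2sub k l).
Proof. rewrite Z2sub_opp. apply knorm_opp. Qed.

Lemma knorm_cauchy_schwarz (k l : Z2) :
  IZR (fst k) * IZR (fst l) + IZR (snd k) * IZR (snd l) <= knorm k * knorm l.
Proof.
  pose proof (knorm_sqr k) as Hk. pose proof (knorm_sqr l) as Hl.
  pose proof (knorm_nonneg k). pose proof (knorm_nonneg l).
  assert (0 <= knorm k * knorm l) by nra.
  destruct (Rle_dec (IZR (fst k) * IZR (fst l) + IZR (snd k) * IZR (snd l)) 0); [lra|].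
  apply Rsqr_incr_0_var; [|assumption].
  unfold Rsqr.
  replace (knorm k * knorm l * (knorm k * knorm l)) with (knorm k ^ 2 * knorm l ^ 2) by ring.
  rewrite Hk, Hl.
  pose proof (pow2_ge_0 (IZR (fst k) * IZR (snd l) - IZR (snd k) * IZR (fst l))). nra.
Qed.

Lemma knorm_triangle (k l : Z2) : knorm k <= knorm (Z2sub k l) + knorm l.
Proof.
  set (d := Z2sub k l).
  pose proof (knorm_nonneg d). pose proof (knorm_nonneg l). pose proof (knorm_nonneg k).
  assert (knorm k ^ 2 <= (knorm d + knorm l) ^ 2).
  { pose proof (knorm_cauchy_schwarz d l).
    replace ((knorm d + knorm l) ^ 2)
      with (knorm d ^ 2 + knorm l ^ 2 + 2 * (knorm d * knorm l)) by ring.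
    rewrite !knorm_sqr.
    assert (Ha : IZR (fst k) = IZR (fst d) + IZR (fst l))
      by (unfold d, Z2sub; simpl; rewrite minus_IZR; ring).
    assert (Hb : IZR (snd k) = IZR (snd d) + IZR (snd l))
      by (unfold d, Z2sub; simpl; rewrite minus_IZR; ring).
    rewrite Ha, Hb. nra. }
  nra.
Qed.

Lemma knorm_box (N : nat) (k : Z2) : ~ In k (box N) -> INR N <= knorm k.
Proof.
  intros H. rewrite in_box in H. rewrite INR_IZR_INZ.
  assert (H' : (Z.of_nat N * Z.of_nat N <= fst k * fst k + snd k * snd k)%Z) by nia.
  apply IZR_le in H'. rewrite plus_IZR, !mult_IZR in H'.
  pose proof (knorm_sqr k). pose proof (knorm_nonneg k).
  assert (0 <= IZR (Z.of_nat N)) by (apply IZR_le; lia). nra.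
Qed.

(** * Fractional powers of the frequency and exponential decay *)

Definition lam (g : R) (k : Z2) : R := Rpower (knorm k) g.

Lemma lam_opp (g : R) (k : Z2) : lam g (Z2opp k) = lam g k.
Proof. unfold lam. now rewrite knorm_opp. Qed.

Lemma ln_zero : ln 0 = 0.
Proof. unfold ln. destruct (Rlt_dec 0 0) as [H|_]; [destruct (Rlt_irrefl 0 H)|reflexivity]. Qed.

(* [ln 0 = 0] makes [lam g 0 = 1], so no exception at the zero mode is needed. *)
Lemma lam_ge1 (g : R) (k : Z2) : 0 < g -> 1 <= lam g k.
Proof.
  intros Hg. unfold lam. destruct (Z2_eq_dec k (0, 0)%Z) as [->|H].
  - rewrite knorm_zero. unfold Rpower. rewrite ln_zero, Rmult_0_r, exp_0; lra.
  - apply knorm_ge1 in H. rewrite <- (Rpower_O (knorm k)) by lra.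
    apply Rle_Rpower; lra.
Qed.

Lemma lam_zero (g : R) : lam g (0, 0)%Z = 1.
Proof.
  unfold lam. rewrite knorm_zero. unfold Rpower. now rewrite ln_zero, Rmult_0_r, exp_0.
Qed.

Section RealPowers.
Variable g : R.
Hypothesis Hg : 0 < g <= 1.

(** Equivalent to the monotonicity of t^(1-g). It stands in for concavity of t^g: subadditivity and
    the commutator gain in [weight_incr] both come from it. *)
Lemma Rpower_ratio_le (x y : R) : 0 < x <= y -> x * Rpower y g <= y * Rpower x g.
Proof.
  intros [H1 H2].
  assert (E : forall z, 0 < z -> z = Rpower z g * Rpower z (1 - g)).
  { intros z Hz. rewrite <- Rpower_plus. replace (g + (1 - g)) with 1 by ring.
    now rewrite Rpower_1. }
  rewrite (E x) at 1 by lra. rewrite (E y) at 2 by lra.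
  assert (Rpower x (1 - g) <= Rpower y (1 - g)) by (apply Rle_Rpower_l; lra).
  assert (0 < Rpower x g) by apply exp_pos.
  assert (0 < Rpower y g) by apply exp_pos.
  replace (Rpower x g * Rpower x (1 - g) * Rpower y g)
    with (Rpower x g * Rpower y g * Rpower x (1 - g)) by ring.
  replace (Rpower y g * Rpower y (1 - g) * Rpower x g)
    with (Rpower x g * Rpower y g * Rpower y (1 - g)) by ring.
  apply Rmult_le_compat_l; [nra|assumption].
Qed.

Lemma Rpower_subadd (x y : R) : 0 < x -> 0 < y ->
  Rpower (x + y) g <= Rpower x g + Rpower y g.
Proof.
  intros Hx Hy.
  pose proof (Rpower_ratio_le x (x + y) ltac:(lra)).
  pose proof (Rpower_ratio_le y (x + y) ltac:(lra)). nra.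
Qed.

Lemma Rpower_mono (x y : R) : 0 < x <= y -> Rpower x g <= Rpower y g.
Proof. intros; apply Rle_Rpower_l; lra. Qed.

End RealPowers.

Lemma exp_mono (x y : R) : x <= y -> exp x <= exp y.
Proof. intros [H|H]; [|rewrite H]; [now apply Rlt_le, exp_increasing|apply Rle_refl]. Qed.

(** For an integer n >= p/g one has x^p <= (x^g)^n, and exp y = exp(y/n)^n >= (y/n)^n with y = sig
    x^g absorbs this power. *)
Lemma pow_exp_decay (g sig : R) (p : nat) : 0 < g -> 0 < sig ->
  exists C, 1 <= C /\ forall x, 1 <= x -> x ^ p * exp (- sig * Rpower x g) <= C.
Proof.
  intros Hg Hs.
  destruct (nfloor_ex (INR p / g)) as [m [_ Hm]].
  { apply Rle_div_r; [lra|]. rewrite Rmult_0_l. apply pos_INR. }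
  set (n := S m).
  assert (Hn : 1 <= INR n) by (apply (le_INR 1); unfold n; lia).
  assert (Hnp : INR p <= g * INR n).
  { unfold n. rewrite S_INR. apply Rlt_div_l in Hm; nra. }
  exists (1 + (INR n / sig) ^ n). split.
  { assert (0 <= (INR n / sig) ^ n); [|lra].
    apply pow_le. apply Rlt_le, Rdiv_lt_0_compat; lra. }
  intros x Hx. set (y := sig * Rpower x g).
  assert (Hy : 0 < y) by (apply Rmult_lt_0_compat; [lra|apply exp_pos]).
  assert (Hexp : (y / INR n) ^ n <= exp y).
  { replace y with (INR n * (y / INR n)) at 2 by (field; lra).
    assert (E : forall j z, exp (INR j * z) = exp z ^ j).
    { induction j; intros z; [simpl; rewrite Rmult_0_l; apply exp_0|].
      rewrite S_INR, Rmult_plus_distr_r, exp_plus, IHj. simpl. rewrite Rmult_1_l. ring. }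
    rewrite E. apply pow_incr. split; [apply Rlt_le, Rdiv_lt_0_compat; lra|].
    pose proof (exp_ineq1_le (y / INR n)). lra. }
  assert (Hxp : x ^ p <= (Rpower x g) ^ n).
  { rewrite <- !Rpower_pow; [|apply exp_pos|lra]. rewrite Rpower_mult.
    apply Rle_Rpower; lra. }
  replace (- sig * Rpower x g) with (- y) by (unfold y; ring).
  rewrite exp_Ropp. apply Rle_trans with ((INR n / sig) ^ n); [|lra].
  apply (Rmult_le_reg_r (exp y)); [apply exp_pos|].
  rewrite Rmult_assoc, Rinv_l, Rmult_1_r by (apply Rgt_not_eq, exp_pos).
  eapply Rle_trans; [apply Hxp|].
  apply Rle_trans with ((INR n / sig) ^ n * (y / INR n) ^ n).
  - rewrite <- Rpow_mult_distr. right. f_equal. unfold y. field. lra.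
  - apply Rmult_le_compat_l; [|assumption]. apply pow_le, Rlt_le, Rdiv_lt_0_compat; lra.
Qed.

(** A product of one-dimensional weights, so that its lattice sum factors; away from zero it is at
    least |k|^-4 / 4 and can replace |k|^-4 in all sums. *)
Definition decay (k : Z2) : R := / ((1 + IZR (fst k) ^ 2) * (1 + IZR (snd k) ^ 2)).

Lemma decay_pos (k : Z2) : 0 < decay k.
Proof. unfold decay. apply Rinv_0_lt_compat. nra. Qed.

Lemma lsum_inv_sqr (N : nat) : lsum (zrange N) (fun a => / (1 + IZR a ^ 2)) <= 8.
Proof.
  (* A function with values in [-1, 1] whose increments, times 4, dominate the summand; telescoping
     gives 4 * 2 = 8, and [lsum_decay] squares this to 64. *)
  set (h := fun x : R => x / (1 + Rabs x)).
  assert (Hh : forall x, -1 <= h x <= 1).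
  { intros x. unfold h. pose proof (Rabs_pos x). pose proof (Rle_abs x).
    pose proof (Rle_abs (- x)). rewrite Rabs_Ropp in *.
    split; [apply Rle_div_r|apply Rle_div_l]; lra. }
  assert (Hstep : forall a : Z, / (1 + IZR a ^ 2) <= 4 * (h (IZR (a + 1)) - h (IZR a))).
  { intros a. unfold h. rewrite plus_IZR.
    destruct (Z_le_gt_dec 0 a) as [Ha|Ha].
    - apply IZR_le in Ha. rewrite !Rabs_pos_eq by lra. set (x := IZR a) in *.
      replace (4 * ((x + 1) / (1 + (x + 1)) - x / (1 + x)))
        with (/ ((1 + x) * (2 + x) / 4)) by (field; lra).
      apply Rinv_le_contravar; nra.
    - assert (Ha' : (a <= -1)%Z) by lia. apply IZR_le in Ha'.
      rewrite !Rabs_left1 by lra. set (x := IZR a) in *.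
      replace (4 * ((x + 1) / (1 + - (x + 1)) - x / (1 + - x)))
        with (/ ((- x) * (1 - x) / 4)) by (field; lra).
      apply Rinv_le_contravar; nra. }
  unfold zrange. rewrite lsum_map.
  assert (H : forall len st : nat,
    lsum (seq st len) (fun n => / (1 + IZR (Z.of_nat n - Z.of_nat N) ^ 2)) <=
    4 * (h (IZR (Z.of_nat (st + len) - Z.of_nat N)) - h (IZR (Z.of_nat st - Z.of_nat N)))).
  { induction len; intros st.
    - simpl. rewrite Nat.add_0_r. lra.
    - cbn [seq]. rewrite lsum_cons. specialize (IHlen (S st)).
      pose proof (Hstep (Z.of_nat st - Z.of_nat N)%Z) as Hs.
      replace (S st + len)%nat with (st + S len)%nat in IHlen by lia.
      replace (Z.of_nat (S st) - Z.of_nat N)%Z with (Z.of_nat st - Z.of_nat N + 1)%Z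
        in IHlen by lia. lra. }
  eapply Rle_trans; [apply H|].
  pose proof (Hh (IZR (Z.of_nat (0 + (2 * N + 1)) - Z.of_nat N))).
  pose proof (Hh (IZR (Z.of_nat 0 - Z.of_nat N))). lra.
Qed.

Lemma lsum_decay (L : list Z2) : NoDup L -> lsum L decay <= 64.
Proof.
  intros HL. destruct (incl_box L) as [N HN].
  eapply Rle_trans; [apply (lsum_incl L (box N))|]; auto.
  { intros; apply Rlt_le, decay_pos. }
  unfold box. rewrite lsum_flat_map.
  rewrite (lsum_ext _ _ (fun a => lsum (zrange N) (fun b => / (1 + IZR b ^ 2)) * / (1 + IZR a ^ 2))).
  2:{ intros a _. rewrite lsum_map, Rmult_comm, <- lsum_scal.
      apply lsum_ext. intros b _. unfold decay; simpl.
      rewrite Rinv_mult. reflexivity. }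
  rewrite lsum_scal. pose proof (lsum_inv_sqr N).
  assert (0 <= lsum (zrange N) (fun a => / (1 + IZR a ^ 2))).
  { apply lsum_nonneg. intros. apply Rlt_le, Rinv_0_lt_compat. nra. }
  nra.
Qed.

Lemma decay_knorm (k : Z2) : k <> (0, 0)%Z -> / 4 <= knorm k ^ 4 * decay k.
Proof.
  intros H. apply knorm_ge1 in H. unfold decay.
  set (D := (1 + IZR (fst k) ^ 2) * (1 + IZR (snd k) ^ 2)).
  assert (HD : 0 < D) by (unfold D; nra).
  apply Rle_trans with ((D / 4) * / D); [right; field; lra|].
  apply Rmult_le_compat_r; [now apply Rlt_le, Rinv_0_lt_compat|].
  pose proof (knorm_sqr k) as E.
  replace (knorm k ^ 4) with ((knorm k ^ 2) ^ 2) by ring.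
  assert (1 <= knorm k ^ 2) by nra. rewrite E in *. unfold D.
  set (x := IZR (fst k)) in *. set (y := IZR (snd k)) in *. clearbody x y.
  assert (0 <= x ^ 2) by apply pow2_ge_0. assert (0 <= y ^ 2) by apply pow2_ge_0. nra.
Qed.

(** Four extra powers of |k| are absorbed by the exponential as well, and [decay] supplies the
    summable |k|^-4. The constant collects 4 from [decay_knorm] and 64 from [lsum_decay]. *)
Lemma lsum_pow_exp (g sig : R) (p : nat) : 0 < g -> 0 < sig ->
  exists S, 1 <= S /\ forall L, NoDup L ->
    lsum L (fun k => knorm k ^ p * exp (- sig * lam g k)) <= S.
Proof.
  intros Hg Hs. destruct (pow_exp_decay g sig (p + 4) Hg Hs) as [C [HC HCx]].
  exists (4 * C * 64). split; [lra|]. intros L HL.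
  apply Rle_trans with (lsum L (fun k => (4 * C) * decay k)).
  - apply lsum_le. intros k _. destruct (Z2_eq_dec k (0, 0)%Z) as [->|Hk].
    + rewrite knorm_zero. unfold decay; simpl.
      assert (0 ^ p <= 1).
      { destruct p; simpl; lra. }
      assert (exp (- sig * lam g (0, 0)%Z) <= 1).
      { rewrite <- exp_0. apply exp_mono. rewrite lam_zero. lra. }
      assert (0 < exp (- sig * lam g (0, 0)%Z)) by apply exp_pos.
      assert (0 <= 0 ^ p) by (apply pow_le; lra).
      replace (/ ((1 + 0 * (0 * 1)) * (1 + 0 * (0 * 1)))) with 1 by field. nra.
    + pose proof (decay_knorm k Hk) as Hd. pose proof (knorm_ge1 k Hk) as H1.
      specialize (HCx (knorm k) H1). rewrite pow_add in HCx.
      fold (lam g k) in HCx.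
      pose proof (decay_pos k). set (t := knorm k ^ p * exp (- sig * lam g k)) in *.
      assert (0 <= t) by (apply Rmult_le_pos; [apply pow_le; lra|apply Rlt_le, exp_pos]).
      assert (Hm : knorm k ^ 4 * t <= C) by (unfold t; lra).
      set (q := knorm k ^ 4) in *.
      assert (t * / 4 <= t * (q * decay k)) by (apply Rmult_le_compat_l; assumption).
      assert (q * t * decay k <= C * decay k) by (apply Rmult_le_compat_r; lra).
      lra.
  - rewrite lsum_scal. pose proof (lsum_decay L HL). nra.
Qed.

(** For nonnegative f this is unconditional summability with sum at most S. Testing all finite index
    sets makes it insensitive to the order of summation, hence stable under injective reindexing and
    tensor products. *)
Definition sum_bound {A : Type} (f : A -> R) (S : R) : Prop :=
  forall L, NoDup L -> lsum L f <= S.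

Lemma sum_bound_le {A : Type} (f h : A -> R) (S : R) :
  (forall k, f k <= h k) -> sum_bound h S -> sum_bound f S.
Proof.
  intros H Hh L HL. eapply Rle_trans; [|exact (Hh L HL)]. apply lsum_le; auto.
Qed.

Lemma sum_bound_scal {A : Type} (f : A -> R) (c S : R) :
  0 <= c -> sum_bound f S -> sum_bound (fun k => c * f k) (c * S).
Proof.
  intros Hc H L HL. rewrite lsum_scal. apply Rmult_le_compat_l; auto.
Qed.

Lemma sum_bound_reindex {A B : Type} (u : B -> A) (f : A -> R) (S : R) :
  Injective u -> sum_bound f S -> sum_bound (fun k => f (u k)) S.
Proof.
  intros Hu H L HL. rewrite <- lsum_map. apply H. now apply Injective_map_NoDup.
Qed.

Definition zsum (f : Z2 -> R) : R := real (Lim_seq (fun N => lsum (box N) f)).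

Lemma boxsumC_eq (N : nat) (f : Z2 -> C) :
  boxsumC N f = (lsum (box N) (fun k => Re (f k)), lsum (box N) (fun k => Im (f k))).
Proof.
  unfold boxsumC. induction (box N) as [|a L IH]; simpl; [reflexivity|].
  rewrite IH. reflexivity.
Qed.

Lemma zsumC_eq (f : Z2 -> C) :
  zsumC f = (zsum (fun k => Re (f k)), zsum (fun k => Im (f k))).
Proof.
  unfold zsumC, zsum. f_equal; f_equal; apply Lim_seq_ext; intros N;
    rewrite boxsumC_eq; reflexivity.
Qed.

Lemma box_sums_incr (f : Z2 -> R) (N : nat) :
  (forall k, 0 <= f k) -> lsum (box N) f <= lsum (box (S N)) f.
Proof.
  intros H. apply lsum_incl; [apply NoDup_box|apply box_mono; lia|auto].
Qed.

Lemma zsum_is_lim (f : Z2 -> R) (S : R) :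
  sum_bound (fun k => Rabs (f k)) S ->
  is_lim_seq (fun N => lsum (box N) f) (zsum f).
Proof.
  intros H. unfold zsum. apply Lim_seq_correct'.
  (* Both |f| and |f| - f are nonnegative, so their box sums increase and stay bounded; f is their
     difference. *)
  assert (E : ex_finite_lim_seq
    (fun N => lsum (box N) (fun k => Rabs (f k)) - lsum (box N) (fun k => Rabs (f k) - f k))).
  - destruct (ex_finite_lim_seq_incr (fun N => lsum (box N) (fun k => Rabs (f k))) S) as [l1 H1].
    + intros N. apply box_sums_incr. intros; apply Rabs_pos.
    + intros N. apply H, NoDup_box.
    + destruct (ex_finite_lim_seq_incr (fun N => lsum (box N) (fun k => Rabs (f k) - f k)) (2 * S))
        as [l2 H2].
      * intros N. apply box_sums_incr. intros k. pose proof (Rle_abs (f k)). lra.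
      * intros N. apply Rle_trans with (2 * lsum (box N) (fun k => Rabs (f k))).
        -- rewrite <- lsum_scal. apply lsum_le. intros k _.
           pose proof (Rle_abs (- f k)). rewrite Rabs_Ropp in *. lra.
        -- pose proof (H (box N) (NoDup_box N)). lra.
      * exists (l1 - l2). now apply is_lim_seq_minus'.
  - destruct E as [l E]. exists l. revert E. apply is_lim_seq_ext.
    intros N. rewrite lsum_minus. ring.
Qed.

Lemma zsum_bound (f : Z2 -> R) (S : R) :
  sum_bound (fun k => Rabs (f k)) S -> Rabs (zsum f) <= S.
Proof.
  intros H. pose proof (zsum_is_lim f S H) as Hl.
  apply (is_lim_seq_abs _ (zsum f)) in Hl.
  assert (Hle := is_lim_seq_le _ (fun _ => S) _ _
    (fun N => Rle_trans _ _ _ (lsum_abs (box N) f) (H _ (NoDup_box N))) Hl (is_lim_seq_const S)).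
  exact Hle.
Qed.

Lemma zsum_plus (f h : Z2 -> R) (S S' : R) :
  sum_bound (fun k => Rabs (f k)) S -> sum_bound (fun k => Rabs (h k)) S' ->
  zsum (fun k => f k + h k) = zsum f + zsum h.
Proof.
  intros H H'. unfold zsum at 1.
  assert (E : is_lim_seq (fun N => lsum (box N) (fun k => f k + h k)) (zsum f + zsum h)).
  { apply (is_lim_seq_ext (fun N => lsum (box N) f + lsum (box N) h)).
    - intros N. now rewrite lsum_plus.
    - apply is_lim_seq_plus'; eapply zsum_is_lim; eassumption. }
  now rewrite (is_lim_seq_unique _ _ E).
Qed.

Lemma lsum_box_supported (f : Z2 -> R) (n N : nat) :
  (forall k, ~ In k (box n) -> f k = 0) -> (n <= N)%nat -> lsum (box N) f = lsum (box n) f.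
Proof.
  intros H HN.
  (* [lsum_cover] compares nonnegative terms; a signed f is again written as |f| minus (|f| - f). *)
  assert (Hpos : forall h : Z2 -> R, (forall k, 0 <= h k) ->
    (forall k, ~ In k (box n) -> h k = 0) -> lsum (box N) h = lsum (box n) h).
  { intros h Hh H0. apply Rle_antisym; apply lsum_cover; auto using NoDup_box.
    - intros k _. destruct (in_dec Z2_eq_dec k (box n)); auto.
    - intros k Hk. left. now apply (box_mono n N). }
  assert (E : forall L, lsum L f = lsum L (fun k => Rabs (f k)) - lsum L (fun k => Rabs (f k) - f k)).
  { intros L. rewrite lsum_minus. ring. }
  rewrite (E (box N)), (E (box n)), !Hpos; auto.
  - intros k. pose proof (Rle_abs (f k)). lra.
  - intros k Hk. rewrite (H k Hk), Rabs_R0. lra.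
  - intros; apply Rabs_pos.
  - intros k Hk. rewrite (H k Hk). apply Rabs_R0.
Qed.

Lemma zsum_supported (f : Z2 -> R) (n : nat) :
  (forall k, ~ In k (box n) -> f k = 0) -> zsum f = lsum (box n) f.
Proof.
  intros H. unfold zsum.
  rewrite (Lim_seq_ext_loc _ (fun _ => lsum (box n) f)).
  - now rewrite Lim_seq_const.
  - exists n. intros N HN. now apply lsum_box_supported.
Qed.

Lemma Cmod_le_abs (z : C) : Cmod z <= Rabs (Re z) + Rabs (Im z).
Proof.
  destruct z as [x y]; unfold Re, Im; cbn [fst snd].
  replace (x, y) with (RtoC x + Ci * RtoC y)%C.
  - eapply Rle_trans; [apply Cmod_triangle|].
    rewrite Cmod_mult, Cmod_Ci, !Cmod_R. lra.
  - apply injective_projections; simpl; ring.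
Qed.

Lemma im_le_Cmod (z : C) : Rabs (Im z) <= Cmod z.
Proof.
  eapply Rle_trans; [|apply Rmax_Cmod]. apply Rmax_r.
Qed.

Lemma sum_bound_Re (f : Z2 -> C) (S : R) :
  sum_bound (fun k => Cmod (f k)) S -> sum_bound (fun k => Rabs (Re (f k))) S.
Proof. apply sum_bound_le. intros; apply re_le_Cmod. Qed.

Lemma sum_bound_Im (f : Z2 -> C) (S : R) :
  sum_bound (fun k => Cmod (f k)) S -> sum_bound (fun k => Rabs (Im (f k))) S.
Proof. apply sum_bound_le. intros; apply im_le_Cmod. Qed.

Lemma zsumC_bound (f : Z2 -> C) (S : R) :
  sum_bound (fun k => Cmod (f k)) S -> Cmod (zsumC f) <= 2 * S.
Proof.
  intros H. rewrite zsumC_eq. eapply Rle_trans; [apply Cmod_le_abs|]. simpl.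
  pose proof (zsum_bound _ _ (sum_bound_Re f S H)).
  pose proof (zsum_bound _ _ (sum_bound_Im f S H)). lra.
Qed.

Lemma zsumC_plus (f h : Z2 -> C) (S S' : R) :
  sum_bound (fun k => Cmod (f k)) S -> sum_bound (fun k => Cmod (h k)) S' ->
  zsumC (fun k => f k + h k)%C = (zsumC f + zsumC h)%C.
Proof.
  intros H H'. rewrite !zsumC_eq. unfold Cplus; simpl. f_equal.
  - exact (zsum_plus _ _ S S' (sum_bound_Re _ _ H) (sum_bound_Re _ _ H')).
  - exact (zsum_plus _ _ S S' (sum_bound_Im _ _ H) (sum_bound_Im _ _ H')).
Qed.

Lemma zsumC_ext (f h : Z2 -> C) : (forall k, f k = h k) -> zsumC f = zsumC h.
Proof.
  intros H. rewrite !zsumC_eq. unfold zsum. f_equal; f_equal; apply Lim_seq_ext; intros N;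
    apply lsum_ext; intros k _; now rewrite H.
Qed.

Lemma zsumC_supported (f : Z2 -> C) (n : nat) :
  (forall k, ~ In k (box n) -> f k = RtoC 0) ->
  zsumC f = (lsum (box n) (fun k => Re (f k)), lsum (box n) (fun k => Im (f k))).
Proof.
  intros H. rewrite zsumC_eq. f_equal; apply zsum_supported; intros k Hk; now rewrite H.
Qed.

(** * The bilinear form on Gevrey classes *)

Definition kap (alpha : R) (j l : Z2) : R :=
  lap_symbol alpha j * (I1hat j * IZR (fst l) + I2hat j * IZR (snd l)).

Definition bterm (alpha : R) (a b : coeffs) (k l : Z2) : C :=
  (Ci * RtoC (kap alpha (Z2sub k l) l) * a (Z2sub k l) * b l)%C.

Definition Bil (alpha : R) (a b : coeffs) (k : Z2) : C := zsumC (bterm alpha a b k).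

Lemma transport_Bil (alpha : R) (th : coeffs) (k : Z2) :
  transport alpha th k = Bil alpha th th k.
Proof.
  unfold transport, Bil. apply zsumC_ext. intros l.
  unfold bterm, u1hat, u2hat, kap.
  repeat rewrite ?RtoC_mult, ?RtoC_plus. ring.
Qed.

Lemma kap_sub (alpha : R) (j k l : Z2) :
  kap alpha j (Z2sub k l) = kap alpha j k - kap alpha j l.
Proof. unfold kap, Z2sub; simpl. rewrite !minus_IZR. ring. Qed.

Lemma zero_mode_sum (j : Z2) : zero_mode j = false -> 1 <= IZR (fst j) ^ 2 + IZR (snd j) ^ 2.
Proof.
  intros H. rewrite zero_mode_false in H. apply knorm_ge1 in H.
  rewrite <- knorm_sqr. nra.
Qed.

(* This is incompressibility: [m(j)] is orthogonal to [j]. *)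
Lemma kap_diag (alpha : R) (j : Z2) : kap alpha j j = 0.
Proof.
  unfold kap, lap_symbol, I1hat, I2hat. destruct (zero_mode j) eqn:E; [ring|].
  apply zero_mode_sum in E. field. lra.
Qed.

(** Incompressibility for the frequency k - l. Together with [kap_opp] it makes the transport kernel
    symmetric in k and l. *)
Lemma kap_shift (alpha : R) (k l : Z2) :
  kap alpha (Z2sub k l) k = kap alpha (Z2sub k l) l.
Proof. pose proof (kap_sub alpha (Z2sub k l) k l) as H. rewrite kap_diag in H. lra. Qed.

Lemma kap_opp (alpha : R) (j l : Z2) : kap alpha (Z2opp j) l = kap alpha j l.
Proof.
  unfold kap, lap_symbol, I1hat, I2hat. rewrite knorm_opp.
  replace (zero_mode (Z2opp j)) with (zero_mode j).
  2:{ unfold zero_mode, Z2opp; simpl. destruct (fst j), (snd j); reflexivity. }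
  destruct (zero_mode j) eqn:E; [reflexivity|]. apply zero_mode_sum in E.
  unfold Z2opp; simpl fst; simpl snd. rewrite !opp_IZR.
  set (x := IZR (fst j)) in *. set (y := IZR (snd j)) in *.
  replace ((- x) ^ 2) with (x ^ 2) by ring. replace ((- y) ^ 2) with (y ^ 2) by ring.
  field. lra.
Qed.

Lemma kap_zero_r (alpha : R) (j : Z2) : kap alpha j (0, 0)%Z = 0.
Proof. unfold kap; simpl. ring. Qed.

Lemma kap_zero_l (alpha : R) (l : Z2) : kap alpha (0, 0)%Z l = 0.
Proof. unfold kap, lap_symbol; simpl. ring. Qed.

(** The vector (I1, I2) at j is j_1 / |j|^2 times (-j_2, j_1), so its length is at most 1; and
    |j|^alpha <= |j|^g because |j| >= 1. *)
Lemma kap_bound_lam (g alpha : R) (j l : Z2) : 0 <= alpha <= g -> 0 < g ->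
  Rabs (kap alpha j l) <= lam g j * knorm l.
Proof.
  intros Ha Hg. unfold kap, lap_symbol, I1hat, I2hat.
  pose proof (lam_ge1 g j Hg). pose proof (knorm_nonneg l).
  destruct (zero_mode j) eqn:E; [rewrite Rmult_0_l, Rabs_R0; nra|].
  pose proof (zero_mode_sum j E) as Hj.
  apply zero_mode_false, knorm_ge1 in E.
  rewrite Rabs_mult. apply Rmult_le_compat; try apply Rabs_pos.
  - unfold lam. rewrite Rabs_pos_eq by apply Rlt_le, exp_pos. apply Rle_Rpower; lra.
  - set (x := IZR (fst j)) in *. set (y := IZR (snd j)) in *.
    pose proof (knorm_sqr l) as Hl.
    set (u := IZR (fst l)) in *. set (v := IZR (snd l)) in *.
    rewrite <- (Rabs_pos_eq (knorm l)) by assumption. apply Rsqr_le_abs_0. unfold Rsqr.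
    replace (knorm l * knorm l) with (u ^ 2 + v ^ 2) by lra.
    set (q := / (x ^ 2 + y ^ 2)).
    assert (Hq : q * (x ^ 2 + y ^ 2) = 1) by (unfold q; field; lra).
    assert (0 < q) by (apply Rinv_0_lt_compat; lra).
    replace ((- (x * y) / (x ^ 2 + y ^ 2) * u + x ^ 2 / (x ^ 2 + y ^ 2) * v) *
      (- (x * y) / (x ^ 2 + y ^ 2) * u + x ^ 2 / (x ^ 2 + y ^ 2) * v))
      with ((q * x * (x * v - y * u)) ^ 2) by (unfold q; field; lra).
    replace (u ^ 2 + v ^ 2) with ((q * (x ^ 2 + y ^ 2)) ^ 2 * (u ^ 2 + v ^ 2)) by (rewrite Hq; ring).
    (* Lagrange's identity (x^2 + y^2)(u^2 + v^2) = (xv - yu)^2 + (xu + yv)^2 exhibits the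
       difference of the two sides as a sum of squares. *)
    replace ((q * (x ^ 2 + y ^ 2)) ^ 2 * (u ^ 2 + v ^ 2) )
      with ((q * x * (x * v - y * u)) ^ 2 +
            q ^ 2 * ((y * (x * v - y * u)) ^ 2 + (x ^ 2 + y ^ 2) * (x * u + y * v) ^ 2)) by ring.
    assert (0 <= q ^ 2 * ((y * (x * v - y * u)) ^ 2 + (x ^ 2 + y ^ 2) * (x * u + y * v) ^ 2)).
    { apply Rmult_le_pos; [apply pow2_ge_0|].
      apply Rplus_le_le_0_compat; [apply pow2_ge_0|].
      apply Rmult_le_pos; [lra|apply pow2_ge_0]. }
    lra.
Qed.

Lemma lam_le_knorm (g : R) (k : Z2) : 0 < g <= 1 -> k <> (0, 0)%Z -> lam g k <= knorm k.
Proof.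
  intros Hg Hk. apply knorm_ge1 in Hk. apply Rle_trans with (Rpower (knorm k) 1).
  - apply Rle_Rpower; lra.
  - rewrite Rpower_1; lra.
Qed.

Lemma kap_bound (alpha : R) (j l : Z2) : 0 <= alpha <= 1 ->
  Rabs (kap alpha j l) <= knorm j * knorm l.
Proof.
  intros Ha. destruct (Z2_eq_dec j (0, 0)%Z) as [->|Hj].
  - rewrite kap_zero_l, Rabs_R0, knorm_zero. lra.
  - eapply Rle_trans; [apply (kap_bound_lam 1); lra|].
    apply Rmult_le_compat_r; [apply knorm_nonneg|]. apply lam_le_knorm; [lra|assumption].
Qed.

(** Triangle inequality and subadditivity of t^g; the default value [lam g (0, 0) = 1] keeps the
    inequality true when one of the frequencies vanishes. *)
Lemma lam_subadd (g : R) (k l : Z2) : 0 < g <= 1 ->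
  lam g k <= lam g (Z2sub k l) + lam g l.
Proof.
  intros Hg.
  pose proof (lam_ge1 g (Z2sub k l) ltac:(lra)). pose proof (lam_ge1 g l ltac:(lra)).
  destruct (Z2_eq_dec k (0, 0)%Z) as [->|Hk]; [rewrite lam_zero; lra|].
  destruct (Z2_eq_dec l (0, 0)%Z) as [->|Hl].
  { replace (Z2sub k (0, 0)%Z) with k; [lra|].
    destruct k; unfold Z2sub; simpl; f_equal; lia. }
  destruct (Z2_eq_dec (Z2sub k l) (0, 0)%Z) as [E|Hd].
  { assert (k = l) as ->; [|lra].
    destruct k, l; unfold Z2sub in E; simpl in E; inversion E. f_equal; lia. }
  apply knorm_ge1 in Hk. apply knorm_ge1 in Hl. apply knorm_ge1 in Hd.
  eapply Rle_trans; [|apply Rpower_subadd; lra].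
  apply Rpower_mono; [lra|]. split; [lra|apply knorm_triangle].
Qed.

(** A Gevrey class with a supremum in place of the l2 norm. Passing between the two costs only part
    of the radius [sig], and the supremum form behaves well under pointwise limits and cut-offs. *)
Definition Gev (g M sig : R) (a : coeffs) : Prop :=
  forall k, Cmod (a k) <= M * exp (- sig * lam g k).

Lemma Gev_nonneg (g M sig : R) (a : coeffs) : Gev g M sig a -> 0 <= M.
Proof.
  intros H. specialize (H (0, 0)%Z). pose proof (Cmod_ge_0 (a (0, 0)%Z)).
  pose proof (exp_pos (- sig * lam g (0, 0)%Z)).
  apply Rmult_le_reg_r with (exp (- sig * lam g (0, 0)%Z)); lra.
Qed.

Lemma Gev_weaken (g M M' sig sig' : R) (a : coeffs) : 0 < g ->
  M <= M' -> sig' <= sig -> Gev g M sig a -> Gev g M' sig' a.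
Proof.
  intros Hg HM Hs H k. pose proof (Gev_nonneg _ _ _ _ H). pose proof (lam_ge1 g k Hg).
  eapply Rle_trans; [apply H|]. apply Rmult_le_compat; try lra.
  - apply Rlt_le, exp_pos.
  - apply exp_mono. nra.
Qed.

Lemma Gev_plus (g M M' sig : R) (a b : coeffs) :
  Gev g M sig a -> Gev g M' sig b -> Gev g (M + M') sig (fun k => a k + b k)%C.
Proof.
  intros H H' k. eapply Rle_trans; [apply Cmod_triangle|].
  specialize (H k). specialize (H' k). lra.
Qed.

Lemma Gev_opp (g M sig : R) (a : coeffs) : Gev g M sig a -> Gev g M sig (fun k => - a k)%C.
Proof. intros H k. rewrite Cmod_opp. apply H. Qed.

Lemma Gev_minus (g M M' sig : R) (a b : coeffs) :
  Gev g M sig a -> Gev g M' sig b -> Gev g (M + M') sig (fun k => a k - b k)%C.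
Proof. intros H H'. apply (Gev_plus _ _ _ _ a (fun k => - b k)%C H), Gev_opp, H'. Qed.

Lemma Cmod_bterm (alpha : R) (a b : coeffs) (k l : Z2) :
  Cmod (bterm alpha a b k l) =
  Rabs (kap alpha (Z2sub k l) l) * Cmod (a (Z2sub k l)) * Cmod (b l).
Proof. unfold bterm. rewrite !Cmod_mult, Cmod_Ci, Cmod_R. ring. Qed.

(** By subadditivity of [lam], half of the decay at k - l and at l becomes decay at k. The other
    half absorbs the kernel factors |k - l| and |l|: the first product is bounded by S (a
    one-element sum), the second is summed over l, hence S * S. *)
Lemma bterm_sum_bound (g sig : R) : 0 < g <= 1 -> 0 < sig ->
  exists C, 0 <= C /\ forall alpha a b Ma Mb, 0 <= alpha <= 1 ->
    Gev g Ma sig a -> Gev g Mb sig b ->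
    forall k, sum_bound (fun l => Cmod (bterm alpha a b k l))
      (C * Ma * Mb * exp (- (sig / 2) * lam g k)).
Proof.
  intros Hg Hs.
  destruct (lsum_pow_exp g (sig / 2) 1 ltac:(lra) ltac:(lra)) as [S [HS HSb]].
  exists (S * S). split; [nra|]. intros alpha a b Ma Mb Halpha Ha Hb k.
  pose proof (Gev_nonneg _ _ _ _ Ha). pose proof (Gev_nonneg _ _ _ _ Hb).
  set (ph := fun l => knorm l ^ 1 * exp (- (sig / 2) * lam g l)).
  assert (Hph : forall l, 0 <= ph l <= S).
  { intros l. split.
    - apply Rmult_le_pos; [apply pow_le, knorm_nonneg|apply Rlt_le, exp_pos].
    - specialize (HSb (l :: nil) ltac:(repeat constructor; auto)). unfold ph. simpl in *. lra. }
  set (K := S * Ma * Mb * exp (- (sig / 2) * lam g k)).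
  assert (HK : 0 <= K).
  { unfold K. repeat apply Rmult_le_pos; try lra. apply Rlt_le, exp_pos. }
  replace (S * S * Ma * Mb * exp (- (sig / 2) * lam g k)) with (K * S) by (unfold K; ring).
  apply sum_bound_le with (fun l => K * ph l); [|now apply sum_bound_scal].
  intros l. rewrite Cmod_bterm. set (j := Z2sub k l).
  apply Rle_trans with ((knorm j * knorm l) * (Ma * exp (- sig * lam g j)) * (Mb * exp (- sig * lam g l))).
  - apply Rmult_le_compat; [|apply Cmod_ge_0| |apply Hb].
    + apply Rmult_le_pos; [apply Rabs_pos|apply Cmod_ge_0].
    + apply Rmult_le_compat; [apply Rabs_pos|apply Cmod_ge_0|now apply kap_bound|apply Ha].
  - assert (He : exp (- sig * lam g j) * exp (- sig * lam g l) <=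
      exp (- (sig / 2) * lam g k) * (exp (- (sig / 2) * lam g j) * exp (- (sig / 2) * lam g l))).
    { rewrite <- !exp_plus. apply exp_mono.
      pose proof (lam_subadd g k l Hg) as Hl. fold j in Hl. nra. }
    replace (knorm j * knorm l * (Ma * exp (- sig * lam g j)) * (Mb * exp (- sig * lam g l)))
      with ((Ma * Mb * (knorm j * knorm l)) * (exp (- sig * lam g j) * exp (- sig * lam g l))) by ring.
    pose proof (knorm_nonneg j). pose proof (knorm_nonneg l).
    eapply Rle_trans; [apply Rmult_le_compat_l; [|apply He]|].
    { repeat apply Rmult_le_pos; assumption. }
    unfold K.
    replace (Ma * Mb * (knorm j * knorm l) *
      (exp (- (sig / 2) * lam g k) * (exp (- (sig / 2) * lam g j) * exp (- (sig / 2) * lam g l))))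
      with (ph j * ((Ma * Mb * exp (- (sig / 2) * lam g k)) * ph l)) by (unfold ph; ring).
    replace (S * Ma * Mb * exp (- (sig / 2) * lam g k) * ph l)
      with (S * ((Ma * Mb * exp (- (sig / 2) * lam g k)) * ph l)) by ring.
    apply Rmult_le_compat_r; [|apply Hph].
    apply Rmult_le_pos; [|apply Hph].
    repeat apply Rmult_le_pos; try lra; apply Rlt_le, exp_pos.
Qed.

Lemma Bil_Gev (g sig : R) : 0 < g <= 1 -> 0 < sig ->
  exists C, 0 <= C /\ forall alpha a b Ma Mb, 0 <= alpha <= 1 ->
    Gev g Ma sig a -> Gev g Mb sig b -> Gev g (C * Ma * Mb) (sig / 2) (Bil alpha a b).
Proof.
  intros Hg Hs. destruct (bterm_sum_bound g sig Hg Hs) as [C [HC H]].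
  exists (2 * C). split; [lra|]. intros alpha a b Ma Mb Hal Ha Hb k.
  specialize (H alpha a b Ma Mb Hal Ha Hb k). apply zsumC_bound in H.
  unfold Bil. lra.
Qed.

Lemma Bil_plus_l (g M M' M'' sig alpha : R) (a a' b : coeffs) (k : Z2) :
  0 < g <= 1 -> 0 < sig -> 0 <= alpha <= 1 ->
  Gev g M sig a -> Gev g M' sig a' -> Gev g M'' sig b ->
  Bil alpha (fun k => a k + a' k)%C b k = (Bil alpha a b k + Bil alpha a' b k)%C.
Proof.
  intros Hg Hs Hal Ha Ha' Hb. destruct (bterm_sum_bound g sig Hg Hs) as [C [HC H]].
  unfold Bil. rewrite <- (zsumC_plus _ _ _ _ (H _ _ _ _ _ Hal Ha Hb k) (H _ _ _ _ _ Hal Ha' Hb k)).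
  apply zsumC_ext. intros l. unfold bterm. ring.
Qed.

Lemma Bil_plus_r (g M M' M'' sig alpha : R) (a b b' : coeffs) (k : Z2) :
  0 < g <= 1 -> 0 < sig -> 0 <= alpha <= 1 ->
  Gev g M sig a -> Gev g M' sig b -> Gev g M'' sig b' ->
  Bil alpha a (fun k => b k + b' k)%C k = (Bil alpha a b k + Bil alpha a b' k)%C.
Proof.
  intros Hg Hs Hal Ha Hb Hb'. destruct (bterm_sum_bound g sig Hg Hs) as [C [HC H]].
  unfold Bil. rewrite <- (zsumC_plus _ _ _ _ (H _ _ _ _ _ Hal Ha Hb k) (H _ _ _ _ _ Hal Ha Hb' k)).
  apply zsumC_ext. intros l. unfold bterm. ring.
Qed.

Lemma Bil_ext (alpha : R) (a a' b b' : coeffs) (k : Z2) :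
  (forall k, a k = a' k) -> (forall k, b k = b' k) -> Bil alpha a b k = Bil alpha a' b' k.
Proof.
  intros H H'. apply zsumC_ext. intros l. unfold bterm. now rewrite H, H'.
Qed.

Definition supported (n : nat) (a : coeffs) : Prop := forall k, ~ In k (box n) -> a k = RtoC 0.

Lemma Bil_supported_r (alpha : R) (n : nat) (a b : coeffs) (k : Z2) : supported n b ->
  Bil alpha a b k = (lsum (box n) (fun l => Re (bterm alpha a b k l)),
                     lsum (box n) (fun l => Im (bterm alpha a b k l))).
Proof.
  intros H. apply zsumC_supported. intros l Hl. unfold bterm. rewrite H by assumption. ring.
Qed.

(** If k and k - l both lie in the box of size n, then l lies in the box of size 2n. *)
Lemma Bil_supported_l (alpha : R) (n : nat) (a b : coeffs) (k : Z2) :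
  supported n a -> In k (box n) ->
  Bil alpha a b k = (lsum (box (2 * n)) (fun l => Re (bterm alpha a b k l)),
                     lsum (box (2 * n)) (fun l => Im (bterm alpha a b k l))).
Proof.
  intros H Hk. apply zsumC_supported. intros l Hl. unfold bterm. rewrite H; [ring|].
  rewrite in_box in *. unfold Z2sub; simpl fst; simpl snd. lia.
Qed.

(** * Commutator and trilinear estimates *)

Lemma Z2sub_Z2opp (k l : Z2) : Z2sub (Z2sub k l) (Z2opp l) = k.
Proof. destruct k, l; unfold Z2sub, Z2opp; simpl; f_equal; lia. Qed.

Lemma lam_sub_le (g : R) (k l : Z2) : 0 < g <= 1 -> lam g (Z2sub k l) <= lam g k + lam g l.
Proof.
  intros Hg. pose proof (lam_subadd g (Z2sub k l) (Z2opp l) Hg) as H.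
  now rewrite Z2sub_Z2opp, lam_opp in H.
Qed.

Lemma lam_sub_sym (g : R) (k l : Z2) : lam g (Z2sub l k) = lam g (Z2sub k l).
Proof. unfold lam. now rewrite knorm_sub_sym. Qed.

Lemma lam_mono (g : R) (k l : Z2) : 0 < g -> k <> (0, 0)%Z -> knorm k <= knorm l ->
  lam g k <= lam g l.
Proof.
  intros Hg Hk H. apply knorm_ge1 in Hk. apply Rle_Rpower_l; lra.
Qed.

Definition ew (g tau : R) (k : Z2) : R := exp (tau * lam g k).
(** The exponent 4 leaves |k|^2 / |k|^4 square summable over the plane lattice; so the energy
    controls the sum of |k|^2 [ew] |theta_k| in [low_frequency_bound]. *)
Definition Wt (g tau : R) (k : Z2) : R := knorm k ^ 4 * ew g tau k.

Lemma ew_pos (g tau : R) (k : Z2) : 0 < ew g tau k.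
Proof. apply exp_pos. Qed.

Lemma ew_ge1 (g tau : R) (k : Z2) : 0 < g -> 0 <= tau -> 1 <= ew g tau k.
Proof.
  intros Hg Ht. unfold ew. rewrite <- exp_0. apply exp_mono.
  pose proof (lam_ge1 g k Hg). nra.
Qed.

Lemma Wt_nonneg (g tau : R) (k : Z2) : 0 <= Wt g tau k.
Proof.
  apply Rmult_le_pos; [apply pow_le, knorm_nonneg|apply Rlt_le, ew_pos].
Qed.

Lemma Wt_ge1 (g tau : R) (k : Z2) : 0 < g -> 0 <= tau -> k <> (0, 0)%Z -> 1 <= Wt g tau k.
Proof.
  intros Hg Ht Hk. apply knorm_ge1 in Hk. pose proof (ew_ge1 g tau k Hg Ht).
  assert (1 <= knorm k ^ 4) by (apply pow_R1_Rle; assumption). unfold Wt. nra.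
Qed.

(** Convexity of exp in the form 1 - exp(-x) <= x; no order between the two frequencies is
    involved. *)
Lemma ew_diff_le (g tau : R) (k l : Z2) : 0 <= tau ->
  ew g tau k - ew g tau l <= tau * (lam g k - lam g l) * ew g tau k.
Proof.
  intros Ht. unfold ew.
  replace (exp (tau * lam g l))
    with (exp (tau * lam g k) * exp (- (tau * (lam g k - lam g l))))
    by (rewrite <- exp_plus; f_equal; ring).
  pose proof (exp_ineq1_le (- (tau * (lam g k - lam g l)))).
  pose proof (exp_pos (tau * lam g k)). nra.
Qed.

Lemma quartic_incr (x d : R) : 1 <= x -> 0 <= d ->
  (x + d) ^ 4 - x ^ 4 <= 15 * (x ^ 3 * d + d ^ 4) /\ (x + d) ^ 4 <= 8 * x ^ 4 + 8 * d ^ 4.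
Proof.
  intros Hx Hd. split.
  (* Expanded, this says x^2 d^2 + x d^3 <= x^3 d + d^4, which disposes of the mixed binomial
     terms. *)
  - assert (H : 0 <= d * ((x + d) * (x - d) ^ 2)).
    { apply Rmult_le_pos; [assumption|]. apply Rmult_le_pos; [lra|apply pow2_ge_0]. }
    assert (0 <= d * x ^ 3) by (apply Rmult_le_pos; [|apply pow_le]; lra).
    assert (0 <= d * x ^ 2 * d) by (repeat apply Rmult_le_pos; try apply pow2_ge_0; lra).
    assert (0 <= d * x * d ^ 2) by (repeat apply Rmult_le_pos; try apply pow2_ge_0; lra).
    assert (0 <= d ^ 4) by (apply pow_le; assumption).
    lra.
  - pose proof (pow2_ge_0 (x - d)). pose proof (pow2_ge_0 (x + d)).
    assert (H1 : (x + d) ^ 2 <= 2 * (x ^ 2 + d ^ 2)) by nra.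
    pose proof (pow2_ge_0 (x ^ 2 - d ^ 2)).
    replace ((x + d) ^ 4) with ((x + d) ^ 2 * (x + d) ^ 2) by ring.
    apply Rle_trans with ((2 * (x ^ 2 + d ^ 2)) * (2 * (x ^ 2 + d ^ 2))).
    + apply Rmult_le_compat; lra.
    + replace (x ^ 4) with ((x ^ 2) ^ 2) by ring. replace (d ^ 4) with ((d ^ 2) ^ 2) by ring.
      nra.
Qed.

(* The commutator gain: one derivative of the weight is traded for one derivative on the
   difference frequency [d] and [g] derivatives on the smaller frequency [m]. *)
Lemma weight_incr (g tau : R) (M m d : Z2) : 0 < g <= 1 -> 0 <= tau ->
  m <> (0, 0)%Z -> d <> (0, 0)%Z ->
  knorm m <= knorm M -> knorm M <= knorm m + knorm d -> lam g M <= lam g m + lam g d ->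
  knorm m * (Wt g tau M ^ 2 - Wt g tau m ^ 2) <=
  (46 + 16 * tau) * Wt g tau M *
    (knorm d * ew g tau d * lam g m * Wt g tau m + knorm m * ew g tau m * Wt g tau d).
Proof.
  intros Hg Ht Hm Hd HmM HMd HL.
  pose proof (lam_mono g m M ltac:(lra) Hm HmM) as HlmM.
  apply knorm_ge1 in Hm. apply knorm_ge1 in Hd.
  pose proof (lam_ge1 g m ltac:(lra)) as Hl1.
  pose proof (ew_ge1 g tau d ltac:(lra) Ht) as Hed.
  pose proof (ew_pos g tau m) as Hem. pose proof (ew_pos g tau M) as HeM.
  assert (HeMm : ew g tau m <= ew g tau M) by (apply exp_mono; nra).
  assert (HeMd : ew g tau M <= ew g tau m * ew g tau d).
  { unfold ew. rewrite <- exp_plus. apply exp_mono. nra. }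
  (* Since t^(g-1) decreases, x (y^g - x^g) <= (y - x) x^g: the increment of [lam] costs |d| but
     keeps [lam] on the smaller frequency only. *)
  assert (Hratio : knorm m * (lam g M - lam g m) <= knorm d * lam g m).
  { pose proof (Rpower_ratio_le g Hg (knorm m) (knorm M) ltac:(lra)) as H.
    fold (lam g m) (lam g M) in H. nra. }
  pose proof (ew_diff_le g tau M m Ht) as Hdiff.
  set (em := ew g tau m) in *. set (eM := ew g tau M) in *. set (ed := ew g tau d) in *.
  set (x := knorm m) in *. set (y := knorm M) in *. set (z := knorm d) in *.
  set (a := lam g m) in *. set (b := lam g M) in *.
  assert (HW : forall k, Wt g tau k = knorm k ^ 4 * ew g tau k) by reflexivity.
  rewrite !HW. fold x y z em eM ed.
  destruct (quartic_incr x z Hm ltac:(lra)) as [Q1 Q2].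
  assert (Hy4 : y ^ 4 <= (x + z) ^ 4) by (apply pow_incr; lra).
  assert (Hxy4 : x ^ 4 <= y ^ 4) by (apply pow_incr; lra).
  assert (0 <= x ^ 4) by (apply pow_le; lra).
  assert (0 <= x ^ 3) by (apply pow_le; lra).
  assert (0 <= z ^ 4) by (apply pow_le; lra).
  clearbody x y z a b em eM ed. clear HW Hg.
  assert (HWle : x ^ 4 * em <= y ^ 4 * eM) by (apply Rmult_le_compat; lra).
  (* In P the weight [Wt] stays on m, and d carries one derivative; in Q the weight has moved to d,
     and m keeps one derivative. *)
  set (P := z * ed * a * (x ^ 4 * em)). set (Q := x * em * (z ^ 4 * ed)).
  assert (HP0 : 0 <= P) by (unfold P; repeat apply Rmult_le_pos; lra).
  assert (HQ0 : 0 <= Q) by (unfold Q; repeat apply Rmult_le_pos; lra).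
  assert (Hxe : x * (eM - em) <= tau * (z * a) * (em * ed)).
  { apply Rle_trans with (tau * (x * (b - a)) * eM).
    - replace (tau * (x * (b - a)) * eM) with (x * (tau * (b - a) * eM)) by ring.
      apply Rmult_le_compat_l; lra.
    - apply Rmult_le_compat; try lra.
      + apply Rmult_le_pos; [lra|]. apply Rmult_le_pos; lra.
      + apply Rmult_le_compat_l; lra. }
  assert (A1 : x ^ 4 * (x * (eM - em)) <= tau * P).
  { apply Rle_trans with (x ^ 4 * (tau * (z * a) * (em * ed))).
    - apply Rmult_le_compat_l; lra.
    - right; unfold P; ring. }
  assert (A2 : z ^ 4 * (x * (eM - em)) <= Q).
  { apply Rle_trans with (z ^ 4 * (x * (em * ed))).
    - apply Rmult_le_compat_l; [lra|]. apply Rmult_le_compat_l; lra.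
    - right; unfold Q; ring. }
  assert (A3 : x * ((y ^ 4 - x ^ 4) * em) <= 15 * (P + Q)).
  { apply Rle_trans with (15 * (x ^ 4 * em * z + x * em * z ^ 4)).
    - replace (15 * (x ^ 4 * em * z + x * em * z ^ 4))
        with ((x * em) * (15 * (x ^ 3 * z + z ^ 4))) by ring.
      replace (x * ((y ^ 4 - x ^ 4) * em)) with ((x * em) * (y ^ 4 - x ^ 4)) by ring.
      apply Rmult_le_compat_l; [apply Rmult_le_pos; lra|lra].
    - apply Rmult_le_compat_l; [lra|]. apply Rplus_le_compat.
      + unfold P. replace (x ^ 4 * em * z) with (z * 1 * 1 * (x ^ 4 * em)) by ring.
        apply Rmult_le_compat_r; [apply Rmult_le_pos; lra|].
        apply Rmult_le_compat; try nra.
      + unfold Q. rewrite <- Rmult_assoc. rewrite <- (Rmult_1_r (x * em * z ^ 4)) at 1.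
        apply Rmult_le_compat_l; [|lra]. repeat apply Rmult_le_pos; lra. }
  (* Splitting y^4 into 8 x^4 + 8 z^4 gives 8 tau P + 8 Q by A1 and A2, and A3 adds 15 (P + Q). The
     factor U + V <= 2 U at the end doubles 23 + 8 tau. *)
  assert (A4 : x * (y ^ 4 * eM - x ^ 4 * em) <= (23 + 8 * tau) * (P + Q)).
  { replace (x * (y ^ 4 * eM - x ^ 4 * em))
      with (y ^ 4 * (x * (eM - em)) + x * ((y ^ 4 - x ^ 4) * em)) by ring.
    assert (y ^ 4 * (x * (eM - em)) <= (8 * x ^ 4 + 8 * z ^ 4) * (x * (eM - em))).
    { apply Rmult_le_compat_r; [apply Rmult_le_pos; lra|lra]. }
    assert (0 <= tau * Q) by (apply Rmult_le_pos; lra). lra. }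
  assert (0 <= y ^ 4 * eM) by (apply Rmult_le_pos; lra).
  assert (0 <= x ^ 4 * em) by (apply Rmult_le_pos; lra).
  set (U := y ^ 4 * eM) in *. set (V := x ^ 4 * em) in *.
  replace (x * (U ^ 2 - V ^ 2)) with ((U + V) * (x * (U - V))) by ring.
  apply Rle_trans with ((2 * U) * (x * (U - V))).
  - apply Rmult_le_compat_r; [apply Rmult_le_pos; lra|lra].
  - replace ((46 + 16 * tau) * U * (P + Q)) with ((2 * U) * ((23 + 8 * tau) * (P + Q))) by ring.
    apply Rmult_le_compat_l; lra.
Qed.

Definition commutator (g alpha tau : R) (k l : Z2) : R :=
  Rabs (kap alpha (Z2sub k l) l) * Rabs (Wt g tau k ^ 2 - Wt g tau l ^ 2).

Lemma commutator_sym (g alpha tau : R) (k l : Z2) :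
  commutator g alpha tau l k = commutator g alpha tau k l.
Proof.
  unfold commutator. rewrite (Rabs_minus_sym (Wt g tau l ^ 2)). f_equal.
  now rewrite Z2sub_opp, kap_opp, kap_shift.
Qed.

Lemma Z2sub_eq_zero (k l : Z2) : Z2sub k l = (0, 0)%Z -> k = l.
Proof.
  destruct k, l; unfold Z2sub; simpl; intros E; inversion E. f_equal; lia.
Qed.

Lemma commutator_degenerate (g alpha tau : R) (k l : Z2) :
  k = (0, 0)%Z \/ l = (0, 0)%Z \/ Z2sub k l = (0, 0)%Z -> commutator g alpha tau k l = 0.
Proof.
  intros H. unfold commutator. destruct H as [->|[->|H]].
  - rewrite <- kap_shift, kap_zero_r, Rabs_R0. ring.
  - rewrite kap_zero_r, Rabs_R0. ring.
  - rewrite H, kap_zero_l, Rabs_R0. ring.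
Qed.

(** [lam <= knorm] and [1 <= knorm] fail at the zero frequency; there the kernel vanishes, so the
    estimates may exclude it. *)
Lemma commutator_cases (g alpha tau : R) (k l : Z2) :
  commutator g alpha tau k l = 0 \/
  (k <> (0, 0)%Z /\ l <> (0, 0)%Z /\ Z2sub k l <> (0, 0)%Z /\ Z2sub l k <> (0, 0)%Z).
Proof.
  destruct (Z2_eq_dec k (0, 0)%Z); [left; apply commutator_degenerate; auto|].
  destruct (Z2_eq_dec l (0, 0)%Z); [left; apply commutator_degenerate; auto|].
  destruct (Z2_eq_dec (Z2sub k l) (0, 0)%Z); [left; apply commutator_degenerate; auto|].
  right. repeat split; auto.
  intros E. apply Z2sub_eq_zero in E. subst. unfold Z2sub in *. rewrite !Z.sub_diag in *. auto.
Qed.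

Lemma Wt_mono (g tau : R) (k l : Z2) : 0 < g -> 0 <= tau -> k <> (0, 0)%Z ->
  knorm k <= knorm l -> Wt g tau k <= Wt g tau l.
Proof.
  intros Hg Ht Hk H. pose proof (lam_mono g k l Hg Hk H).
  apply Rmult_le_compat.
  - apply pow_le, knorm_nonneg.
  - apply Rlt_le, ew_pos.
  - apply pow_incr. split; [apply knorm_nonneg|assumption].
  - apply exp_mono. nra.
Qed.

Lemma commutator_bound (g alpha tau : R) (k l : Z2) : 0 < g <= 1 -> 0 <= alpha <= g -> 0 <= tau ->
  k <> (0, 0)%Z -> l <> (0, 0)%Z -> Z2sub k l <> (0, 0)%Z -> knorm l <= knorm k ->
  let d := Z2sub k l in
  commutator g alpha tau k l <=
  (46 + 16 * tau) * lam g d * Wt g tau k *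
    (knorm d * ew g tau d * lam g l * Wt g tau l + knorm l * ew g tau l * Wt g tau d).
Proof.
  intros Hg Hal Ht Hk Hl Hd Hle d.
  pose proof (weight_incr g tau k l d Hg Ht Hl Hd Hle) as H.
  pose proof (knorm_triangle k l). pose proof (lam_subadd g k l Hg).
  fold d in H0, H1. specialize (H ltac:(lra) ltac:(lra)).
  unfold commutator. fold d.
  pose proof (kap_bound_lam g alpha d l Hal ltac:(lra)) as Hkap.
  pose proof (Wt_mono g tau l k ltac:(lra) Ht Hl Hle) as HW.
  pose proof (Wt_nonneg g tau l).
  assert (HW2 : Wt g tau l ^ 2 <= Wt g tau k ^ 2) by (apply pow_incr; lra).
  rewrite (Rabs_pos_eq (_ - _)) by lra.
  pose proof (lam_ge1 g d ltac:(lra)).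
  apply Rle_trans with (lam g d * (knorm l * (Wt g tau k ^ 2 - Wt g tau l ^ 2))).
  - rewrite <- Rmult_assoc. apply Rmult_le_compat_r; lra.
  - set (P := knorm d * ew g tau d * lam g l * Wt g tau l + knorm l * ew g tau l * Wt g tau d) in *.
    replace ((46 + 16 * tau) * lam g d * Wt g tau k * P)
      with (lam g d * ((46 + 16 * tau) * Wt g tau k * P)) by ring.
    apply Rmult_le_compat_l; lra.
Qed.

(** * Double sums of convolution type *)

Lemma lsum_list_prod {A B : Type} (L : list A) (L' : list B) (F : A * B -> R) :
  lsum (list_prod L L') F = lsum L (fun k => lsum L' (fun l => F (k, l))).
Proof.
  induction L as [|a L IH]; simpl; [reflexivity|].
  rewrite lsum_app, lsum_map. now rewrite IH.
Qed.

Lemma NoDup_prod {A B : Type} (L : list A) (L' : list B) :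
  NoDup L -> NoDup L' -> NoDup (list_prod L L').
Proof.
  intros HL HL'. induction HL as [|a L Ha HL IH]; simpl; [constructor|].
  apply NoDup_app; auto.
  - apply Injective_map_NoDup; [|assumption]. intros x y E; congruence.
  - intros x Hx Hx'. apply in_map_iff in Hx. destruct Hx as [b [<- _]].
    apply in_prod_iff in Hx'. now destruct Hx'.
Qed.

Lemma sum_bound_nonneg {A : Type} (f : A -> R) (S : R) : sum_bound f S -> 0 <= S.
Proof. intros H. exact (H nil (NoDup_nil A)). Qed.

(** A finite set of pairs lies in the product of its two projections, over which the sum factors. *)
Lemma sum_bound_tensor (ps u : Z2 -> R) (S U : R) :
  (forall k, 0 <= ps k) -> (forall k, 0 <= u k) -> sum_bound ps S -> sum_bound u U ->
  sum_bound (fun p : Z2 * Z2 => ps (fst p) * u (snd p)) (S * U).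
Proof.
  intros Hps Hu HS HU P HP.
  set (L := nodup Z2_eq_dec (map fst P)). set (L' := nodup Z2_eq_dec (map snd P)).
  apply Rle_trans with (lsum (list_prod L L') (fun p => ps (fst p) * u (snd p))).
  - apply lsum_incl; [assumption| |intros; apply Rmult_le_pos; auto].
    intros [a b] H. apply in_prod; apply nodup_In.
    + apply in_map_iff. now exists (a, b).
    + apply in_map_iff. now exists (a, b).
  - rewrite lsum_list_prod. simpl.
    rewrite (lsum_ext L _ (fun k => lsum L' u * ps k)).
    2:{ intros k _. rewrite lsum_scal. ring. }
    rewrite lsum_scal, Rmult_comm.
    assert (H1 : lsum L ps <= S) by apply HS, NoDup_nodup.
    assert (H2 : lsum L' u <= U) by apply HU, NoDup_nodup.
    assert (0 <= lsum L ps) by (apply lsum_nonneg; auto).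
    assert (0 <= lsum L' u) by (apply lsum_nonneg; auto).
    apply Rmult_le_compat; assumption.
Qed.

(** The l1 convolution estimate: the injection [r] is the change of variables after which the
    summand is a product in separate variables. The six lemmas of [ConvolutionSums] are the choices
    of two among k, l and k - l. *)
Lemma double_sum_le (ps u : Z2 -> R) (S U : R) (L L' : list Z2) (r : Z2 * Z2 -> Z2 * Z2) :
  (forall k, 0 <= ps k) -> (forall k, 0 <= u k) -> sum_bound ps S -> sum_bound u U ->
  Injective r -> NoDup L -> NoDup L' ->
  lsum L (fun k => lsum L' (fun l => ps (fst (r (k, l))) * u (snd (r (k, l))))) <= S * U.
Proof.
  intros Hps Hu HS HU Hr HL HL'.
  rewrite <- (lsum_list_prod L L' (fun p => ps (fst (r p)) * u (snd (r p)))).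
  apply (sum_bound_reindex r (fun p => ps (fst p) * u (snd p))); [assumption| |].
  - now apply sum_bound_tensor.
  - now apply NoDup_prod.
Qed.

Ltac prod_nonneg := repeat first [lra | apply Rmult_le_pos].

Ltac injective_pairs :=
  intros [[a b] [c d]] [[a' b'] [c' d']]; unfold Z2sub; simpl; intros E; inversion E;
  repeat f_equal; lia.

Section ConvolutionSums.
Variables (ps u : Z2 -> R) (S U : R) (L L' : list Z2).
Hypotheses (Hps : forall k, 0 <= ps k) (Hu : forall k, 0 <= u k)
  (HS : sum_bound ps S) (HU : sum_bound u U) (HL : NoDup L) (HL' : NoDup L').

Lemma conv_diff_fst : lsum L (fun k => lsum L' (fun l => ps (Z2sub k l) * u k)) <= S * U.
Proof.
  apply (double_sum_le ps u S U L L' (fun p => (Z2sub (fst p) (snd p), fst p))); auto.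
  injective_pairs.
Qed.

Lemma conv_diff_snd : lsum L (fun k => lsum L' (fun l => ps (Z2sub k l) * u l)) <= S * U.
Proof.
  apply (double_sum_le ps u S U L L' (fun p => (Z2sub (fst p) (snd p), snd p))); auto.
  injective_pairs.
Qed.

Lemma conv_snd_diff : lsum L (fun k => lsum L' (fun l => ps l * u (Z2sub k l))) <= S * U.
Proof.
  apply (double_sum_le ps u S U L L' (fun p => (snd p, Z2sub (fst p) (snd p)))); auto.
  injective_pairs.
Qed.

Lemma conv_fst_diff : lsum L (fun k => lsum L' (fun l => ps k * u (Z2sub k l))) <= S * U.
Proof.
  apply (double_sum_le ps u S U L L' (fun p => (fst p, Z2sub (fst p) (snd p)))); auto.
  injective_pairs.
Qed.

Lemma conv_snd_fst : lsum L (fun k => lsum L' (fun l => ps l * u k)) <= S * U.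
Proof.
  apply (double_sum_le ps u S U L L' (fun p => (snd p, fst p))); auto.
  injective_pairs.
Qed.

Lemma conv_fst_snd : lsum L (fun k => lsum L' (fun l => ps k * u l)) <= S * U.
Proof.
  apply (double_sum_le ps u S U L L' (fun p => p)); auto. now intros x y.
Qed.

End ConvolutionSums.

Lemma Wt_sub_sym (g tau : R) (k l : Z2) : Wt g tau (Z2sub l k) = Wt g tau (Z2sub k l).
Proof. unfold Wt, ew. now rewrite lam_sub_sym, knorm_sub_sym. Qed.

Lemma ew_sub_sym (g tau : R) (k l : Z2) : ew g tau (Z2sub l k) = ew g tau (Z2sub k l).
Proof. unfold ew. now rewrite lam_sub_sym. Qed.

Lemma pow_ew_nonneg (g tau : R) (p : nat) (f : Z2 -> R) : (forall k, 0 <= f k) ->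
  forall k, 0 <= knorm k ^ p * (ew g tau k * f k).
Proof.
  intros Hf k. apply Rmult_le_pos; [apply pow_le, knorm_nonneg|].
  apply Rmult_le_pos; [apply Rlt_le, ew_pos|apply Hf].
Qed.

Definition ydens (g tau : R) (f : Z2 -> R) (k : Z2) : R := lam g k * (Wt g tau k * f k) ^ 2.

Lemma ydens_nonneg (g tau : R) (f : Z2 -> R) (k : Z2) : 0 < g -> 0 <= ydens g tau f k.
Proof.
  intros Hg. apply Rmult_le_pos; [pose proof (lam_ge1 g k Hg); lra|apply pow2_ge_0].
Qed.

Section Trilinear.
Variables g alpha tau : R.
Hypotheses (Hg : 0 < g <= 1) (Hal : 0 <= alpha <= g) (Ht : 0 <= tau).

Lemma amgm_lam (k l : Z2) (f h : Z2 -> R) (c : R) : 0 <= c -> c <= lam g k -> c <= lam g l ->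
  c * ((Wt g tau k * f k) * (Wt g tau l * h l)) <=
  / 2 * (ydens g tau f k + ydens g tau h l).
Proof.
  intros Hc Hk Hl. unfold ydens.
  set (X := Wt g tau k * f k). set (Y := Wt g tau l * h l).
  pose proof (pow2_ge_0 (X - Y)). pose proof (pow2_ge_0 X). pose proof (pow2_ge_0 Y).
  assert (c * X ^ 2 <= lam g k * X ^ 2) by (apply Rmult_le_compat_r; assumption).
  assert (c * Y ^ 2 <= lam g l * Y ^ 2) by (apply Rmult_le_compat_r; assumption).
  assert (0 <= c * (X - Y) ^ 2) by (apply Rmult_le_pos; assumption).
  nra.
Qed.

(** One amplitude goes into the low-order sum [ps], the other two carry [Wt] and share one factor
    [lam] by AM-GM. Where d and k are paired, lam d <= lam k + lam l <= 2 lam k, so lam d / 2 lies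
    below both. The amplitude at k - l is a separate [F] so that the lemma also applies with k and l
    exchanged. *)
Lemma commutator_cubic_aux (f : Z2 -> R) (k l : Z2) : (forall k, 0 <= f k) ->
  k <> (0, 0)%Z -> l <> (0, 0)%Z -> Z2sub k l <> (0, 0)%Z -> knorm l <= knorm k ->
  let d := Z2sub k l in
  let ps := fun k => knorm k ^ 2 * (ew g tau k * f k) in
  forall F, F = f d ->
  commutator g alpha tau k l * (F * f k * f l) <=
  (46 + 16 * tau) * (ps d * (ydens g tau f k + ydens g tau f l) +
                     ps l * (ydens g tau f d + ydens g tau f k)).
Proof.
  intros Hf Hk Hl Hd Hle d ps F ->.
  pose proof (commutator_bound g alpha tau k l Hg Hal Ht Hk Hl Hd Hle) as H. fold d in H.
  pose proof (lam_mono g l k ltac:(lra) Hl Hle) as Hlm.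
  pose proof (lam_sub_le g k l Hg) as Hls. fold d in Hls.
  pose proof (lam_le_knorm g d Hg Hd) as Hld.
  pose proof (lam_ge1 g l ltac:(lra)) as Hl1. pose proof (lam_ge1 g d ltac:(lra)) as Hd1.
  pose proof (knorm_ge1 l Hl) as Kl. pose proof (knorm_ge1 d Hd) as Kd.
  pose proof (Hf k) as Fk. pose proof (Hf l) as Fl. pose proof (Hf d) as Fd.
  pose proof (ew_pos g tau d) as Ed. pose proof (ew_pos g tau l) as El.
  pose proof (Wt_nonneg g tau d) as Wd. pose proof (Wt_nonneg g tau k) as Wk.
  pose proof (Wt_nonneg g tau l) as Wl.
  apply Rle_trans with ((46 + 16 * tau) * lam g d * Wt g tau k *
    (knorm d * ew g tau d * lam g l * Wt g tau l + knorm l * ew g tau l * Wt g tau d)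
    * (f d * f k * f l)).
  { apply Rmult_le_compat_r; [prod_nonneg|exact H]. }
  rewrite !Rmult_assoc. apply Rmult_le_compat_l; [lra|].
  replace (lam g d * (Wt g tau k *
    ((knorm d * (ew g tau d * (lam g l * Wt g tau l)) + knorm l * (ew g tau l * Wt g tau d)) *
     (f d * (f k * f l)))))
    with ((lam g d * knorm d * (ew g tau d * f d)) *
            (lam g l * ((Wt g tau l * f l) * (Wt g tau k * f k))) +
          (knorm l * (ew g tau l * f l)) *
            (lam g d * ((Wt g tau d * f d) * (Wt g tau k * f k)))) by ring.
  apply Rplus_le_compat.
  - apply Rmult_le_compat.
    + prod_nonneg.
    + prod_nonneg.
    + unfold ps. apply Rmult_le_compat_r; [apply Rmult_le_pos; lra|]. nra.
    + eapply Rle_trans; [apply amgm_lam; lra|].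
      pose proof (ydens_nonneg g tau f k ltac:(lra)). pose proof (ydens_nonneg g tau f l ltac:(lra)). lra.
  - apply Rmult_le_compat.
    + prod_nonneg.
    + prod_nonneg.
    + unfold ps. apply Rmult_le_compat_r; [apply Rmult_le_pos; lra|]. nra.
    + apply Rle_trans with (2 * (lam g d / 2 * ((Wt g tau d * f d) * (Wt g tau k * f k)))); [right; field|].
      pose proof (amgm_lam d k f f (lam g d / 2) ltac:(lra) ltac:(lra) ltac:(lra)). lra.
Qed.

(** Here the velocity amplitude [F] belongs to a known smooth function, so every weight at d is put
    on it: |d|^6 covers both |d|^4 lam d and |d| lam d. The two copies of h then share only lam of
    the smaller frequency, and the bound is linear in the dissipation of h. *)
Lemma commutator_linear_aux (f h : Z2 -> R) (k l : Z2) :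
  (forall k, 0 <= f k) -> (forall k, 0 <= h k) ->
  k <> (0, 0)%Z -> l <> (0, 0)%Z -> Z2sub k l <> (0, 0)%Z -> knorm l <= knorm k ->
  let d := Z2sub k l in
  forall F, 0 <= F ->
  commutator g alpha tau k l * (F * h k * h l) <=
  (46 + 16 * tau) * (knorm d ^ 6 * (ew g tau d * F) * (ydens g tau h k + ydens g tau h l)).
Proof.
  intros Hf Hh Hk Hl Hd Hle d F HF.
  pose proof (commutator_bound g alpha tau k l Hg Hal Ht Hk Hl Hd Hle) as H. fold d in H.
  pose proof (lam_mono g l k ltac:(lra) Hl Hle) as Hlm.
  pose proof (lam_le_knorm g d Hg Hd) as Hld.
  pose proof (lam_ge1 g l ltac:(lra)) as Hl1. pose proof (lam_ge1 g d ltac:(lra)) as Hd1.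
  pose proof (knorm_ge1 l Hl) as Kl. pose proof (knorm_ge1 d Hd) as Kd.
  pose proof (Hh k) as Fk. pose proof (Hh l) as Fl.
  pose proof (ew_pos g tau d) as Ed. pose proof (ew_pos g tau l) as El.
  pose proof (Wt_nonneg g tau d) as Wd. pose proof (Wt_nonneg g tau k) as Wk.
  pose proof (Wt_nonneg g tau l) as Wl.
  apply Rle_trans with ((46 + 16 * tau) * lam g d * Wt g tau k *
    (knorm d * ew g tau d * lam g l * Wt g tau l + knorm l * ew g tau l * Wt g tau d)
    * (F * h k * h l)).
  { apply Rmult_le_compat_r; [prod_nonneg|exact H]. }
  rewrite !Rmult_assoc. apply Rmult_le_compat_l; [lra|].
  set (Q := (Wt g tau l * h l) * (Wt g tau k * h k)).
  assert (HQ : 0 <= Q) by (unfold Q; prod_nonneg).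
  assert (HlQ : lam g l * Q <= / 2 * (ydens g tau h k + ydens g tau h l)).
  { eapply Rle_trans; [apply amgm_lam; lra|lra]. }
  set (z := knorm d) in *.
  assert (Hz4 : 1 <= z ^ 4) by (apply pow_R1_Rle; assumption).
  set (N := knorm l) in *.
  assert (HN3 : 1 <= N ^ 3) by (apply pow_R1_Rle; assumption).
  assert (HeF : 0 <= ew g tau d * F) by (apply Rmult_le_pos; lra).
  assert (HlQ0 : 0 <= lam g l * Q) by (apply Rmult_le_pos; lra).
  apply Rle_trans with ((2 * (z ^ 6 * (ew g tau d * F))) * (lam g l * Q)).
  2:{ assert (0 <= z ^ 6 * (ew g tau d * F)) by (apply Rmult_le_pos; [apply pow_le|]; lra).
      pose proof (Rmult_le_compat_l _ _ _ H0 HlQ). lra. }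
  replace (lam g d * (Wt g tau k * ((z * (ew g tau d * (lam g l * Wt g tau l)) +
      N * (ew g tau l * Wt g tau d)) * (F * (h k * h l)))))
    with ((lam g d * z * (ew g tau d * F)) * (lam g l * Q) +
          (lam g d * z ^ 4 * (ew g tau d * F)) * ((N * ew g tau l * h l) * (Wt g tau k * h k))).
  2:{ unfold Q, Wt. fold z N. ring. }
  replace (2 * (z ^ 6 * (ew g tau d * F)) * (lam g l * Q))
    with ((z ^ 6 * (ew g tau d * F)) * (lam g l * Q) + (z ^ 6 * (ew g tau d * F)) * (lam g l * Q))
    by ring.
  assert (Hz6 : lam g d * z ^ 4 <= z ^ 6).
  { replace (z ^ 6) with ((z * z) * z ^ 4) by ring. apply Rmult_le_compat_r; nra. }
  assert (Hz6' : lam g d * z <= z ^ 6).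
  { eapply Rle_trans; [|apply Hz6]. apply Rmult_le_compat_l; [lra|].
    replace (z ^ 4) with (z * z ^ 3) by ring.
    assert (1 <= z ^ 3) by (apply pow_R1_Rle; assumption). nra. }
  apply Rplus_le_compat.
  - apply Rmult_le_compat_r; [assumption|]. apply Rmult_le_compat_r; assumption.
  - apply Rmult_le_compat.
    + prod_nonneg.
    + prod_nonneg.
    + apply Rmult_le_compat_r; assumption.
    + apply Rle_trans with (1 * Q); [|apply Rmult_le_compat_r; lra].
      rewrite Rmult_1_l. unfold Q. apply Rmult_le_compat_r; [apply Rmult_le_pos; lra|].
      apply Rmult_le_compat_r; [lra|]. unfold Wt. fold N.
      apply Rmult_le_compat_r; [lra|]. replace (N ^ 4) with (N * N ^ 3) by ring. nra.
Qed.

Lemma commutator_cubic (f : Z2 -> R) (k l : Z2) : (forall k, 0 <= f k) ->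
  f (Z2sub l k) = f (Z2sub k l) ->
  let d := Z2sub k l in
  let ps := fun k => knorm k ^ 2 * (ew g tau k * f k) in
  commutator g alpha tau k l * (f d * f k * f l) <=
  (46 + 16 * tau) * (ps d * ydens g tau f k + ps d * ydens g tau f l +
                     ps l * ydens g tau f d + ps l * ydens g tau f k +
                     ps k * ydens g tau f d + ps k * ydens g tau f l).
Proof.
  intros Hf Hsym d ps.
  assert (Hps : forall k, 0 <= ps k) by (apply pow_ew_nonneg; assumption).
  assert (Hy : forall i j, 0 <= ps i * ydens g tau f j).
  { intros i j. apply Rmult_le_pos; [apply Hps|apply ydens_nonneg; lra]. }
  assert (Hc : 0 <= 46 + 16 * tau) by lra.
  destruct (commutator_cases g alpha tau k l) as [-> | (Hk & Hl & Hd & Hd')].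
  { rewrite Rmult_0_l. apply Rmult_le_pos; [assumption|].
    repeat apply Rplus_le_le_0_compat; auto. }
  destruct (Rle_dec (knorm l) (knorm k)) as [Hle|Hle].
  - eapply Rle_trans; [exact (commutator_cubic_aux f k l Hf Hk Hl Hd Hle (f d) eq_refl)|].
    apply Rmult_le_compat_l; [assumption|].
    pose proof (Hy k d). pose proof (Hy k l). unfold ps, d in *. lra.
  - rewrite <- commutator_sym.
    pose proof (commutator_cubic_aux f l k Hf Hl Hk Hd' ltac:(lra) (f d) ltac:(now rewrite Hsym)) as H.
    assert (Eps : knorm (Z2sub l k) ^ 2 * (ew g tau (Z2sub l k) * f (Z2sub l k)) = ps d).
    { unfold ps, d. now rewrite knorm_sub_sym, ew_sub_sym, Hsym. }
    assert (Ey : ydens g tau f (Z2sub l k) = ydens g tau f d).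
    { unfold ydens, d. now rewrite lam_sub_sym, Wt_sub_sym, Hsym. }
    cbv beta zeta in H. rewrite Eps, Ey in H.
    replace (f d * f k * f l) with (f d * f l * f k) by ring.
    eapply Rle_trans; [exact H|]. apply Rmult_le_compat_l; [assumption|].
    pose proof (Hy l d). pose proof (Hy l k). unfold ps, d in *. lra.
Qed.

Lemma commutator_linear (f h : Z2 -> R) (k l : Z2) :
  (forall k, 0 <= f k) -> (forall k, 0 <= h k) ->
  let A := fun k => knorm k ^ 6 * (ew g tau k * f k) in
  commutator g alpha tau k l * (f (Z2sub k l) * h k * h l) <=
  (46 + 16 * tau) * (A (Z2sub k l) * ydens g tau h k + A (Z2sub k l) * ydens g tau h l).
Proof.
  intros Hf Hh A.
  assert (HA : forall k, 0 <= A k) by (apply pow_ew_nonneg; assumption).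
  assert (Hy : forall i j, 0 <= A i * ydens g tau h j).
  { intros i j. apply Rmult_le_pos; [apply HA|apply ydens_nonneg; lra]. }
  assert (Hc : 0 <= 46 + 16 * tau) by lra.
  destruct (commutator_cases g alpha tau k l) as [-> | (Hk & Hl & Hd & Hd')].
  { rewrite Rmult_0_l. apply Rmult_le_pos; [assumption|].
    repeat apply Rplus_le_le_0_compat; auto. }
  destruct (Rle_dec (knorm l) (knorm k)) as [Hle|Hle].
  - eapply Rle_trans; [exact (commutator_linear_aux f h k l Hf Hh Hk Hl Hd Hle _ (Hf (Z2sub k l)))|].
    right. unfold A. ring.
  - rewrite <- commutator_sym.
    replace (f (Z2sub k l) * h k * h l) with (f (Z2sub k l) * h l * h k) by ring.
    eapply Rle_trans; [exact (commutator_linear_aux f h l k Hf Hh Hl Hk Hd' ltac:(lra) _ (Hf (Z2sub k l)))|].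
    right. unfold A. rewrite knorm_sub_sym, ew_sub_sym. ring.
Qed.

Lemma lsum2_plus (L L' : list Z2) (F G : Z2 -> Z2 -> R) :
  lsum L (fun k => lsum L' (fun l => F k l + G k l)) =
  lsum L (fun k => lsum L' (fun l => F k l)) + lsum L (fun k => lsum L' (fun l => G k l)).
Proof.
  rewrite <- lsum_plus. apply lsum_ext. intros k _. apply lsum_plus.
Qed.

Lemma lsum2_scal (L L' : list Z2) (c : R) (F : Z2 -> Z2 -> R) :
  lsum L (fun k => lsum L' (fun l => c * F k l)) = c * lsum L (fun k => lsum L' (fun l => F k l)).
Proof.
  rewrite <- lsum_scal. apply lsum_ext. intros k _. apply lsum_scal.
Qed.

Lemma lsum2_le (L L' : list Z2) (F G : Z2 -> Z2 -> R) :
  (forall k l, In k L -> In l L' -> F k l <= G k l) ->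
  lsum L (fun k => lsum L' (fun l => F k l)) <= lsum L (fun k => lsum L' (fun l => G k l)).
Proof. intros H. apply lsum_le; intros k Hk; apply lsum_le; intros l Hl; auto. Qed.

Lemma commutator_cubic_sum (f : Z2 -> R) (L : list Z2) (S Y : R) : (forall k, 0 <= f k) ->
  (forall k l, f (Z2sub l k) = f (Z2sub k l)) -> NoDup L ->
  sum_bound (fun k => knorm k ^ 2 * (ew g tau k * f k)) S ->
  sum_bound (ydens g tau f) Y ->
  lsum L (fun k => lsum L (fun l => commutator g alpha tau k l * (f (Z2sub k l) * f k * f l)))
  <= (46 + 16 * tau) * (6 * (S * Y)).
Proof.
  intros Hf Hsym HL HS HY.
  eapply Rle_trans; [apply lsum2_le; intros k l _ _; apply commutator_cubic; auto|].
  cbv beta zeta. rewrite lsum2_scal. apply Rmult_le_compat_l; [lra|].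
  rewrite !lsum2_plus.
  set (ps := fun k => knorm k ^ 2 * (ew g tau k * f k)) in HS.
  assert (Hps : forall k, 0 <= ps k) by (apply pow_ew_nonneg; assumption).
  assert (Hy : forall j, 0 <= ydens g tau f j) by (intros; apply ydens_nonneg; lra).
  pose proof (conv_diff_fst ps _ S Y L L Hps Hy HS HY HL HL).
  pose proof (conv_diff_snd ps _ S Y L L Hps Hy HS HY HL HL).
  pose proof (conv_snd_diff ps _ S Y L L Hps Hy HS HY HL HL).
  pose proof (conv_snd_fst ps _ S Y L L Hps Hy HS HY HL HL).
  pose proof (conv_fst_diff ps _ S Y L L Hps Hy HS HY HL HL).
  pose proof (conv_fst_snd ps _ S Y L L Hps Hy HS HY HL HL).
  unfold ps in *. lra.
Qed.

Lemma commutator_linear_sum (f h : Z2 -> R) (L : list Z2) (A Y : R) :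
  (forall k, 0 <= f k) -> (forall k, 0 <= h k) -> NoDup L ->
  sum_bound (fun k => knorm k ^ 6 * (ew g tau k * f k)) A ->
  sum_bound (ydens g tau h) Y ->
  lsum L (fun k => lsum L (fun l => commutator g alpha tau k l * (f (Z2sub k l) * h k * h l)))
  <= (46 + 16 * tau) * (2 * (A * Y)).
Proof.
  intros Hf Hh HL HS HY.
  eapply Rle_trans; [apply lsum2_le; intros k l _ _; apply commutator_linear; auto|].
  cbv beta zeta. rewrite lsum2_scal. apply Rmult_le_compat_l; [lra|].
  rewrite !lsum2_plus.
  set (ps := fun k => knorm k ^ 6 * (ew g tau k * f k)) in HS.
  assert (Hps : forall k, 0 <= ps k) by (apply pow_ew_nonneg; assumption).
  assert (Hy : forall j, 0 <= ydens g tau h j) by (intros; apply ydens_nonneg; lra).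
  pose proof (conv_diff_fst ps _ A Y L L Hps Hy HS HY HL HL).
  pose proof (conv_diff_snd ps _ A Y L L Hps Hy HS HY HL HL).
  unfold ps in *. lra.
Qed.

(** Two lengths that are at least 1 satisfy a + b <= 2 a b; the fourth power of 2 is the 16. *)
Lemma Wt_submul (k l : Z2) : Z2sub k l <> (0, 0)%Z -> l <> (0, 0)%Z ->
  Wt g tau k <= 16 * (Wt g tau (Z2sub k l) * Wt g tau l).
Proof.
  intros Hd Hl. pose proof (lam_subadd g k l Hg) as H1.
  pose proof (knorm_triangle k l) as H2. apply knorm_ge1 in Hd. apply knorm_ge1 in Hl.
  pose proof (knorm_nonneg k). unfold Wt, ew.
  set (d := Z2sub k l) in *.
  replace (16 * (knorm d ^ 4 * exp (tau * lam g d) * (knorm l ^ 4 * exp (tau * lam g l))))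
    with ((2 * (knorm d * knorm l)) ^ 4 * (exp (tau * lam g d) * exp (tau * lam g l))) by ring.
  rewrite <- exp_plus. apply Rmult_le_compat.
  - now apply pow_le.
  - apply Rlt_le, exp_pos.
  - apply pow_incr. split; [assumption|nra].
  - apply exp_mono. nra.
Qed.

(** The term in which the difference h sits in the velocity: the gradient falls on the smooth factor
    b, so no commutator is required. The loss in the velocity is shared by lam j <= lam k + lam l <=
    2 lam k lam l, which moves half of it to the output frequency k. *)
Lemma stretching_pointwise (h b : Z2 -> R) (k l : Z2) :
  (forall k, 0 <= h k) -> (forall k, 0 <= b k) ->
  let A := fun k => knorm k ^ 6 * (ew g tau k * b k) in
  Wt g tau k ^ 2 * (Rabs (kap alpha (Z2sub k l) l) * (h (Z2sub k l) * b l * h k)) <=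
  16 * (A l * ydens g tau h (Z2sub k l) + A l * ydens g tau h k).
Proof.
  intros Hh Hb A. set (j := Z2sub k l).
  assert (HA : 0 <= A l).
  { apply (pow_ew_nonneg g tau 6 b Hb). }
  pose proof (ydens_nonneg g tau h j ltac:(lra)) as Yj.
  pose proof (ydens_nonneg g tau h k ltac:(lra)) as Yk.
  destruct (Z2_eq_dec l (0, 0)%Z) as [El|Hl].
  { rewrite El at 1. rewrite kap_zero_r, Rabs_R0. nra. }
  destruct (Z2_eq_dec j (0, 0)%Z) as [Ej|Hj].
  { rewrite Ej at 1. rewrite kap_zero_l, Rabs_R0. nra. }
  pose proof (kap_bound_lam g alpha j l Hal ltac:(lra)) as Hkap.
  pose proof (Wt_submul k l Hj Hl) as HW. fold j in HW.
  pose proof (lam_sub_le g k l Hg) as Hls. fold j in Hls.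
  pose proof (lam_le_knorm g l Hg Hl) as Hll.
  pose proof (lam_ge1 g l ltac:(lra)) as Hl1. pose proof (lam_ge1 g j ltac:(lra)) as Hj1.
  pose proof (lam_ge1 g k ltac:(lra)) as Hk1.
  pose proof (knorm_ge1 l Hl) as Kl.
  pose proof (Hh k) as Fk. pose proof (Hb l) as Fl. pose proof (Hh j) as Fj.
  pose proof (ew_pos g tau l) as El.
  pose proof (Wt_nonneg g tau j) as Wj. pose proof (Wt_nonneg g tau k) as Wk.
  pose proof (Wt_nonneg g tau l) as Wl.
  set (Xj := Wt g tau j * h j). set (Xk := Wt g tau k * h k).
  assert (HXj : 0 <= Xj) by (apply Rmult_le_pos; lra).
  assert (HXk : 0 <= Xk) by (apply Rmult_le_pos; lra).
  assert (Hjkl : lam g j * (Xj * Xk) <= lam g l * (ydens g tau h j + ydens g tau h k)).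
  { unfold ydens. fold Xj Xk. pose proof (pow2_ge_0 (Xj - Xk)).
    pose proof (pow2_ge_0 Xk). pose proof (pow2_ge_0 Xj).
    assert (lam g j * (Xj * Xk) <= lam g j * (/ 2 * Xj ^ 2) + lam g j * (/ 2 * Xk ^ 2)).
    { rewrite <- Rmult_plus_distr_l. apply Rmult_le_compat_l; nra. }
    assert (lam g j <= 2 * (lam g k * lam g l)) by nra.
    assert (lam g j * (/ 2 * Xk ^ 2) <= (2 * (lam g k * lam g l)) * (/ 2 * Xk ^ 2))
      by (apply Rmult_le_compat_r; lra).
    assert (0 <= lam g j * Xj ^ 2) by (apply Rmult_le_pos; lra). nra. }
  apply Rle_trans with (Wt g tau k * (16 * (Wt g tau j * Wt g tau l)) *
    ((lam g j * knorm l) * (h j * b l * h k))).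
  { assert (0 <= h j * b l * h k) by (prod_nonneg).
    apply Rmult_le_compat.
    - apply pow2_ge_0.
    - apply Rmult_le_pos; [apply Rabs_pos|assumption].
    - replace (Wt g tau k ^ 2) with (Wt g tau k * Wt g tau k) by ring.
      apply Rmult_le_compat_l; lra.
    - apply Rmult_le_compat_r; assumption. }
  replace (Wt g tau k * (16 * (Wt g tau j * Wt g tau l)) * (lam g j * knorm l * (h j * b l * h k)))
    with (16 * ((knorm l * Wt g tau l * b l) * (lam g j * (Xj * Xk)))) by (unfold Xj, Xk; ring).
  apply Rmult_le_compat_l; [lra|].
  apply Rle_trans with ((knorm l * Wt g tau l * b l) * (lam g l * (ydens g tau h j + ydens g tau h k))).
  { apply Rmult_le_compat_l; [prod_nonneg|assumption]. }
  rewrite <- Rmult_plus_distr_l, <- Rmult_assoc. apply Rmult_le_compat_r; [lra|].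
  unfold A, Wt. replace (knorm l * (knorm l ^ 4 * ew g tau l) * b l * lam g l)
    with ((knorm l ^ 5 * lam g l) * (ew g tau l * b l)) by ring.
  apply Rmult_le_compat_r; [apply Rmult_le_pos; lra|].
  replace (knorm l ^ 6) with (knorm l ^ 5 * knorm l) by ring.
  apply Rmult_le_compat_l; [apply pow_le|]; lra.
Qed.

Lemma stretching_sum (h b : Z2 -> R) (L L' : list Z2) (A Y : R) :
  (forall k, 0 <= h k) -> (forall k, 0 <= b k) -> NoDup L -> NoDup L' ->
  sum_bound (fun k => knorm k ^ 6 * (ew g tau k * b k)) A ->
  sum_bound (ydens g tau h) Y ->
  lsum L (fun k => lsum L' (fun l =>
    Wt g tau k ^ 2 * (Rabs (kap alpha (Z2sub k l) l) * (h (Z2sub k l) * b l * h k))))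
  <= 32 * (A * Y).
Proof.
  intros Hh Hb HL HL' HA HY.
  eapply Rle_trans; [apply lsum2_le; intros k l _ _; apply (stretching_pointwise h b k l Hh Hb)|].
  cbv beta zeta. rewrite lsum2_scal. rewrite !lsum2_plus.
  set (ps := fun k => knorm k ^ 6 * (ew g tau k * b k)) in HA.
  assert (Hps : forall k, 0 <= ps k) by (apply pow_ew_nonneg; assumption).
  assert (Hy : forall j, 0 <= ydens g tau h j) by (intros; apply ydens_nonneg; lra).
  pose proof (conv_snd_diff ps _ A Y L L' Hps Hy HA HY HL HL').
  pose proof (conv_snd_fst ps _ A Y L L' Hps Hy HA HY HL HL').
  unfold ps in *. lra.
Qed.

End Trilinear.

(** * Energy balance *)

Lemma flux_bound (g alpha tau : R) (a v : coeffs) (L : list Z2) :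
  (forall k, a (Z2opp k) = Cconj (a k)) ->
  Rabs (lsum L (fun k => Wt g tau k ^ 2 *
          lsum L (fun l => Re (Cconj (v k) * bterm alpha a v k l)%C))) <=
  / 2 * lsum L (fun k => lsum L (fun l =>
          commutator g alpha tau k l * (Cmod (a (Z2sub k l)) * Cmod (v k) * Cmod (v l)))).
Proof.
  intros Ha. set (q := fun k l => Re (Cconj (v k) * bterm alpha a v k l)%C).
  (* Exchanging k and l conjugates the product of the three amplitudes and preserves [kap], while
     the factor [Ci] stays, so the real part changes sign. Symmetrizing then replaces w k by (w k -
     w l) / 2. *)
  assert (Hanti : forall k l, q l k = - q k l).
  { intros k l. unfold q, bterm.
    rewrite (Z2sub_opp k l), kap_opp, kap_shift, Ha.
    destruct (v k) as [x1 y1], (v l) as [x2 y2], (a (Z2sub k l)) as [x3 y3].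
    unfold Cconj, Cmult, Ci, RtoC, Re; simpl. ring. }
  assert (Hq : forall k l, Rabs (q k l) <=
    Rabs (kap alpha (Z2sub k l) l) * (Cmod (a (Z2sub k l)) * Cmod (v k) * Cmod (v l))).
  { intros k l. unfold q. eapply Rle_trans; [apply re_le_Cmod|].
    rewrite Cmod_mult, Cmod_conj, Cmod_bterm. right; ring. }
  set (w := fun k => Wt g tau k ^ 2).
  rewrite (lsum_ext L _ (fun k => lsum L (fun l => w k * q k l))).
  2:{ intros k _. now rewrite lsum_scal. }
  assert (E : lsum L (fun k => lsum L (fun l => w k * q k l)) =
    / 2 * lsum L (fun k => lsum L (fun l => (w k - w l) * q k l))).
  { assert (E1 : lsum L (fun k => lsum L (fun l => w k * q k l)) =
      lsum L (fun k => lsum L (fun l => - (w l * q k l)))).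
    { rewrite lsum_swap. apply lsum_ext; intros k _; apply lsum_ext; intros l _.
      rewrite (Hanti k l). ring. }
    assert (E2 : lsum L (fun k => lsum L (fun l => (w k - w l) * q k l)) =
      lsum L (fun k => lsum L (fun l => w k * q k l)) +
      lsum L (fun k => lsum L (fun l => - (w l * q k l)))).
    { rewrite <- lsum2_plus. apply lsum_ext; intros k _; apply lsum_ext; intros l _. ring. }
    lra. }
  rewrite E, Rabs_mult, (Rabs_pos_eq (/ 2)) by lra.
  apply Rmult_le_compat_l; [lra|].
  eapply Rle_trans; [apply lsum_abs|]. apply lsum_le; intros k _.
  eapply Rle_trans; [apply lsum_abs|]. apply lsum_le; intros l _.
  rewrite Rabs_mult. unfold commutator. fold (w k) (w l).
  rewrite (Rmult_comm (Rabs (kap _ _ _))), Rmult_assoc.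
  apply Rmult_le_compat_l; [apply Rabs_pos|apply Hq].
Qed.

(** A sum over a finite list, so that it can be differentiated in time term by term whatever the
    solution does at high frequency. *)
Definition energy (g tau : R) (L : list Z2) (v : coeffs) : R :=
  lsum L (fun k => (Wt g tau k * Cmod (v k)) ^ 2).

Definition dissip (g tau : R) (L : list Z2) (v : coeffs) : R :=
  lsum L (ydens g tau (fun k => Cmod (v k))).

Lemma energy_nonneg (g tau : R) (L : list Z2) (v : coeffs) : 0 <= energy g tau L v.
Proof. apply lsum_nonneg; intros; apply pow2_ge_0. Qed.

Lemma dissip_nonneg (g tau : R) (L : list Z2) (v : coeffs) : 0 < g -> 0 <= dissip g tau L v.
Proof. intros; apply lsum_nonneg; intros; now apply ydens_nonneg. Qed.

Lemma is_derive_lsum {A : Type} (L : list A) (f : A -> R -> R) (df : A -> R) (t : R) :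
  (forall k, In k L -> is_derive (f k) t (df k)) ->
  is_derive (fun s => lsum L (fun k => f k s)) t (lsum L df).
Proof.
  induction L as [|a L IH]; intros H; simpl.
  - apply (is_derive_const (V := R_NormedModule) 0 t).
  - apply (is_derive_plus (V := R_NormedModule) (f a)).
    + apply H; now left.
    + apply IH; intros; apply H; now right.
Qed.

Definition is_derive_C (f : R -> C) (t : R) (l : C) : Prop :=
  is_derive (fun s => Re (f s)) t (Re l) /\ is_derive (fun s => Im (f s)) t (Im l).

Lemma energy_sqr (g tau : R) (k : Z2) (z : C) :
  (Wt g tau k * Cmod z) ^ 2 =
  knorm k ^ 8 * exp (2 * lam g k * tau) * (Re z ^ 2 + Im z ^ 2).
Proof.
  rewrite <- Cmod2_alt, Rpow_mult_distr. f_equal. unfold Wt, ew.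
  rewrite Rpow_mult_distr. f_equal; [ring|].
  replace (2 * lam g k * tau) with (tau * lam g k + tau * lam g k) by ring.
  rewrite exp_plus. ring.
Qed.

Lemma energy_derive (g tau0 beta t0 t : R) (L : list Z2) (v : R -> coeffs) (F : coeffs) :
  (forall k, In k L -> is_derive_C (fun s => v s k) t (F k)) ->
  let tau := tau0 - beta * (t - t0) in
  is_derive (fun s => energy g (tau0 - beta * (s - t0)) L (v s)) t
    (- 2 * beta * dissip g tau L (v t) +
     2 * lsum L (fun k => Wt g tau k ^ 2 * Re (Cconj (v t k) * F k)%C)).
Proof.
  intros H tau.
  replace (- 2 * beta * dissip g tau L (v t) +
     2 * lsum L (fun k => Wt g tau k ^ 2 * Re (Cconj (v t k) * F k)%C))
    with (lsum L (fun k => - 2 * beta * ydens g tau (fun k => Cmod (v t k)) k +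
      2 * (Wt g tau k ^ 2 * Re (Cconj (v t k) * F k)%C)))
    by (rewrite lsum_plus; f_equal; apply lsum_scal).
  unfold energy. apply is_derive_lsum. intros k Hk. destruct (H k Hk) as [HR HI].
  apply is_derive_ext with (fun s => knorm k ^ 8 * exp (2 * lam g k * (tau0 - beta * (s - t0)))
    * (Re (v s k) ^ 2 + Im (v s k) ^ 2)).
  { intros s. now rewrite energy_sqr. }
  set (c := knorm k ^ 8). set (x := fun s => Re (v s k)) in *. set (y := fun s => Im (v s k)) in *.
  change (is_derive (fun s => c * exp (2 * lam g k * (tau0 - beta * (s - t0))) * (x s ^ 2 + y s ^ 2)) t
    (- 2 * beta * ydens g tau (fun k => Cmod (v t k)) k +
      2 * (Wt g tau k ^ 2 * Re (Cconj (v t k) * F k)%C))).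
  unfold ydens. rewrite energy_sqr. fold c.
  replace (Wt g tau k ^ 2) with (c * exp (2 * lam g k * tau)).
  2:{ unfold c, Wt, ew. rewrite Rpow_mult_distr. f_equal; [ring|].
      replace (2 * lam g k * tau) with (tau * lam g k + tau * lam g k) by ring.
      rewrite exp_plus. ring. }
  replace (Re (Cconj (v t k) * F k)%C) with (x t * Re (F k) + y t * Im (F k)).
  2:{ unfold x, y, Cconj, Cmult, Re, Im; simpl. ring. }
  fold (x t) (y t). change (is_derive x t (Re (F k))) in HR. change (is_derive y t (Im (F k))) in HI.
  clearbody x y c.
  auto_derive.
  - split; [exists (Re (F k)); exact HR|]. split; [exists (Im (F k)); exact HI|auto].
  - replace (Derive (fun x0 : R => x x0) t) with (Re (F k)) by (symmetry; exact (is_derive_unique _ _ _ HR)).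
    replace (Derive (fun x0 : R => y x0) t) with (Im (F k)) by (symmetry; exact (is_derive_unique _ _ _ HI)).
    unfold tau. replace (tau0 + - (beta * (t + - t0))) with (tau0 - beta * (t - t0)) by ring. ring.
Qed.

(** All that a solution provides at the initial time: the equation itself is imposed for t > 0
    only. *)
Definition right_cont (f : R -> R) (a : R) : Prop := filterlim f (at_right a) (locally (f a)).

Lemma right_cont_continuous (f : R -> R) (a : R) : continuous f a -> right_cont f a.
Proof.
  intros H. apply filterlim_filter_le_1 with (2 := H). apply filter_le_within.
Qed.

Lemma right_cont_plus (f h : R -> R) (a : R) :
  right_cont f a -> right_cont h a -> right_cont (fun t => f t + h t) a.
Proof.
  intros Hf Hh. unfold right_cont.
  apply (filterlim_comp_2 f h Rplus Hf Hh), (filterlim_plus (V := R_NormedModule)).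
Qed.

Lemma right_cont_mult (f h : R -> R) (a : R) :
  right_cont f a -> right_cont h a -> right_cont (fun t => f t * h t) a.
Proof.
  intros Hf Hh. unfold right_cont.
  apply (filterlim_comp_2 f h Rmult Hf Hh), (filterlim_mult (K := R_AbsRing)).
Qed.

Lemma right_cont_ext (f h : R -> R) (a : R) :
  (forall t, f t = h t) -> right_cont f a -> right_cont h a.
Proof.
  intros H Hf. unfold right_cont. rewrite <- H. revert Hf. now apply filterlim_ext.
Qed.

Lemma right_cont_lsum {A : Type} (L : list A) (f : A -> R -> R) (a : R) :
  (forall k, In k L -> right_cont (f k) a) -> right_cont (fun s => lsum L (fun k => f k s)) a.
Proof.
  induction L as [|b L IH]; intros H; simpl.
  - apply right_cont_continuous, continuous_const.
  - apply (right_cont_plus (f b)).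
    + apply H; now left.
    + apply IH; intros; apply H; now right.
Qed.

Definition right_cont_C (f : R -> C) (a : R) : Prop :=
  right_cont (fun s => Re (f s)) a /\ right_cont (fun s => Im (f s)) a.

Lemma energy_right_cont (g tau0 beta t0 a : R) (L : list Z2) (v : R -> coeffs) :
  (forall k, In k L -> right_cont_C (fun s => v s k) a) ->
  right_cont (fun s => energy g (tau0 - beta * (s - t0)) L (v s)) a.
Proof.
  intros H. unfold energy. apply right_cont_lsum. intros k Hk. destruct (H k Hk) as [HR HI].
  apply right_cont_ext with (fun s => knorm k ^ 8 * exp (2 * lam g k * (tau0 - beta * (s - t0)))
    * (Re (v s k) * Re (v s k) + Im (v s k) * Im (v s k))).
  { intros s. rewrite energy_sqr. ring. }
  apply right_cont_mult.
  - apply right_cont_continuous, (ex_derive_continuous (V := R_NormedModule)). auto_derive. auto.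
  - apply right_cont_plus; now apply right_cont_mult.
Qed.

Lemma derive_le_growth (f df : R -> R) (a b c : R) :
  (forall t, a < t < b -> is_derive f t (df t) /\ df t <= c) -> right_cont f a ->
  forall t, a <= t < b -> f t <= f a + c * (t - a).
Proof.
  intros Hd Hc t Ht. destruct (Rle_lt_or_eq_dec a t (proj1 Ht)) as [Hat| <-]; [|lra].
  assert (Hst : forall s, a < s < t -> f t - c * t <= f s - c * s).
  { intros s Hs.
    (* Truncating the derivative by c makes the bound available at whatever point the mean value
       theorem returns. Afterwards s tends to a from the right. *)
    destruct (MVT_gen f s t (fun x => Rmin (df x) c)) as [x [_ Hx]].
    - rewrite Rmin_left, Rmax_right by lra. intros x Hx.
      destruct (Hd x ltac:(lra)) as [D1 D2]. now rewrite Rmin_left.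
    - rewrite Rmin_left, Rmax_right by lra. intros x Hx.
      destruct (Hd x ltac:(lra)) as [D1 D2]. apply continuity_pt_filterlim.
      apply (ex_derive_continuous (V := R_NormedModule)). now exists (df x).
    - pose proof (Rmin_r (df x) c). nra. }
  assert (Hlim : right_cont (fun s => f s - c * s) a).
  { apply (right_cont_plus f (fun s => - (c * s))); [assumption|].
    apply right_cont_continuous, (ex_derive_continuous (V := R_NormedModule)). auto_derive. auto. }
  assert (Hle : Rbar_le (f t - c * t) (f a - c * a)).
  { eapply (filterlim_le (F := at_right a) (fun _ => f t - c * t) (fun s => f s - c * s)).
    - assert (Hpos : 0 < t - a) by lra. exists (mkposreal _ Hpos). intros s Hs Has.
      apply Hst. split; [assumption|].
      unfold ball in Hs; simpl in Hs. unfold AbsRing_ball, abs, minus, plus, opp in Hs; simpl in Hs.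
      apply Rabs_def2 in Hs. lra.
    - apply filterlim_const.
    - exact Hlim. }
  simpl in Hle. lra.
Qed.

(** * Picard iteration *)

Lemma lipschitz_continuous (f : R -> R) (K : R) :
  (forall s t, Rabs (f s - f t) <= K * Rabs (s - t)) -> forall t, continuous f t.
Proof.
  intros H t. apply continuity_pt_filterlim. intros eps Heps.
  assert (HK : 0 < Rabs K + 1) by (pose proof (Rabs_pos K); lra).
  exists (eps / (Rabs K + 1)). split; [now apply Rdiv_lt_0_compat|].
  intros s [_ Hs]. simpl in *. unfold R_dist in *.
  eapply Rle_lt_trans; [apply H|].
  apply Rle_lt_trans with ((Rabs K + 1) * Rabs (s - t)).
  - apply Rmult_le_compat_r; [apply Rabs_pos|]. pose proof (Rle_abs K). lra.
  - apply Rlt_le_trans with ((Rabs K + 1) * (eps / (Rabs K + 1))).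
    + now apply Rmult_lt_compat_l.
    + right; field; lra.
Qed.

Lemma continuous_ex_RInt (f : R -> R) (a b : R) : (forall t, continuous f t) -> ex_RInt f a b.
Proof. intros H. apply (ex_RInt_continuous (V := R_CompleteNormedModule)). auto. Qed.

Lemma RInt_continuous_derive (f : R -> R) (a t : R) : (forall t, continuous f t) ->
  is_derive (fun s => RInt f a s) t (f t).
Proof.
  intros H. apply (is_derive_RInt f _ a t); [|apply H].
  exists (mkposreal 1 Rlt_0_1). intros s _. apply (RInt_correct f), continuous_ex_RInt, H.
Qed.

Lemma RInt_lipschitz (f : R -> R) (M a s t : R) : (forall t, continuous f t) ->
  (forall t, Rabs (f t) <= M) -> Rabs (RInt f a s - RInt f a t) <= M * Rabs (s - t).
Proof.
  intros Hc HM.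
  assert (Hst : forall s t, t <= s -> Rabs (RInt f a s - RInt f a t) <= M * Rabs (s - t)).
  { intros u v Huv. rewrite <- (RInt_Chasles f a v u) by now apply continuous_ex_RInt.
    change (Rabs (RInt f a v + RInt f v u - RInt f a v) <= M * Rabs (u - v)).
    rewrite Rplus_minus_l.
    rewrite (Rabs_pos_eq (u - v)), Rmult_comm by lra.
    apply abs_RInt_le_const; auto. now apply continuous_ex_RInt. }
  destruct (Rle_dec t s); [auto|].
  rewrite Rabs_minus_sym, (Rabs_minus_sym s). apply Hst. lra.
Qed.

Lemma Rmax_0_lipschitz (s t : R) : Rabs (Rmax 0 s - Rmax 0 t) <= Rabs (s - t).
Proof.
  unfold Rmax. destruct (Rle_dec 0 s), (Rle_dec 0 t); unfold Rabs;
    repeat destruct Rcase_abs; lra.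
Qed.

Section Picard.
Context {I : Type}.
Variables (F : (I -> R) -> I -> R) (M K : R) (x0 : I -> R).
Hypotheses (HK : 1 <= K) (HM : 0 <= M) (HF : forall y i, Rabs (F y i) <= M)
  (HL : forall y z rho, 0 <= rho -> (forall i, Rabs (y i - z i) <= rho) ->
        forall i, Rabs (F y i - F z i) <= K * rho).

(** [Rmax 0 s] freezes the integrand at negative times, which makes it continuous on the whole line
    and gives a two-sided derivative at t = 0. *)
Definition picard_step (X : R -> I -> R) (t : R) (i : I) : R :=
  x0 i + RInt (fun s => F (X (Rmax 0 s)) i) 0 t.

Definition time_lip (X : R -> I -> R) : Prop :=
  forall s t i, Rabs (X s i - X t i) <= M * Rabs (s - t).

Lemma picard_integrand_continuous (X : R -> I -> R) (i : I) : time_lip X ->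
  forall t, continuous (fun s => F (X (Rmax 0 s)) i) t.
Proof.
  intros HX. apply (lipschitz_continuous _ (K * M)). intros s t.
  rewrite Rmult_assoc. apply HL; [apply Rmult_le_pos; [assumption|apply Rabs_pos]|]. intros j. eapply Rle_trans; [apply HX|].
  apply Rmult_le_compat_l; [assumption|apply Rmax_0_lipschitz].
Qed.

Lemma picard_step_lip (X : R -> I -> R) : time_lip X -> time_lip (picard_step X).
Proof.
  intros HX s t i. unfold picard_step.
  replace (x0 i + RInt (fun s => F (X (Rmax 0 s)) i) 0 s -
    (x0 i + RInt (fun s => F (X (Rmax 0 s)) i) 0 t))
    with (RInt (fun s => F (X (Rmax 0 s)) i) 0 s - RInt (fun s => F (X (Rmax 0 s)) i) 0 t) by ring.
  apply RInt_lipschitz; [now apply picard_integrand_continuous|auto].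
Qed.

(* The weight [exp (2 K t)] turns the Picard map into a contraction of ratio 1/2. *)
Lemma picard_step_contract (X Y : R -> I -> R) (A : R) : 0 <= A -> time_lip X -> time_lip Y ->
  (forall t i, 0 <= t -> Rabs (X t i - Y t i) <= A * exp (2 * K * t)) ->
  forall t i, 0 <= t ->
    Rabs (picard_step X t i - picard_step Y t i) <= A / 2 * exp (2 * K * t).
Proof.
  intros HA HX HY H t i Ht. unfold picard_step.
  set (fX := fun s => F (X (Rmax 0 s)) i). set (fY := fun s => F (Y (Rmax 0 s)) i).
  assert (cX : forall t, continuous fX t) by now apply picard_integrand_continuous.
  assert (cY : forall t, continuous fY t) by now apply picard_integrand_continuous.
  replace (x0 i + RInt fX 0 t - (x0 i + RInt fY 0 t)) with (RInt fX 0 t - RInt fY 0 t) by ring.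
  replace (RInt fX 0 t - RInt fY 0 t) with (RInt (fun s => fX s - fY s) 0 t)
    by (apply (RInt_minus fX fY); now apply continuous_ex_RInt).
  assert (cD : forall t, continuous (fun s => fX s - fY s) t).
  { intros s. apply (continuous_minus fX fY); auto. }
  set (h := fun s => K * (A * exp (2 * K * s))).
  assert (Hh : is_RInt h 0 t (A / 2 * exp (2 * K * t) - A / 2 * exp (2 * K * 0))).
  { apply (is_RInt_derive (fun s => A / 2 * exp (2 * K * s)) h).
    - intros s _. unfold h. auto_derive; [auto|field].
    - intros s _. apply (ex_derive_continuous (V := R_NormedModule)). unfold h. auto_derive. auto. }
  eapply Rle_trans; [apply abs_RInt_le; [assumption|now apply continuous_ex_RInt]|].
  apply Rle_trans with (RInt h 0 t).
  - apply RInt_le; [assumption| | |].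
    + apply continuous_ex_RInt. intros s. apply (continuous_comp (fun s => fX s - fY s) Rabs); auto.
      apply continuity_pt_filterlim, Rcontinuity_abs.
    + eexists; exact Hh.
    + intros s Hs. unfold fX, fY, h.
      apply HL; [apply Rmult_le_pos; [assumption|apply Rlt_le, exp_pos]|]. intros j.
      rewrite Rmax_right by lra. apply H; lra.
  - rewrite (is_RInt_unique _ _ _ _ Hh), Rmult_0_r, exp_0. lra.
Qed.

Fixpoint picard (n : nat) : R -> I -> R :=
  match n with
  | O => fun _ => x0
  | S n => picard_step (picard n)
  end.

Lemma picard_lip (n : nat) : time_lip (picard n).
Proof.
  induction n; [|now apply picard_step_lip].
  intros s t i. simpl. rewrite Rminus_diag, Rabs_R0.
  apply Rmult_le_pos; [assumption|apply Rabs_pos].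
Qed.

Lemma picard_increment (n : nat) (t : R) (i : I) : 0 <= t ->
  Rabs (picard (S n) t i - picard n t i) <= M / 2 ^ n * exp (2 * K * t).
Proof.
  revert t i. induction n; intros t i Ht.
  - simpl. unfold picard_step.
    rewrite Rplus_minus_l, RInt_const. change (Rabs ((t - 0) * F x0 i) <= M / 1 * exp (2 * K * t)).
    rewrite Rabs_mult, (Rabs_pos_eq (t - 0)) by lra. specialize (HF x0 i).
    pose proof (exp_ineq1_le (2 * K * t)).
    assert (t <= exp (2 * K * t)) by nra.
    pose proof (Rabs_pos (F x0 i)).
    apply Rle_trans with (exp (2 * K * t) * M); [|right; field].
    apply Rmult_le_compat; lra.
  - replace (M / 2 ^ S n) with (M / 2 ^ n / 2) by (simpl; field; apply pow_nonzero; lra).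
    apply (picard_step_contract (picard (S n)) (picard n)); auto using picard_lip.
    apply Rmult_le_pos; [assumption|]. apply Rlt_le, Rinv_0_lt_compat, pow_lt. lra.
Qed.

Lemma picard_cauchy (n m : nat) (t : R) (i : I) : 0 <= t ->
  Rabs (picard (n + m) t i - picard n t i) <= 2 * (M / 2 ^ n) * exp (2 * K * t).
Proof.
  intros Ht. set (E := exp (2 * K * t)).
  assert (HE : 0 < E) by apply exp_pos.
  (* The stated bound is not inductive; subtracting the geometric tail that is still to come makes
     it so. *)
  enough (H : Rabs (picard (n + m) t i - picard n t i) <= (2 * (M / 2 ^ n) - 2 * (M / 2 ^ (n + m))) * E).
  { assert (0 <= 2 * (M / 2 ^ (n + m)) * E); [|lra].
    apply Rmult_le_pos; [|lra]. apply Rmult_le_pos; [lra|].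
    apply Rmult_le_pos; [assumption|]. apply Rlt_le, Rinv_0_lt_compat, pow_lt. lra. }
  induction m.
  - rewrite Nat.add_0_r, !Rminus_diag, Rabs_R0. lra.
  - rewrite Nat.add_succ_r.
    replace (picard (S (n + m)) t i - picard n t i)
      with ((picard (S (n + m)) t i - picard (n + m) t i) + (picard (n + m) t i - picard n t i)) by ring.
    eapply Rle_trans; [apply Rabs_triang|].
    pose proof (picard_increment (n + m) t i Ht) as H. fold E in H.
    replace (M / 2 ^ S (n + m)) with (M / 2 ^ (n + m) / 2) by (simpl; field; apply pow_nonzero; lra).
    lra.
Qed.

Definition picard_lim (t : R) (i : I) : R := real (Lim_seq (fun n => picard n t i)).

Lemma inv_pow2_small (A eps : R) : 0 <= A -> 0 < eps -> exists N, forall n, (N <= n)%nat -> A / 2 ^ n < eps.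
Proof.
  intros HA Heps.
  destruct (pow_lt_1_zero (/ 2) ltac:(rewrite Rabs_pos_eq; lra) (eps / (A + 1))) as [N HN].
  { apply Rdiv_lt_0_compat; lra. }
  exists N. intros n Hn. specialize (HN n Hn).
  rewrite Rabs_pos_eq in HN by (apply pow_le; lra). rewrite pow_inv in HN.
  assert (H2 : 0 < / 2 ^ n) by (apply Rinv_0_lt_compat, pow_lt; lra).
  apply Rle_lt_trans with ((A + 1) * / 2 ^ n); [unfold Rdiv; nra|].
  apply Rlt_le_trans with ((A + 1) * (eps / (A + 1))); [apply Rmult_lt_compat_l; lra|].
  right; field; lra.
Qed.

Lemma picard_lim_correct (t : R) (i : I) : 0 <= t ->
  is_lim_seq (fun n => picard n t i) (picard_lim t i).
Proof.
  intros Ht. apply Lim_seq_correct', ex_lim_seq_cauchy_corr.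
  intros eps. set (E := exp (2 * K * t)).
  assert (HE : 0 < E) by apply exp_pos.
  destruct (inv_pow2_small (4 * M * E) eps) as [N HN].
  { apply Rmult_le_pos; lra. } { apply cond_pos. }
  exists N. intros n m Hn Hm.
  pose proof (picard_cauchy N (n - N) t i Ht) as H1. pose proof (picard_cauchy N (m - N) t i Ht) as H2.
  replace (N + (n - N))%nat with n in H1 by lia. replace (N + (m - N))%nat with m in H2 by lia.
  fold E in H1, H2. specialize (HN N (le_n N)).
  replace (picard n t i - picard m t i)
    with ((picard n t i - picard N t i) - (picard m t i - picard N t i)) by ring.
  eapply Rle_lt_trans; [apply Rabs_triang|]. rewrite Rabs_Ropp.
  unfold Rdiv in *. lra.
Qed.

Lemma picard_lim_error (n : nat) (t : R) (i : I) : 0 <= t ->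
  Rabs (picard_lim t i - picard n t i) <= 2 * (M / 2 ^ n) * exp (2 * K * t).
Proof.
  intros Ht. pose proof (picard_lim_correct t i Ht) as Hl.
  apply (is_lim_seq_incr_n _ n) in Hl.
  apply (is_lim_seq_minus' _ (fun _ => picard n t i) _ (picard n t i)) in Hl;
    [|apply is_lim_seq_const].
  apply (is_lim_seq_abs _ (Finite _)) in Hl.
  exact (is_lim_seq_le _ (fun _ => 2 * (M / 2 ^ n) * exp (2 * K * t)) _ (Finite _)
    (fun m => eq_ind_r (fun j => Rabs (picard j t i - picard n t i) <= _)
       (picard_cauchy n m t i Ht) (Nat.add_comm m n)) Hl (is_lim_seq_const _)).
Qed.

Lemma picard_lim_lip (s t : R) (i : I) : 0 <= s -> 0 <= t ->
  Rabs (picard_lim s i - picard_lim t i) <= M * Rabs (s - t).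
Proof.
  intros Hs Ht.
  pose proof (is_lim_seq_minus' _ _ _ _ (picard_lim_correct s i Hs) (picard_lim_correct t i Ht)) as Hl.
  apply (is_lim_seq_abs _ (Finite _)) in Hl.
  exact (is_lim_seq_le _ (fun _ => M * Rabs (s - t)) _ (Finite _)
    (fun n => picard_lip n s t i) Hl (is_lim_seq_const _)).
Qed.

(** The field is bounded and globally Lipschitz, so the solution is global. Closeness of states is a
    common bound [rho] on all coordinates, which allows an infinite index type without a norm on I
    -> R. *)
Theorem picard_lindelof : exists x : R -> I -> R,
  (forall i, x 0 i = x0 i) /\
  (forall t i, 0 <= t -> is_derive (fun s => x s i) t (F (x t) i)).
Proof.
  (* The limit is controlled for t >= 0 only; freezing it at negative times keeps it Lipschitz on
     the whole line. *)
  set (Y := fun t => picard_lim (Rmax 0 t)).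
  assert (HYl : time_lip Y).
  { intros s t i. unfold Y. eapply Rle_trans; [apply picard_lim_lip; apply Rmax_l|].
    apply Rmult_le_compat_l; [assumption|apply Rmax_0_lipschitz]. }
  assert (Hfix : forall t i, 0 <= t -> picard_step Y t i = Y t i).
  { intros t i Ht. apply cond_eq. intros eps Heps. set (E := exp (2 * K * t)).
    assert (HE : 0 < E) by apply exp_pos.
    destruct (inv_pow2_small (4 * M * E) eps) as [n Hn]; [apply Rmult_le_pos; lra|assumption|].
    specialize (Hn n (le_n n)).
    assert (Hn2 : 0 <= M / 2 ^ n).
    { apply Rmult_le_pos; [assumption|]. apply Rlt_le, Rinv_0_lt_compat, pow_lt. lra. }
    assert (H1 : Rabs (picard_step Y t i - picard_step (picard n) t i) <= 2 * (M / 2 ^ n) / 2 * E).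
    { apply picard_step_contract; auto using picard_lip; [lra|].
      intros s j Hs. unfold Y. rewrite Rmax_right by assumption. now apply picard_lim_error. }
    pose proof (picard_lim_error (S n) t i Ht) as H2. fold E in H2.
    unfold Y in H1 |- *. rewrite (Rmax_right 0 t) by assumption.
    replace (M / 2 ^ S n) with (M / 2 ^ n / 2) in H2 by (simpl; field; apply pow_nonzero; lra).
    change (picard (S n) t i) with (picard_step (picard n) t i) in H2.
    rewrite Rabs_minus_sym in H2.
    replace (picard_step (fun t0 => picard_lim (Rmax 0 t0)) t i - picard_lim t i)
      with ((picard_step (fun t0 => picard_lim (Rmax 0 t0)) t i - picard_step (picard n) t i)
        + (picard_step (picard n) t i - picard_lim t i)) by ring.
    eapply Rle_lt_trans; [apply Rabs_triang|].
    replace (4 * M * E / 2 ^ n) with (4 * (M / 2 ^ n) * E) in Hn by (field; apply pow_nonzero; lra).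
    assert (0 <= M / 2 ^ n * E) by (apply Rmult_le_pos; lra). lra. }
  (* The image of Y under the Picard map, equal to Y for t >= 0, is an integral and hence
     differentiable from both sides at t = 0; Y itself need not be. *)
  exists (picard_step Y). split.
  - intros i. unfold picard_step. rewrite RInt_point. apply Rplus_0_r.
  - intros t i Ht.
    (* The Lipschitz bound with rho = 0 turns pointwise equality of the arguments into equality of
       the values. *)
    assert (E : F (picard_step Y t) i = F (Y (Rmax 0 t)) i).
    { assert (H0 : Rabs (F (picard_step Y t) i - F (Y (Rmax 0 t)) i) <= K * 0).
      { apply HL; [lra|]. intros j. rewrite Hfix by assumption.
        rewrite (Rmax_right 0 t) by assumption. rewrite Rminus_diag, Rabs_R0. lra. }
      rewrite Rmult_0_r in H0. apply Rabs_le_between in H0. lra. }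
    rewrite E. unfold picard_step.
    replace (F (Y (Rmax 0 t)) i) with (plus 0 (F (Y (Rmax 0 t)) i)) by apply Rplus_0_l.
    apply (is_derive_plus (V := R_NormedModule) (fun _ => x0 i)).
    + apply (is_derive_const (V := R_NormedModule)).
    + apply (RInt_continuous_derive (fun s => F (Y (Rmax 0 s)) i)).
      now apply picard_integrand_continuous.
Qed.

End Picard.

(** * Galerkin truncations *)

Lemma lsum_perm {A : Type} (L L' : list A) (f : A -> R) :
  Permutation L L' -> lsum L f = lsum L' f.
Proof. intros H. induction H; simpl; lra. Qed.

Lemma Z2opp_involutive (k : Z2) : Z2opp (Z2opp k) = k.
Proof. destruct k; unfold Z2opp; simpl; f_equal; lia. Qed.

Lemma in_box_opp (N : nat) (k : Z2) : In (Z2opp k) (box N) <-> In k (box N).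
Proof. rewrite !in_box. unfold Z2opp; simpl. lia. Qed.

Lemma lsum_box_opp (N : nat) (f : Z2 -> R) : lsum (box N) (fun k => f (Z2opp k)) = lsum (box N) f.
Proof.
  rewrite <- lsum_map. apply lsum_perm, NoDup_Permutation.
  - apply Injective_map_NoDup; [|apply NoDup_box]. intros k l E.
    now rewrite <- (Z2opp_involutive k), E, Z2opp_involutive.
  - apply NoDup_box.
  - intros k. rewrite in_map_iff. split.
    + intros [l [<- Hl]]. now apply in_box_opp.
    + intros Hk. exists (Z2opp k). split; [apply Z2opp_involutive|now apply in_box_opp].
Qed.

Definition conj_sym (a : coeffs) : Prop := forall k, a (Z2opp k) = Cconj (a k).

Lemma bterm_opp (alpha : R) (a b : coeffs) (k l : Z2) : conj_sym a -> conj_sym b ->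
  bterm alpha a b (Z2opp k) (Z2opp l) = Cconj (bterm alpha a b k l).
Proof.
  intros Ha Hb. unfold bterm.
  assert (E : Z2sub (Z2opp k) (Z2opp l) = Z2opp (Z2sub k l)).
  { destruct k, l; unfold Z2sub, Z2opp; simpl; f_equal; lia. }
  rewrite E, kap_opp, Ha, Hb.
  assert (E2 : kap alpha (Z2sub k l) (Z2opp l) = - kap alpha (Z2sub k l) l).
  { unfold kap, Z2opp; simpl. rewrite !opp_IZR. ring. }
  rewrite E2.
  destruct (a (Z2sub k l)), (b l). unfold Cconj, Cmult, Ci, RtoC; simpl.
  apply injective_projections; simpl; ring.
Qed.

Lemma Bil_opp (alpha : R) (n : nat) (a b : coeffs) (k : Z2) :
  conj_sym a -> conj_sym b -> supported n b ->
  Bil alpha a b (Z2opp k) = Cconj (Bil alpha a b k).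
Proof.
  intros Ha Hb Hs. rewrite !(Bil_supported_r alpha n) by assumption.
  unfold Cconj; cbn [fst snd]. f_equal.
  - rewrite <- (lsum_box_opp n (fun l => Re (bterm alpha a b (Z2opp k) l))). apply lsum_ext. intros l _. cbv beta. now rewrite bterm_opp.
  - rewrite <- (lsum_box_opp n (fun l => Im (bterm alpha a b (Z2opp k) l))).
    rewrite <- (Rmult_1_l (lsum _ (fun l => Im (bterm alpha a b k l)))), Ropp_mult_distr_l, <- lsum_scal.
    apply lsum_ext. intros l _. cbv beta. rewrite bterm_opp by assumption.
    unfold Cconj, Im; simpl. ring.
Qed.

(** The mean is conserved: by [kap_shift] the kernel is linear in the output frequency, which is
    zero here. *)
Lemma Bil_zero_mode (alpha : R) (a b : coeffs) : Bil alpha a b (0, 0)%Z = RtoC 0.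
Proof.
  unfold Bil. rewrite (zsumC_supported _ O).
  - rewrite !lsum_zero; [reflexivity| |]; intros l _; unfold bterm;
      rewrite <- kap_shift, kap_zero_r, Cmult_0_r, !Cmult_0_l; reflexivity.
  - intros l _. unfold bterm. rewrite <- kap_shift, kap_zero_r. ring.
Qed.

(** * The algebra of bounded Lipschitz functionals *)

Section BoundedLipschitz.
Context {I : Type}.
Implicit Types G H : (I -> R) -> R.

(** Boundedness is carried along because it is what makes products Lipschitz again; polynomials in
    clamped coordinates then meet the hypotheses of [picard_lindelof]. *)
Definition bdlip (M K : R) G : Prop :=
  0 <= M /\ 0 <= K /\ (forall y, Rabs (G y) <= M) /\
  (forall y z rho, 0 <= rho -> (forall i, Rabs (y i - z i) <= rho) -> Rabs (G y - G z) <= K * rho).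

Definition BL G : Prop := exists M K, bdlip M K G.

Lemma BL_ext G H : (forall y, G y = H y) -> BL G -> BL H.
Proof.
  intros E (M & K & HM & HK & H1 & H2). exists M, K. repeat split; auto; intros.
  - now rewrite <- E.
  - rewrite <- !E. auto.
Qed.

Lemma BL_const (c : R) : BL (fun _ => c).
Proof.
  exists (Rabs c), 0. split; [apply Rabs_pos|]. split; [lra|]. split; [intros; lra|].
  intros. rewrite Rminus_diag, Rabs_R0. lra.
Qed.

Lemma BL_plus G H : BL G -> BL H -> BL (fun y => G y + H y).
Proof.
  intros (M & K & HM & HK & H1 & H2) (M' & K' & HM' & HK' & H1' & H2').
  exists (M + M'), (K + K'). repeat split; try lra.
  - intros y. eapply Rle_trans; [apply Rabs_triang|]. specialize (H1 y). specialize (H1' y). lra.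
  - intros y z rho Hr Hyz. specialize (H2 y z rho Hr Hyz). specialize (H2' y z rho Hr Hyz).
    replace (G y + H y - (G z + H z)) with ((G y - G z) + (H y - H z)) by ring.
    eapply Rle_trans; [apply Rabs_triang|]. lra.
Qed.

Lemma BL_mult G H : BL G -> BL H -> BL (fun y => G y * H y).
Proof.
  intros (M & K & HM & HK & H1 & H2) (M' & K' & HM' & HK' & H1' & H2').
  exists (M * M'), (K * M' + M * K'). repeat split.
  - now apply Rmult_le_pos.
  - apply Rplus_le_le_0_compat; now apply Rmult_le_pos.
  - intros y. rewrite Rabs_mult. apply Rmult_le_compat; auto using Rabs_pos.
  - intros y z rho Hr Hyz. specialize (H2 y z rho Hr Hyz). specialize (H2' y z rho Hr Hyz).
    replace (G y * H y - G z * H z) with ((G y - G z) * H y + G z * (H y - H z)) by ring.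
    eapply Rle_trans; [apply Rabs_triang|]. rewrite !Rabs_mult.
    replace ((K * M' + M * K') * rho) with (K * rho * M' + M * (K' * rho)) by ring.
    apply Rplus_le_compat; apply Rmult_le_compat; auto using Rabs_pos.
Qed.

Lemma BL_lsum {A : Type} (L : list A) (G : A -> (I -> R) -> R) :
  (forall a, In a L -> BL (G a)) -> BL (fun y => lsum L (fun a => G a y)).
Proof.
  induction L as [|a L IH]; intros H; simpl; [apply BL_const|].
  apply (BL_plus (G a)); [apply H; now left|]. apply IH; intros; apply H; now right.
Qed.

Lemma BL_uniform {A : Type} (L : list A) (G : A -> (I -> R) -> R) :
  (forall a, In a L -> BL (G a)) -> exists M K, forall a, In a L -> bdlip M K (G a).
Proof.
  induction L as [|a L IH]; intros H; [exists 0, 0; easy|].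
  destruct IH as (M & K & HMK); [intros; apply H; now right|].
  destruct (H a (or_introl eq_refl)) as (M' & K' & HM' & HK' & H1' & H2').
  assert (Hmono : forall m k M K G, m <= M -> k <= K -> bdlip m k G -> bdlip M K G).
  { intros m k M1 K1 G1 Hm Hk (Q1 & Q2 & Q3 & Q4). repeat split; try lra.
    - intros y. specialize (Q3 y). lra.
    - intros y z rho Hr Hyz. eapply Rle_trans; [exact (Q4 y z rho Hr Hyz)|]. now apply Rmult_le_compat_r. }
  exists (Rmax M M'), (Rmax K K'). intros b [<-|Hb].
  - apply (Hmono M' K'); try apply Rmax_r. now repeat split.
  - apply (Hmono M K); try apply Rmax_l. auto.
Qed.

Lemma BL_clamp (B : R) (i : I) : 0 <= B -> BL (fun y => Rmax (- B) (Rmin B (y i))).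
Proof.
  intros HB. exists B, 1. repeat split; try lra.
  - intros y. apply Rabs_le. split; [apply Rmax_l|].
    apply Rmax_lub; [lra|apply Rmin_l].
  - intros y z rho Hr Hyz. eapply Rle_trans; [|rewrite Rmult_1_l; apply (Hyz i)].
    unfold Rmax, Rmin. repeat destruct Rle_dec; unfold Rabs; repeat destruct Rcase_abs; lra.
Qed.

End BoundedLipschitz.

Lemma Re_Cconj_lsum (z : C) (L : list Z2) (f : Z2 -> C) :
  Re (Cconj z * (lsum L (fun l => Re (f l)), lsum L (fun l => Im (f l))))%C =
  lsum L (fun l => Re (Cconj z * f l)%C).
Proof.
  rewrite (lsum_ext L (fun l => Re (Cconj z * f l)%C)
    (fun l => Re z * Re (f l) + Im z * Im (f l))).
  - rewrite lsum_plus, !lsum_scal. unfold Cconj, Cmult, Re, Im; simpl. ring.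
  - intros l _. unfold Cconj, Cmult, Re, Im; simpl. ring.
Qed.

(** * The clamped Galerkin system *)

Section Galerkin.
Variables (alpha B : R) (N : nat).
Hypothesis HB : 0 <= B.

Definition clamp (x : R) : R := Rmax (- B) (Rmin B x).

(** The boolean selects the real (true) or imaginary (false) part. Averaging the modes k and -k
    builds conjugate symmetry into the field for every state y, symmetric or not. *)
Definition clamp_modes (y : Z2 * bool -> R) (k : Z2) : C :=
  if in_dec Z2_eq_dec k (box N) then
    (/ 2 * (clamp (y (k, true)) + clamp (y (Z2opp k, true))),
     / 2 * (clamp (y (k, false)) + - clamp (y (Z2opp k, false))))
  else RtoC 0.

Definition galerkin_field (y : Z2 * bool -> R) (i : Z2 * bool) : R :=
  if in_dec Z2_eq_dec (fst i) (box N) then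
    let z := Bil alpha (clamp_modes y) (clamp_modes y) (fst i) in
    - (if snd i then Re z else Im z)
  else 0.

Lemma clamp_modes_conj (y : Z2 * bool -> R) : conj_sym (clamp_modes y).
Proof.
  intros k. unfold clamp_modes. rewrite Z2opp_involutive.
  destruct (in_dec Z2_eq_dec (Z2opp k) (box N)) as [H|H];
    destruct (in_dec Z2_eq_dec k (box N)) as [H'|H'].
  - unfold Cconj; simpl. f_equal; ring.
  - destruct H'. now apply in_box_opp.
  - destruct H. now apply in_box_opp.
  - unfold Cconj, RtoC; simpl. f_equal; ring.
Qed.

Lemma clamp_modes_supported (y : Z2 * bool -> R) : supported N (clamp_modes y).
Proof.
  intros k Hk. unfold clamp_modes. now destruct (in_dec Z2_eq_dec k (box N)).
Qed.

Lemma BL_scal {I : Type} (c : R) (G : (I -> R) -> R) : BL G -> BL (fun y => c * G y).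
Proof. apply BL_mult, BL_const. Qed.

Lemma BL_opp {I : Type} (G : (I -> R) -> R) : BL G -> BL (fun y => - G y).
Proof.
  intros H. apply (BL_ext (fun y => (-1) * G y)); [intros; ring|now apply BL_scal].
Qed.

Lemma BL_clamp_modes_Re (k : Z2) : BL (fun y => Re (clamp_modes y k)).
Proof.
  unfold clamp_modes. destruct (in_dec Z2_eq_dec k (box N)); [|apply BL_const].
  simpl. apply BL_scal, BL_plus; now apply BL_clamp.
Qed.

Lemma BL_clamp_modes_Im (k : Z2) : BL (fun y => Im (clamp_modes y k)).
Proof.
  unfold clamp_modes. destruct (in_dec Z2_eq_dec k (box N)); [|apply BL_const].
  simpl. apply BL_scal, BL_plus; [now apply BL_clamp|]. apply BL_opp. now apply BL_clamp.
Qed.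

Lemma galerkin_field_BL (i : Z2 * bool) : BL (fun y => galerkin_field y i).
Proof.
  unfold galerkin_field. destruct i as [k b]; cbn [fst snd]; cbv zeta.
  destruct (in_dec Z2_eq_dec k (box N)); [|apply BL_const].
  apply BL_opp. destruct b.
  - apply (BL_ext (fun y => lsum (box N) (fun l => (- kap alpha (Z2sub k l) l) *
      (Re (clamp_modes y (Z2sub k l)) * Im (clamp_modes y l) +
       Im (clamp_modes y (Z2sub k l)) * Re (clamp_modes y l))))).
    + intros y. rewrite (Bil_supported_r alpha N) by apply clamp_modes_supported.
      apply lsum_ext. intros l _. unfold bterm, Cmult, Ci, RtoC, Re, Im; simpl. ring.
    + apply BL_lsum. intros l _. apply BL_scal, BL_plus; apply BL_mult;
        auto using BL_clamp_modes_Re, BL_clamp_modes_Im.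
  - apply (BL_ext (fun y => lsum (box N) (fun l => (kap alpha (Z2sub k l) l) *
      (Re (clamp_modes y (Z2sub k l)) * Re (clamp_modes y l) +
       - (Im (clamp_modes y (Z2sub k l)) * Im (clamp_modes y l)))))).
    + intros y. rewrite (Bil_supported_r alpha N) by apply clamp_modes_supported.
      apply lsum_ext. intros l _. unfold bterm, Cmult, Ci, RtoC, Re, Im; simpl. ring.
    + apply BL_lsum. intros l _. apply BL_scal, BL_plus; [|apply BL_opp]; apply BL_mult;
        auto using BL_clamp_modes_Re, BL_clamp_modes_Im.
Qed.

(** Only the finitely many components in the box are nonzero, so the constants of the single
    components have a common bound. *)
Lemma galerkin_field_bdlip : exists M K, 0 <= M /\ 1 <= K /\
  (forall y i, Rabs (galerkin_field y i) <= M) /\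
  (forall y z rho, 0 <= rho -> (forall i, Rabs (y i - z i) <= rho) ->
     forall i, Rabs (galerkin_field y i - galerkin_field z i) <= K * rho).
Proof.
  destruct (BL_uniform (list_prod (box N) (true :: false :: nil)) (fun i y => galerkin_field y i))
    as (M & K & H).
  { intros i _. apply galerkin_field_BL. }
  exists (Rabs M), (1 + Rabs K).
  pose proof (Rabs_pos M). pose proof (Rabs_pos K). pose proof (Rle_abs M). pose proof (Rle_abs K).
  assert (Hout : forall y i, ~ In i (list_prod (box N) (true :: false :: nil)) ->
    galerkin_field y i = 0).
  { intros y [k b] Hi. unfold galerkin_field. destruct (in_dec Z2_eq_dec (fst (k, b)) (box N)) as [Hk|]; auto.
    destruct Hi. apply in_prod; [exact Hk|]. destruct b; simpl; auto. }
  assert (Hdec : forall i : Z2 * bool, {In i (list_prod (box N) (true :: false :: nil))} +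
    {~ In i (list_prod (box N) (true :: false :: nil))}).
  { intros i. apply in_dec. decide equality; [apply Bool.bool_dec|apply Z2_eq_dec]. }
  repeat split; try lra.
  - intros y i. destruct (Hdec i) as [Hi|Hi].
    + destruct (H i Hi) as (_ & _ & Hb & _). specialize (Hb y). lra.
    + rewrite Hout by assumption. rewrite Rabs_R0. lra.
  - intros y z rho Hr Hyz i. destruct (Hdec i) as [Hi|Hi].
    + destruct (H i Hi) as (_ & _ & _ & Hb). specialize (Hb y z rho Hr Hyz). nra.
    + rewrite !Hout by assumption. rewrite Rminus_diag, Rabs_R0. nra.
Qed.

Lemma clamp_id (x : R) : Rabs x <= B -> clamp x = x.
Proof.
  intros H. apply Rabs_le_between in H. unfold clamp.
  rewrite Rmin_right, Rmax_right; lra.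
Qed.

(** Since the clamped field is symmetric and mean-free for every argument, conjugate symmetry and
    the zero mode propagate from the data by a vanishing derivative. The derivative [w] is the true
    transport term only below the clamp level; the energy estimate discharges this condition
    later. *)
Lemma clamped_galerkin (th0 : coeffs) : conj_sym th0 -> th0 (0, 0)%Z = RtoC 0 ->
  exists v : R -> coeffs,
    (forall k, In k (box N) -> v 0 k = th0 k) /\
      forall t, 0 <= t ->
      supported N (v t) /\ conj_sym (v t) /\ v t (0, 0)%Z = RtoC 0 /\
      exists w, (forall k, In k (box N) -> is_derive_C (fun s => v s k) t (- w k)%C) /\
      ((forall k, Cmod (v t k) <= B) -> forall k, w k = Bil alpha (v t) (v t) k).
Proof.
  intros Hsym Hz.
  destruct galerkin_field_bdlip as (M & K & HM & HK & H1 & H2).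
  set (x0 := fun i : Z2 * bool => if snd i then Re (th0 (fst i)) else Im (th0 (fst i))).
  destruct (picard_lindelof galerkin_field M K x0 HK HM H1 H2) as (y & Hy0 & Hy).
  set (v := fun t k => if in_dec Z2_eq_dec k (box N) then (y t (k, true), y t (k, false)) else RtoC 0).
  exists v. split.
  { intros k Hk. unfold v. destruct (in_dec Z2_eq_dec k (box N)); [|easy].
    rewrite !Hy0. unfold x0; simpl. destruct (th0 k); reflexivity. }
  set (w := fun t k => Bil alpha (clamp_modes (y t)) (clamp_modes (y t)) k).
  assert (Hder : forall t k, 0 <= t -> In k (box N) ->
    is_derive_C (fun s => v s k) t (- w t k)%C).
  { intros t k Ht Hk. unfold is_derive_C, v. destruct (in_dec Z2_eq_dec k (box N)) as [Hk'|]; [|easy].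
    pose proof (Hy t (k, true) Ht) as D1. pose proof (Hy t (k, false) Ht) as D2.
    unfold galerkin_field in D1, D2. cbn [fst snd] in D1, D2.
    destruct (in_dec Z2_eq_dec k (box N)); [|easy]. split; assumption. }
  assert (Hwopp : forall t k, w t (Z2opp k) = Cconj (w t k)).
  { intros t k. apply (Bil_opp alpha N); auto using clamp_modes_conj, clamp_modes_supported. }
  assert (Hconst : forall f : R -> R, (forall s, 0 <= s -> is_derive f s 0) ->
    forall t, 0 <= t -> f t = f 0).
  { intros f Hf t Ht. destruct (MVT_gen f 0 t (fun _ => 0)) as [c [_ Hc]].
    - rewrite Rmin_left, Rmax_right by lra. intros s Hs. apply Hf; lra.
    - rewrite Rmin_left, Rmax_right by lra. intros s Hs. apply continuity_pt_filterlim.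
      apply (ex_derive_continuous (V := R_NormedModule)). exists 0. apply Hf; lra.
    - lra. }
  assert (Hvsym : forall t, 0 <= t -> conj_sym (v t)).
  { intros t Ht k. destruct (in_dec Z2_eq_dec k (box N)) as [Hk|Hk].
    - assert (Hk' : In (Z2opp k) (box N)) by now apply in_box_opp.
      assert (E0 : v 0 (Z2opp k) = Cconj (v 0 k)).
      { unfold v. destruct (in_dec Z2_eq_dec k (box N)); [|easy].
        destruct (in_dec Z2_eq_dec (Z2opp k) (box N)); [|easy].
        rewrite !Hy0. unfold x0; simpl. rewrite Hsym. reflexivity. }
      assert (ER : Re (v t (Z2opp k)) - Re (v t k) = Re (v 0 (Z2opp k)) - Re (v 0 k)).
      { apply (Hconst (fun s => Re (v s (Z2opp k)) - Re (v s k))); [|assumption].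
        intros s Hs. destruct (Hder s k Hs Hk) as [D1 _]. destruct (Hder s _ Hs Hk') as [D2 _].
        pose proof (is_derive_minus _ _ _ _ _ D2 D1) as D.
        rewrite Hwopp in D.
        replace (minus _ _) with 0 in D; [exact D|].
        unfold minus, plus, opp, Cconj, Copp, Re; simpl. ring. }
      assert (EI : Im (v t (Z2opp k)) + Im (v t k) = Im (v 0 (Z2opp k)) + Im (v 0 k)).
      { apply (Hconst (fun s => Im (v s (Z2opp k)) + Im (v s k))); [|assumption].
        intros s Hs. destruct (Hder s k Hs Hk) as [_ D1]. destruct (Hder s _ Hs Hk') as [_ D2].
        pose proof (is_derive_plus _ _ _ _ _ D2 D1) as D.
        rewrite Hwopp in D.
        replace (plus _ _) with 0 in D; [exact D|].
        unfold plus, Cconj, Copp, Im; simpl. ring. }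
      rewrite E0 in ER, EI. unfold Cconj, Re, Im in ER, EI |- *; simpl in ER, EI.
      apply injective_projections; simpl; lra.
    - unfold v. destruct (in_dec Z2_eq_dec k (box N)); [easy|].
      destruct (in_dec Z2_eq_dec (Z2opp k) (box N)) as [H|H]; [now rewrite in_box_opp in H|].
      unfold Cconj, RtoC; simpl. f_equal; ring. }
  assert (H0box : In (0, 0)%Z (box N)) by (apply in_box; simpl; lia).
  intros t Ht. split; [|split; [|split]].
  - intros k Hk. unfold v. now destruct (in_dec Z2_eq_dec k (box N)).
  - now apply Hvsym.
  - assert (E0 : v 0 (0, 0)%Z = RtoC 0).
    { unfold v. destruct (in_dec Z2_eq_dec (0, 0)%Z (box N)); [|easy].
      rewrite !Hy0. unfold x0; simpl. rewrite Hz. reflexivity. }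
    assert (Hw0 : forall s, w s (0, 0)%Z = RtoC 0) by (intros; apply Bil_zero_mode).
    apply injective_projections.
    + change (Re (v t (0, 0)%Z) = 0). rewrite (Hconst (fun s => Re (v s (0, 0)%Z))); auto.
      * now rewrite E0.
      * intros s Hs. destruct (Hder s _ Hs H0box) as [D _]. rewrite Hw0 in D.
        replace 0 with (Re (- RtoC 0)%C) by (simpl; ring). exact D.
    + change (Im (v t (0, 0)%Z) = 0). rewrite (Hconst (fun s => Im (v s (0, 0)%Z))); auto.
      * now rewrite E0.
      * intros s Hs. destruct (Hder s _ Hs H0box) as [_ D]. rewrite Hw0 in D.
        replace 0 with (Im (- RtoC 0)%C) by (simpl; ring). exact D.
  - exists (w t). split; [intros k Hk; now apply Hder|].
    intros Hb k. unfold w.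
    assert (E : forall k, clamp_modes (y t) k = v t k).
    { intros j. pose proof (Hvsym t Ht j) as Hs. pose proof (Hb j) as Bj. pose proof (Hb (Z2opp j)) as Bj'.
      unfold clamp_modes. unfold v in *. destruct (in_dec Z2_eq_dec j (box N)) as [Hj|]; [|reflexivity].
      destruct (in_dec Z2_eq_dec (Z2opp j) (box N)) as [Hj'|Hj']; [|destruct Hj'; now apply in_box_opp].
      pose proof (re_le_Cmod (y t (j, true), y t (j, false))) as R1.
      pose proof (im_le_Cmod (y t (j, true), y t (j, false))) as R2.
      pose proof (re_le_Cmod (y t (Z2opp j, true), y t (Z2opp j, false))) as R3.
      pose proof (im_le_Cmod (y t (Z2opp j, true), y t (Z2opp j, false))) as R4.
      unfold Re, Im in R1, R2, R3, R4; simpl in R1, R2, R3, R4.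
      rewrite !clamp_id by lra. unfold Cconj in Hs; simpl in Hs. inversion Hs as [[S1 S2]].
      f_equal; rewrite ?S1, ?S2; field. }
    apply Bil_ext; exact E.
Qed.

End Galerkin.

(** * Uniform energy bound for the truncations *)

Lemma sum_bound_supported (f : Z2 -> R) (n : nat) : (forall k, 0 <= f k) ->
  (forall k, ~ In k (box n) -> f k = 0) -> sum_bound f (lsum (box n) f).
Proof.
  intros Hf Hs L HL. apply lsum_cover; auto.
  intros k _. destruct (in_dec Z2_eq_dec k (box n)); auto.
Qed.

(** Weighted AM-GM: with a = |k|^4, 2 p <= a p^2 + 1/a, where a p^2 is the energy density and 1/a <=
    4 [decay]. The right side is affine in the energy, without square roots. *)
Lemma low_frequency_bound (g tau : R) (f : Z2 -> R) (k : Z2) :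
  knorm k ^ 2 * (ew g tau k * f k) <= 2 * decay k + / 2 * (Wt g tau k * f k) ^ 2.
Proof.
  pose proof (decay_pos k) as HD. pose proof (pow2_ge_0 (Wt g tau k * f k)) as HX.
  destruct (Z2_eq_dec k (0, 0)%Z) as [Ek|Hk].
  { rewrite Ek at 1. rewrite knorm_zero. lra. }
  pose proof (decay_knorm k Hk) as Hq. apply knorm_ge1 in Hk.
  set (ps := knorm k ^ 2 * (ew g tau k * f k)).
  replace (Wt g tau k * f k) with (knorm k ^ 2 * ps) by (unfold ps, Wt; ring).
  set (a := knorm k ^ 4) in *.
  assert (Ha : 1 <= a) by (apply pow_R1_Rle; assumption).
  replace ((knorm k ^ 2 * ps) ^ 2) with (a * ps ^ 2) by (unfold a; ring).
  clearbody ps a. apply Rmult_le_reg_l with a; [lra|].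
  pose proof (pow2_ge_0 (a * ps - 1)). nra.
Qed.

(** The sign of df is known only while f < b. At the supremum s of the times up to which f stays
    below f 0, continuity gives f s <= f 0 < b, so f is nonincreasing slightly beyond s, and s was
    not the supremum. *)
Lemma barrier (f df : R -> R) (T b : R) :
  (forall t, 0 <= t < T -> is_derive f t (df t)) ->
  (forall t, 0 <= t < T -> f t < b -> df t <= 0) -> f 0 < b ->
  forall t, 0 <= t < T -> f t <= f 0.
Proof.
  intros Hd Hneg H0 t Ht. destruct (Rle_dec (f t) (f 0)) as [|Hbad]; [assumption|exfalso].
  assert (Hcont : forall s, 0 <= s < T -> forall eps, 0 < eps ->
    exists del, 0 < del /\ forall u, Rabs (u - s) < del -> Rabs (f u - f s) < eps).
  { intros s Hs eps Heps.
    assert (C : continuous f s).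
    { apply (ex_derive_continuous (V := R_NormedModule)). exists (df s). now apply Hd. }
    apply (filterlim_locally f (f s)) with (eps := mkposreal eps Heps) in C.
    destruct C as [del Hdel]. exists del. split; [apply cond_pos|]. exact Hdel. }
  set (P := fun s => 0 <= s <= t /\ forall u, 0 <= u <= s -> f u <= f 0).
  destruct (completeness P) as [s [Hub Hlub]].
  { exists t. intros s Hs. apply Hs. }
  { exists 0. split; [lra|]. intros u Hu. replace u with 0 by lra. lra. }
  assert (HP0 : P 0) by (split; [lra|]; intros u Hu; replace u with 0 by lra; lra).
  assert (Hs0 : 0 <= s) by (apply Hub; assumption).
  assert (Hst : s <= t) by (apply Hlub; intros u Hu; apply Hu).
  assert (Hbelow : forall u, 0 <= u < s -> f u <= f 0).
  { intros u Hu. destruct (Rle_dec (f u) (f 0)) as [|Hn]; [assumption|].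
    assert (s <= u); [|lra]. apply Hlub. intros r [Hr1 Hr2].
    destruct (Rle_dec r u) as [|Hru]; [assumption|]. destruct Hn. apply Hr2. lra. }
  assert (Hs : f s <= f 0).
  { destruct (Rle_dec (f s) (f 0)) as [|Hn]; [assumption|].
    destruct (Rle_lt_or_eq_dec 0 s Hs0) as [Hpos|E]; [|rewrite <- E in *; lra].
    destruct (Hcont s ltac:(lra) (f s - f 0) ltac:(lra)) as [del [Hdel Hc]].
    set (u := Rmax 0 (s - del / 2)).
    assert (Hu : 0 <= u < s /\ s - u <= del / 2).
    { unfold u, Rmax. destruct Rle_dec; lra. }
    specialize (Hbelow u ltac:(lra)).
    specialize (Hc u). rewrite Rabs_minus_sym, Rabs_pos_eq in Hc by lra.
    specialize (Hc ltac:(lra)). apply Rabs_def2 in Hc. lra. }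
  destruct (Rle_lt_or_eq_dec s t Hst) as [Hlt|E]; [|rewrite E in *; lra].
  destruct (Hcont s ltac:(lra) (b - f 0) ltac:(lra)) as [del [Hdel Hc]].
  set (r := Rmin t (s + del / 2)).
  assert (Hr : s < r <= t /\ r - s <= del / 2).
  { unfold r, Rmin. destruct Rle_dec; lra. }
  (* [derive_le_growth] concludes on a half-open interval; the margin del / 2 brings r inside and
     still stays within distance del of s. *)
  assert (Hgrow : forall u, s <= u < r + del / 2 -> u < T -> f u <= f s + 0 * (u - s)).
  { intros u Hu HuT.
    apply (derive_le_growth f df s (Rmin T (r + del / 2)) 0).
    - intros v Hv. assert (v < T) by (pose proof (Rmin_l T (r + del / 2)); lra).
      assert (v < r + del / 2) by (pose proof (Rmin_r T (r + del / 2)); lra).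
      split; [apply Hd; lra|]. apply Hneg; [lra|].
      specialize (Hc v). rewrite Rabs_pos_eq in Hc by lra.
      specialize (Hc ltac:(lra)). apply Rabs_def2 in Hc. lra.
    - apply right_cont_continuous, (ex_derive_continuous (V := R_NormedModule)).
      exists (df s). apply Hd. lra.
    - split; [lra|]. apply Rmin_glb_lt; lra. }
  assert (HPr : P r).
  { split; [lra|]. intros u Hu. destruct (Rlt_dec u s) as [Hus|Hus]; [apply Hbelow; lra|].
    specialize (Hgrow u ltac:(lra) ltac:(lra)). lra. }
  specialize (Hub r HPr). lra.
Qed.

(** X^2 <= E gives X <= 1 + E, which keeps square roots out of the constants that follow. *)
Lemma weighted_mode_le (g tau : R) (L : list Z2) (v : coeffs) (k : Z2) (E : R) :
  In k L -> energy g tau L v <= E -> 0 <= E -> Wt g tau k * Cmod (v k) <= 1 + E.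
Proof.
  intros Hk HE HE0.
  pose proof (lsum_term_le L (fun k => (Wt g tau k * Cmod (v k)) ^ 2) k
    (fun _ _ => pow2_ge_0 _) Hk) as H. cbv beta in H. fold (energy g tau L v) in H.
  nra.
Qed.

(** The 3 is the one half of [flux_bound] times the six convolution sums; 128 is the factor 2 of
    [low_frequency_bound] times the lattice sum 64. *)
Lemma galerkin_energy_flux (g alpha tau : R) (N : nat) (v : coeffs) :
  0 < g <= 1 -> 0 <= alpha <= g -> 0 <= tau -> supported N v -> conj_sym v ->
  Rabs (lsum (box N) (fun k => Wt g tau k ^ 2 * Re (Cconj (v k) * Bil alpha v v k)%C)) <=
  (46 + 16 * tau) * (3 * (128 + / 2 * energy g tau (box N) v)) * dissip g tau (box N) v.
Proof.
  intros Hg Hal Ht Hs Hc.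
  assert (H0 : forall k, ~ In k (box N) -> Cmod (v k) = 0).
  { intros k Hk. rewrite Hs by assumption. apply Cmod_0. }
  rewrite (lsum_ext _ _ (fun k => Wt g tau k ^ 2 *
    lsum (box N) (fun l => Re (Cconj (v k) * bterm alpha v v k l)%C))).
  2:{ intros k _. rewrite (Bil_supported_r alpha N) by assumption. now rewrite Re_Cconj_lsum. }
  eapply Rle_trans; [now apply flux_bound|].
  pose proof (commutator_cubic_sum g alpha tau Hg Hal Ht (fun k => Cmod (v k)) (box N)
    (2 * 64 + / 2 * energy g tau (box N) v) (dissip g tau (box N) v)
    (fun k => Cmod_ge_0 _)) as H. cbv beta in H.
  apply Rle_trans with (/ 2 * ((46 + 16 * tau) *
    (6 * ((2 * 64 + / 2 * energy g tau (box N) v) * dissip g tau (box N) v)))); [|right; field].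
  apply Rmult_le_compat_l; [lra|]. apply H.
  - intros k l. rewrite Z2sub_opp, Hc. apply Cmod_conj.
  - apply NoDup_box.
  - intros L HL. eapply Rle_trans; [apply lsum_le; intros k _; apply (low_frequency_bound g tau (fun k => Cmod (v k)))|].
    rewrite lsum_plus, !lsum_scal. pose proof (lsum_decay L HL).
    assert (Hb : sum_bound (fun k => (Wt g tau k * Cmod (v k)) ^ 2) (energy g tau (box N) v)).
    { apply sum_bound_supported; [intros; apply pow2_ge_0|].
      intros k Hk. rewrite H0 by assumption. ring. }
    specialize (Hb L HL). lra.
  - apply sum_bound_supported; [intros; apply ydens_nonneg; lra|].
    intros k Hk. unfold ydens. rewrite H0 by assumption. ring.
Qed.

Theorem galerkin_solutions (g alpha tau1 E0 : R) :
  0 < g <= 1 -> 0 <= alpha <= g -> 0 < tau1 -> 0 <= E0 ->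
  exists T1, 0 < T1 /\ forall N th0, conj_sym th0 -> th0 (0, 0)%Z = RtoC 0 ->
    energy g tau1 (box N) th0 <= E0 ->
    exists v : R -> coeffs,
      (forall k, In k (box N) -> v 0 k = th0 k) /\
      forall t, 0 <= t < T1 ->
        supported N (v t) /\ conj_sym (v t) /\ v t (0, 0)%Z = RtoC 0 /\
        Gev g (1 + E0) (tau1 / 2) (v t) /\
        (forall k, In k (box N) ->
           is_derive_C (fun s => v s k) t (- Bil alpha (v t) (v t) k)%C).
Proof.
  intros Hg Hal Htau HE0.
  (* E1 leaves room above E0 for the barrier; energy at most E1 keeps every mode below B, so the
     clamp is inactive; beta is the flux constant at energy E1 and radius tau1. None of them depends
     on N. *)
  set (E1 := E0 + 1). set (B := 1 + E1).
  set (beta := (46 + 16 * tau1) * (3 * (128 + / 2 * E1))).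
  assert (Hbeta : 0 < beta) by (unfold beta, E1; apply Rmult_lt_0_compat; lra).
  (* Up to this time the shrinking radius tau1 - beta t stays above tau1 / 2. *)
  exists (tau1 / (2 * beta)). split; [apply Rdiv_lt_0_compat; lra|].
  intros N th0 Hsym Hz Hen.
  destruct (clamped_galerkin alpha B N ltac:(unfold B, E1; lra) th0 Hsym Hz) as (v & Hv0 & Hv).
  exists v. split; [assumption|].
  set (tau := fun t => tau1 - beta * (t - 0)).
  assert (Htau_t : forall t, 0 <= t < tau1 / (2 * beta) -> tau1 / 2 <= tau t <= tau1).
  { intros t Ht. unfold tau. split; [|nra].
    assert (beta * t <= beta * (tau1 / (2 * beta))) by (apply Rmult_le_compat_l; lra).
    replace (beta * (tau1 / (2 * beta))) with (tau1 / 2) in H by (field; lra). lra. }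
  set (E := fun t => energy g (tau t) (box N) (v t)).
  assert (Hmode : forall t e, 0 <= t < tau1 / (2 * beta) -> E t <= e -> 0 <= e ->
    forall k, Cmod (v t k) * exp (tau t * lam g k) <= 1 + e).
  { intros t e Ht He He0 k. specialize (Htau_t t Ht).
    destruct (Hv t ltac:(lra)) as (Hsup & _ & Hz0 & _).
    destruct (Z2_eq_dec k (0, 0)%Z) as [->|Hk0]; [rewrite Hz0, Cmod_0; lra|].
    destruct (in_dec Z2_eq_dec k (box N)) as [Hk|Hk]; [|rewrite Hsup, Cmod_0 by assumption; lra].
    pose proof (weighted_mode_le g (tau t) (box N) (v t) k e Hk He He0) as H.
    unfold Wt, ew in H. apply knorm_ge1 in Hk0.
    assert (1 <= knorm k ^ 4) by (apply pow_R1_Rle; assumption).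
    assert (0 <= Cmod (v t k) * exp (tau t * lam g k)).
    { apply Rmult_le_pos; [apply Cmod_ge_0|apply Rlt_le, exp_pos]. }
    nra. }
  assert (HleB : forall t, 0 <= t < tau1 / (2 * beta) -> E t <= E1 -> forall k, Cmod (v t k) <= B).
  { intros t Ht He k.
    pose proof (Hmode t E1 Ht He ltac:(unfold E1; lra) k) as H.
    specialize (Htau_t t Ht). pose proof (lam_ge1 g k ltac:(lra)).
    assert (1 <= exp (tau t * lam g k)) by (rewrite <- exp_0; apply exp_mono; nra).
    pose proof (Cmod_ge_0 (v t k)). unfold B. nra. }
  assert (HE_0 : E 0 <= E0).
  { unfold E, tau. rewrite Rminus_diag, Rmult_0_r, Rminus_0_r.
    eapply Rle_trans; [|apply Hen]. right. apply lsum_ext. intros k Hk. now rewrite Hv0. }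
  assert (HEle : forall t, 0 <= t < tau1 / (2 * beta) -> E t <= E 0).
  {
    assert (Hd : forall t, 0 <= t < tau1 / (2 * beta) -> exists d, is_derive E t d /\
      (E t < E1 -> d <= 0)).
    { intros t Ht. destruct (Hv t ltac:(lra)) as (Hsup & Hsy & _ & w & Hw & HwB).
      pose proof (energy_derive g tau1 beta 0 t (box N) v _ (fun k Hk => Hw k Hk)) as D.
      cbv zeta in D. eexists. split; [exact D|]. intros He. fold (tau t).
      pose proof (Htau_t t Ht) as Htt.
      assert (HwE : forall k, w k = Bil alpha (v t) (v t) k).
      { apply HwB, HleB; [assumption|lra]. }
      rewrite (lsum_ext _ _ (fun k => (-1) * (Wt g (tau t) k ^ 2 *
        Re (Cconj (v t k) * Bil alpha (v t) (v t) k)%C))).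
      2:{ intros k _. rewrite HwE. unfold Cconj, Cmult, Copp, Re; cbn [fst snd]. ring. }
      rewrite lsum_scal.
      pose proof (galerkin_energy_flux g alpha (tau t) N (v t) Hg Hal ltac:(lra) Hsup Hsy) as Hf.
      fold (E t) in Hf. apply Rabs_le_between in Hf.
      pose proof (dissip_nonneg g (tau t) (box N) (v t) ltac:(lra)) as HY.
      set (Y := dissip g (tau t) (box N) (v t)) in *.
      assert (Hb : (46 + 16 * tau t) * (3 * (128 + / 2 * E t)) <= beta).
      { unfold beta. pose proof (energy_nonneg g (tau t) (box N) (v t)) as HE. fold (E t) in HE.
        apply Rmult_le_compat; lra. }
      assert ((46 + 16 * tau t) * (3 * (128 + / 2 * E t)) * Y <= beta * Y)
        by (apply Rmult_le_compat_r; assumption).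
      lra. }
    apply (barrier E (Derive E) (tau1 / (2 * beta)) E1).
    - intros t Ht. destruct (Hd t Ht) as [d [D _]]. apply Derive_correct. now exists d.
    - intros t Ht He. destruct (Hd t Ht) as [d [D Hneg]].
      rewrite (is_derive_unique _ _ _ D). auto.
    - unfold E1; lra. }
  intros t Ht. destruct (Hv t ltac:(lra)) as (Hsup & Hsy & Hz0 & _).
  specialize (HEle t Ht).
  split; [assumption|split; [assumption|split; [assumption|split]]].
  - intros k. pose proof (Hmode t E0 Ht ltac:(lra) HE0 k) as H.
    specialize (Htau_t t Ht). pose proof (lam_ge1 g k ltac:(lra)).
    apply Rle_trans with ((1 + E0) * exp (- tau t * lam g k)).
    + replace (Cmod (v t k)) with ((Cmod (v t k) * exp (tau t * lam g k)) * exp (- tau t * lam g k)).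
      * apply Rmult_le_compat_r; [apply Rlt_le, exp_pos|assumption].
      * rewrite Rmult_assoc, <- exp_plus. replace (tau t * lam g k + - tau t * lam g k) with 0 by ring.
        rewrite exp_0; ring.
    + apply Rmult_le_compat_l; [lra|]. apply exp_mono. nra.
  - intros k Hk. destruct (Hv t ltac:(lra)) as (_ & _ & _ & w & Hw & HwB).
    rewrite <- HwB; [now apply Hw|]. apply HleB; [assumption|]. unfold E1; lra.
Qed.

(** * Stability *)

(** Only the equations inside the box are required, with the full transport term. Exact solutions
    and truncations of order at least n both satisfy this, so [mode_stability] can compare either
    kind. *)
Definition solves_modes (alpha : R) (n : nat) (t0 t1 : R) (x : R -> coeffs) : Prop :=
  forall k, In k (box n) ->
    right_cont_C (fun s => x s k) t0 /\
    forall t, t0 < t < t1 -> is_derive_C (fun s => x s k) t (- Bil alpha (x t) (x t) k)%C.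

Definition regular (g M sig t0 t1 : R) (x : R -> coeffs) : Prop :=
  forall t, t0 <= t < t1 -> Gev g M sig (x t) /\ conj_sym (x t) /\ x t (0, 0)%Z = RtoC 0.

Definition low_modes (n : nat) (a : coeffs) : coeffs :=
  fun k => if in_dec Z2_eq_dec k (box n) then a k else RtoC 0.

Definition high_modes (n : nat) (a : coeffs) : coeffs :=
  fun k => if in_dec Z2_eq_dec k (box n) then RtoC 0 else a k.

Lemma low_high_split (n : nat) (a : coeffs) (k : Z2) :
  a k = (low_modes n a k + high_modes n a k)%C.
Proof.
  unfold low_modes, high_modes. destruct (in_dec Z2_eq_dec k (box n)); ring.
Qed.

Lemma low_modes_in (n : nat) (a : coeffs) (k : Z2) : In k (box n) -> low_modes n a k = a k.
Proof. intros H. unfold low_modes. now destruct (in_dec Z2_eq_dec k (box n)). Qed.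

Lemma low_modes_supported (n : nat) (a : coeffs) : supported n (low_modes n a).
Proof. intros k H. unfold low_modes. now destruct (in_dec Z2_eq_dec k (box n)). Qed.

Lemma low_modes_Gev (g M sig : R) (n : nat) (a : coeffs) :
  Gev g M sig a -> Gev g M sig (low_modes n a).
Proof.
  intros H k. unfold low_modes. destruct (in_dec Z2_eq_dec k (box n)); [apply H|].
  rewrite Cmod_0. apply Rmult_le_pos; [now apply Gev_nonneg in H|apply Rlt_le, exp_pos].
Qed.

Definition tail_rate (g sig : R) (n : nat) : R := exp (- (sig / 2) * Rpower (INR n) g).

(** [pow_exp_decay] with p = 1 bounds n times the rate, which is enough to make the rate small. *)
Lemma tail_rate_small (g sig eps : R) : 0 < g -> 0 < sig -> 0 < eps ->
  exists n0, forall n, (n0 <= n)%nat -> tail_rate g sig n <= eps.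
Proof.
  intros Hg Hs He. destruct (pow_exp_decay g (sig / 2) 1 Hg ltac:(lra)) as [C [HC H]].
  destruct (nfloor_ex (C / eps)) as [m [_ Hm]].
  { apply Rlt_le, Rdiv_lt_0_compat; lra. }
  exists (S m). intros n Hn.
  assert (Hn1 : INR (S m) <= INR n) by now apply le_INR.
  rewrite S_INR in Hn1. pose proof (pos_INR m).
  specialize (H (INR n) ltac:(lra)). rewrite pow_1 in H. fold (tail_rate g sig n) in H.
  apply Rlt_div_l in Hm; [|assumption].
  apply Rmult_le_reg_l with (INR n); [lra|]. nra.
Qed.

(** Outside the box |k| >= n, so half of the radius is converted into the small factor [tail_rate]
    and the other half is kept. *)
Lemma high_modes_Gev (g M sig : R) (n : nat) (a : coeffs) : 0 < g -> 0 < sig ->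
  Gev g M sig a -> Gev g (M * tail_rate g sig n) (sig / 2) (high_modes n a).
Proof.
  intros Hg Hs H k. pose proof (Gev_nonneg _ _ _ _ H) as HM.
  unfold high_modes. destruct (in_dec Z2_eq_dec k (box n)) as [Hk|Hk].
  - rewrite Cmod_0. repeat apply Rmult_le_pos; try assumption; apply Rlt_le, exp_pos.
  - eapply Rle_trans; [apply H|]. rewrite Rmult_assoc. apply Rmult_le_compat_l; [assumption|].
    unfold tail_rate. rewrite <- exp_plus. apply exp_mono.
    assert (Hl : Rpower (INR n) g <= lam g k).
    { pose proof (knorm_box n k Hk) as Hn. destruct n as [|n].
      (* For n = 0 the rate contains [Rpower 0 g], which has the same default value 1 as [lam] at
         zero. *)
      - simpl. rewrite <- knorm_zero. fold (lam g (0, 0)%Z). rewrite lam_zero. now apply lam_ge1.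
      - apply Rle_Rpower_l; [lra|]. split; [apply lt_0_INR; lia|assumption]. }
    nra.
Qed.

Lemma Wt_sqr (g tau : R) (k : Z2) : Wt g tau k ^ 2 = knorm k ^ 8 * exp (2 * tau * lam g k).
Proof.
  unfold Wt, ew. rewrite Rpow_mult_distr. f_equal; [ring|].
  replace (2 * tau * lam g k) with (tau * lam g k + tau * lam g k) by ring.
  rewrite exp_plus. ring.
Qed.

(* Split [d] at the edge of the box: the commutator and stretching estimates control the
   low modes, the high modes only contribute a small source. *)
Lemma difference_flux (g alpha sig M : R) : 0 < g <= 1 -> 0 <= alpha <= g -> 0 < sig -> 0 <= M ->
  exists A C, 0 <= A /\ 0 <= C /\ forall n x y tau,
    0 <= tau <= sig / 4 -> Gev g M sig x -> Gev g M sig y -> conj_sym x ->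
    let d := fun k => (x k - y k)%C in
    Rabs (lsum (box n) (fun k => Wt g tau k ^ 2 *
      Re (Cconj (d k) * (Bil alpha x x k - Bil alpha y y k))%C)) <=
    A * dissip g tau (box n) d + C * tail_rate g sig n.
Proof.
  intros Hg Hal Hs HM.
  destruct (lsum_pow_exp g (sig / 2) 6 ltac:(lra) ltac:(lra)) as [S6 [HS6 HS6b]].
  destruct (lsum_pow_exp g (sig / 2) 8 ltac:(lra) ltac:(lra)) as [S8 [HS8 HS8b]].
  destruct (Bil_Gev g (sig / 2) Hg ltac:(lra)) as [CB [HCB HBil]].
  assert (HMS : 0 <= M * S6) by (apply Rmult_le_pos; lra).
  exists ((46 + 16 * (sig / 4)) * (M * S6) + 32 * (M * S6)), (8 * CB * M ^ 3 * S8).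
  split; [apply Rplus_le_le_0_compat; apply Rmult_le_pos; lra|].
  split; [repeat apply Rmult_le_pos; try lra; apply pow_le; lra|].
  intros n x y tau Ht Hx Hy Hxc d.
  set (P := low_modes n d). set (Q := high_modes n d).
  assert (Hd : Gev g (M + M) sig d) by now apply Gev_minus.
  assert (HP : Gev g (M + M) sig P) by now apply low_modes_Gev.
  assert (HQ : Gev g ((M + M) * tail_rate g sig n) (sig / 2) Q) by (apply high_modes_Gev; auto; lra).
  assert (HPs : supported n P) by apply low_modes_supported.
  assert (Hw : forall K a, Gev g K sig a -> Gev g K (sig / 2) a).
  { intros K a. apply Gev_weaken; lra. }
  (* B(x,x) - B(y,y) = B(x,d) + B(d,y), and d = P + Q is inserted in both terms. *)
  assert (Hdec : forall k, (Bil alpha x x k - Bil alpha y y k)%C =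
    (Bil alpha x P k + Bil alpha P y k + (Bil alpha x Q k + Bil alpha Q y k))%C).
  { intros k.
    assert (E1 : Bil alpha x x k = (Bil alpha x d k + Bil alpha x y k)%C).
    { rewrite <- (Bil_plus_r g M (M + M) M sig) by (auto; lra).
      apply Bil_ext; intros j; unfold d; ring. }
    assert (E2 : Bil alpha x y k = (Bil alpha d y k + Bil alpha y y k)%C).
    { rewrite <- (Bil_plus_l g (M + M) M M sig) by (auto; lra).
      apply Bil_ext; intros j; unfold d; ring. }
    assert (E3 : Bil alpha x d k = (Bil alpha x P k + Bil alpha x Q k)%C).
    { rewrite <- (Bil_plus_r g M (M + M) ((M + M) * tail_rate g sig n) (sig / 2)) by (auto; lra).
      apply Bil_ext; intros j; [reflexivity|apply low_high_split]. }
    assert (E4 : Bil alpha d y k = (Bil alpha P y k + Bil alpha Q y k)%C).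
    { rewrite <- (Bil_plus_l g (M + M) ((M + M) * tail_rate g sig n) M (sig / 2)) by (auto; lra).
      apply Bil_ext; intros j; [apply low_high_split|reflexivity]. }
    rewrite E1, E2, E3, E4. ring. }
  (* J1 is transport of P by x, a commutator; J2 has P in the velocity and the gradient on y; J3 is
     the source from the high modes Q. *)
  set (J1 := lsum (box n) (fun k => Wt g tau k ^ 2 * Re (Cconj (P k) * Bil alpha x P k)%C)).
  set (J2 := lsum (box n) (fun k => Wt g tau k ^ 2 * Re (Cconj (P k) * Bil alpha P y k)%C)).
  set (J3 := lsum (box n) (fun k => Wt g tau k ^ 2 *
    Re (Cconj (P k) * (Bil alpha x Q k + Bil alpha Q y k))%C)).
  rewrite (lsum_ext _ _ (fun k =>
    (Wt g tau k ^ 2 * Re (Cconj (P k) * Bil alpha x P k)%C +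
     Wt g tau k ^ 2 * Re (Cconj (P k) * Bil alpha P y k)%C) +
    Wt g tau k ^ 2 * Re (Cconj (P k) * (Bil alpha x Q k + Bil alpha Q y k))%C)).
  2:{ intros k Hk. rewrite Hdec. unfold P at 3 5 7. rewrite low_modes_in by assumption.
      rewrite <- !Rmult_plus_distr_l. f_equal.
      unfold Cconj, Cmult, Cplus, Re; cbn [fst snd]. ring. }
  rewrite !lsum_plus. fold J1 J2 J3.
  assert (HPY : sum_bound (ydens g tau (fun k => Cmod (P k))) (dissip g tau (box n) d)).
  { replace (dissip g tau (box n) d) with (lsum (box n) (ydens g tau (fun k => Cmod (P k)))).
    - apply sum_bound_supported; [intros; apply ydens_nonneg; lra|].
      intros k Hk. unfold ydens. rewrite HPs, Cmod_0 by assumption. ring.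
    - unfold dissip. apply lsum_ext. intros k Hk. unfold ydens, P. now rewrite low_modes_in. }
  set (Y := dissip g tau (box n) d) in *.
  assert (HA : forall a, Gev g M sig a ->
    sum_bound (fun k => knorm k ^ 6 * (ew g tau k * Cmod (a k))) (M * S6)).
  { intros a Ha. apply sum_bound_le with (fun k => M * (knorm k ^ 6 * exp (- (sig / 2) * lam g k))).
    2:{ apply sum_bound_scal; auto. }
    intros k. rewrite (Rmult_comm M), Rmult_assoc.
    apply Rmult_le_compat_l; [apply pow_le, knorm_nonneg|].
    apply Rle_trans with (ew g tau k * (M * exp (- sig * lam g k))).
    - apply Rmult_le_compat_l; [apply Rlt_le, ew_pos|apply Ha].
    - unfold ew. replace (exp (tau * lam g k) * (M * exp (- sig * lam g k)))
        with (exp (tau * lam g k) * exp (- sig * lam g k) * M) by ring.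
      apply Rmult_le_compat_r; [assumption|]. rewrite <- exp_plus. apply exp_mono.
      pose proof (lam_ge1 g k ltac:(lra)). nra. }
  assert (HJ1 : Rabs J1 <= (46 + 16 * (sig / 4)) * (M * S6) * Y).
  { unfold J1. rewrite (lsum_ext _ _ (fun k => Wt g tau k ^ 2 *
      lsum (box n) (fun l => Re (Cconj (P k) * bterm alpha x P k l)%C))).
    2:{ intros k _. rewrite (Bil_supported_r alpha n) by assumption. now rewrite Re_Cconj_lsum. }
    eapply Rle_trans; [now apply flux_bound|].
    pose proof (commutator_linear_sum g alpha tau Hg Hal ltac:(lra) (fun k => Cmod (x k))
      (fun k => Cmod (P k)) (box n) (M * S6) Y (fun k => Cmod_ge_0 _) (fun k => Cmod_ge_0 _)
      (NoDup_box n) (HA x Hx) HPY) as H. cbv beta in H.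
    assert (HMY : 0 <= (M * S6) * Y).
    { apply Rmult_le_pos; [assumption|]. apply (sum_bound_nonneg _ _ HPY). }
    assert ((46 + 16 * tau) * (M * S6 * Y) <= (46 + 16 * (sig / 4)) * (M * S6 * Y))
      by (apply Rmult_le_compat_r; lra).
    lra. }
  assert (HJ2 : Rabs J2 <= 32 * (M * S6) * Y).
  { unfold J2. rewrite (lsum_ext _ _ (fun k => lsum (box (2 * n)) (fun l =>
      Wt g tau k ^ 2 * Re (Cconj (P k) * bterm alpha P y k l)%C))).
    2:{ intros k Hk. rewrite (Bil_supported_l alpha n) by assumption.
        now rewrite Re_Cconj_lsum, lsum_scal. }
    pose proof (stretching_sum g alpha tau Hg Hal ltac:(lra) (fun k => Cmod (P k)) (fun k => Cmod (y k))
      (box n) (box (2 * n)) (M * S6) Y (fun k => Cmod_ge_0 _) (fun k => Cmod_ge_0 _)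
      (NoDup_box n) (NoDup_box (2 * n)) (HA y Hy) HPY) as H. cbv beta in H.
    rewrite Rmult_assoc. eapply Rle_trans; [|exact H].
    eapply Rle_trans; [apply lsum_abs|]. apply lsum_le; intros k _.
    eapply Rle_trans; [apply lsum_abs|]. apply lsum_le; intros l _.
    rewrite Rabs_mult, Rabs_pos_eq by apply pow2_ge_0.
    apply Rmult_le_compat_l; [apply pow2_ge_0|].
    eapply Rle_trans; [apply re_le_Cmod|].
    rewrite Cmod_mult, Cmod_conj, Cmod_bterm. right; ring. }
  assert (HJ3 : Rabs J3 <= 8 * CB * M ^ 3 * S8 * tail_rate g sig n).
  { set (eta := tail_rate g sig n) in *. assert (Heta : 0 < eta) by apply exp_pos.
    unfold J3. eapply Rle_trans; [apply lsum_abs|].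
    apply Rle_trans with (lsum (box n) (fun k => (8 * CB * M ^ 3 * eta) *
      (knorm k ^ 8 * exp (- (sig / 2) * lam g k)))).
    2:{ rewrite lsum_scal. pose proof (HS8b (box n) (NoDup_box n)) as H.
        replace (8 * CB * M ^ 3 * S8 * eta) with ((8 * CB * M ^ 3 * eta) * S8) by ring.
        apply Rmult_le_compat_l; [|assumption].
        repeat apply Rmult_le_pos; try lra; apply pow_le; lra. }
    apply lsum_le. intros k _. rewrite Rabs_mult, Rabs_pos_eq by apply pow2_ge_0.
    pose proof (lam_ge1 g k ltac:(lra)) as Hl.
    (* Q has size 2 M eta, so each of the two terms is at most 2 CB M^2 eta; the factor 2 M from P
       then makes 8 CB M^3. *)
    assert (HB : Cmod (Bil alpha x Q k + Bil alpha Q y k)%C <= 4 * CB * M ^ 2 * eta).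
    { eapply Rle_trans; [apply Cmod_triangle|].
      pose proof (HBil alpha x Q M _ ltac:(lra) (Hw _ _ Hx) HQ k) as B1.
      pose proof (HBil alpha Q y _ M ltac:(lra) HQ (Hw _ _ Hy) k) as B2.
      assert (He : exp (- (sig / 2 / 2) * lam g k) <= 1).
      { rewrite <- exp_0. apply exp_mono. nra. }
      assert (Hc : 0 <= 2 * CB * M ^ 2 * eta).
      { repeat apply Rmult_le_pos; try lra; apply pow_le; lra. }
      replace (CB * M * ((M + M) * eta)) with (2 * CB * M ^ 2 * eta) in B1 by ring.
      replace (CB * ((M + M) * eta) * M) with (2 * CB * M ^ 2 * eta) in B2 by ring.
      nra. }
    apply Rle_trans with (Wt g tau k ^ 2 * (((M + M) * exp (- sig * lam g k)) * (4 * CB * M ^ 2 * eta))).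
    { apply Rmult_le_compat_l; [apply pow2_ge_0|].
      eapply Rle_trans; [apply re_le_Cmod|]. rewrite Cmod_mult, Cmod_conj.
      apply Rmult_le_compat; auto using Cmod_ge_0. }
    (* This is where tau <= sig / 4 is used in full: the squared weight costs 2 tau <= sig / 2 of
       the decay of P. *)
    rewrite Wt_sqr.
    replace (knorm k ^ 8 * exp (2 * tau * lam g k) *
      ((M + M) * exp (- sig * lam g k) * (4 * CB * M ^ 2 * eta)))
      with ((8 * CB * M ^ 3 * eta) * (knorm k ^ 8 * (exp (2 * tau * lam g k) * exp (- sig * lam g k)))) by ring.
    apply Rmult_le_compat_l; [repeat apply Rmult_le_pos; try lra; apply pow_le; lra|].
    apply Rmult_le_compat_l; [apply pow_le, knorm_nonneg|].
    rewrite <- exp_plus. apply exp_mono. nra. }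
  eapply Rle_trans; [apply Rabs_triang|].
  pose proof (Rabs_triang J1 J2). lra.
Qed.

(** The radius falls from sig / 4 to 0 at speed beta = A + 1, so [del] depends on M and sig but not
    on t0, and the estimate can be iterated. What remains is the source, at most 2 C del times
    [tail_rate], and n0 brings it below eps^2; on nonzero modes the weight is at least 1, so the
    energy bounds the difference. *)
Theorem mode_stability (g alpha M sig : R) : 0 < g <= 1 -> 0 <= alpha <= g -> 0 < sig -> 0 <= M ->
  exists del, 0 < del /\ forall eps, 0 < eps -> exists n0, forall n x y t0 t1,
    (n0 <= n)%nat -> t1 <= t0 + del ->
    regular g M sig t0 t1 x -> regular g M sig t0 t1 y ->
    solves_modes alpha n t0 t1 x -> solves_modes alpha n t0 t1 y ->
    (forall k, In k (box n) -> x t0 k = y t0 k) ->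
    forall t k, t0 <= t < t1 -> In k (box n) -> Cmod (x t k - y t k)%C <= eps.
Proof.
  intros Hg Hal Hs HM.
  destruct (difference_flux g alpha sig M Hg Hal Hs HM) as (A & C & HA & HC & Hflux).
  set (beta := A + 1). exists (sig / (4 * beta)).
  split; [apply Rdiv_lt_0_compat; unfold beta; lra|]. set (del := sig / (4 * beta)).
  assert (Hdel : 0 < del) by (apply Rdiv_lt_0_compat; unfold beta; lra).
  intros eps Heps.
  assert (HCdel : 0 <= 2 * C * del) by (apply Rmult_le_pos; lra).
  destruct (tail_rate_small g sig (eps ^ 2 / (2 * C * del + 1)) ltac:(lra) Hs) as [n0 Hn0].
  { apply Rdiv_lt_0_compat; [apply pow_lt|]; lra. }
  exists n0. intros n x y t0 t1 Hn Ht1 Hxr Hyr Hxs Hys H0 t k Ht Hk.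
  specialize (Hn0 n Hn). set (eta := tail_rate g sig n) in *.
  set (d := fun t k => (x t k - y t k)%C).
  set (tau := fun s => sig / 4 - beta * (s - t0)).
  set (E := fun s => energy g (tau s) (box n) (d s)).
  assert (Htau : forall s, t0 <= s < t1 -> 0 <= tau s <= sig / 4).
  { intros s Hs'. unfold tau. assert (beta * (s - t0) <= beta * del).
    { apply Rmult_le_compat_l; unfold beta; lra. }
    replace (beta * del) with (sig / 4) in H by (unfold del, beta; field; lra).
    assert (0 <= beta * (s - t0)) by (apply Rmult_le_pos; unfold beta; lra). lra. }
  assert (HE : E t <= E t0 + 2 * C * eta * (t - t0)).
  { apply (derive_le_growth E (Derive E) t0 t1 (2 * C * eta)); [| |lra].
    - intros s Hs'.
      assert (Dd : forall k, In k (box n) -> is_derive_C (fun s => d s k) s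
        (- (Bil alpha (x s) (x s) k - Bil alpha (y s) (y s) k))%C).
      { intros j Hj. destruct (Hxs j Hj) as [_ Dx]. destruct (Hys j Hj) as [_ Dy].
        destruct (Dx s Hs') as [Dx1 Dx2]. destruct (Dy s Hs') as [Dy1 Dy2].
        pose proof (is_derive_minus _ _ _ _ _ Dx1 Dy1) as D1.
        pose proof (is_derive_minus _ _ _ _ _ Dx2 Dy2) as D2.
        split.
        - replace (Re _) with (minus (Re (- Bil alpha (x s) (x s) j)%C) (Re (- Bil alpha (y s) (y s) j)%C)).
          + exact D1.
          + unfold minus, plus, opp, Copp, Cminus, Cplus, Re; simpl. ring.
        - replace (Im _) with (minus (Im (- Bil alpha (x s) (x s) j)%C) (Im (- Bil alpha (y s) (y s) j)%C)).
          + exact D2.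
          + unfold minus, plus, opp, Copp, Cminus, Cplus, Im; simpl. ring. }
      pose proof (energy_derive g (sig / 4) beta t0 s (box n) d _ Dd) as D. cbv zeta in D.
      split; [apply Derive_correct; eexists; exact D|].
      replace (Derive E s) with (- 2 * beta * dissip g (tau s) (box n) (d s) +
        2 * lsum (box n) (fun k => Wt g (tau s) k ^ 2 *
          Re (Cconj (d s k) * - (Bil alpha (x s) (x s) k - Bil alpha (y s) (y s) k))%C))
        by (symmetry; exact (is_derive_unique _ _ _ D)).
      destruct (Hxr s ltac:(lra)) as (Gx & Sx & _). destruct (Hyr s ltac:(lra)) as (Gy & _ & _).
      pose proof (Hflux n (x s) (y s) (tau s) (Htau s ltac:(lra)) Gx Gy Sx) as Hf.
      cbv zeta in Hf. fold (d s) in Hf. fold eta in Hf.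
      rewrite (lsum_ext _ _ (fun k => (-1) * (Wt g (tau s) k ^ 2 *
        Re (Cconj (x s k - y s k) * (Bil alpha (x s) (x s) k - Bil alpha (y s) (y s) k))%C))).
      2:{ intros j _. unfold d, Cconj, Cmult, Copp, Cminus, Cplus, Re; cbn [fst snd]. ring. }
      rewrite lsum_scal. apply Rabs_le_between in Hf.
      pose proof (dissip_nonneg g (tau s) (box n) (d s) ltac:(lra)) as HY.
      set (Y := dissip g (tau s) (box n) (d s)) in *.
      match goal with |- context [-1 * ?z] => set (Z := z) end.
      assert (Hf' : - (A * Y + C * eta) <= Z <= A * Y + C * eta) by exact Hf.
      unfold beta. lra.
    - apply energy_right_cont. intros j Hj.
      destruct (Hxs j Hj) as [[Cx1 Cx2] _]. destruct (Hys j Hj) as [[Cy1 Cy2] _].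
      assert (Hm : forall f h : R -> R, right_cont f t0 -> right_cont h t0 ->
        right_cont (fun s => f s - h s) t0).
      { intros f h Hf Hh.
        apply right_cont_ext with (fun s => f s + (-1) * h s); [intros; ring|].
        apply right_cont_plus; [assumption|]. apply right_cont_mult; [|assumption].
        apply right_cont_continuous, continuous_const. }
      split; now apply Hm. }
  assert (HE0 : E t0 = 0).
  { unfold E, energy. apply lsum_zero. intros j Hj. unfold d. rewrite H0 by assumption.
    replace (y t0 j - y t0 j)%C with (RtoC 0) by ring. rewrite Cmod_0. ring. }
  assert (HEt : E t <= eps ^ 2).
  { assert (Heta : 0 < eta) by apply exp_pos.
    assert (2 * C * eta * (t - t0) <= 2 * C * eta * del).
    { apply Rmult_le_compat_l; [repeat apply Rmult_le_pos|]; lra. }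
    assert (eta * (2 * C * del + 1) <= eps ^ 2).
    { apply Rle_trans with (eps ^ 2 / (2 * C * del + 1) * (2 * C * del + 1)).
      - apply Rmult_le_compat_r; lra.
      - right; field; lra. }
    lra. }
  destruct (Z2_eq_dec k (0, 0)%Z) as [->|Hk0].
  { destruct (Hxr t Ht) as (_ & _ & ->). destruct (Hyr t Ht) as (_ & _ & ->).
    replace (RtoC 0 - RtoC 0)%C with (RtoC 0) by ring. rewrite Cmod_0. lra. }
  pose proof (lsum_term_le (box n) (fun k => (Wt g (tau t) k * Cmod (d t k)) ^ 2) k
    (fun _ _ => pow2_ge_0 _) Hk) as Hterm. cbv beta in Hterm.
  fold (energy g (tau t) (box n) (d t)) in Hterm. fold (E t) in Hterm.
  pose proof (Wt_ge1 g (tau t) k ltac:(lra) ltac:(apply Htau; assumption) Hk0) as HW.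
  change (Cmod (d t k) <= eps). pose proof (Cmod_ge_0 (d t k)).
  apply Rle_trans with (Wt g (tau t) k * Cmod (d t k)); [nra|].
  apply Rsqr_incr_0_var; [|lra]. unfold Rsqr. lra.
Qed.

(** * Passage to the limit *)

Lemma Bil_lipschitz (g sig : R) : 0 < g <= 1 -> 0 < sig ->
  exists C, 0 <= C /\ forall alpha a b M K, 0 <= alpha <= 1 ->
    Gev g M sig a -> Gev g M sig b -> Gev g K sig (fun k => a k - b k)%C ->
    forall k, Cmod (Bil alpha a a k - Bil alpha b b k)%C <= C * M * K.
Proof.
  intros Hg Hs. destruct (Bil_Gev g sig Hg Hs) as [C [HC HB]].
  exists (2 * C). split; [lra|]. intros alpha a b M K Hal Ha Hb Hd k.
  pose proof (Gev_nonneg _ _ _ _ Ha) as HM. pose proof (Gev_nonneg _ _ _ _ Hd) as HK.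
  set (d := fun k => (a k - b k)%C) in *.
  assert (E1 : Bil alpha a a k = (Bil alpha a d k + Bil alpha a b k)%C).
  { rewrite <- (Bil_plus_r g M K M sig) by (auto; lra).
    apply Bil_ext; intros j; unfold d; ring. }
  assert (E2 : Bil alpha a b k = (Bil alpha d b k + Bil alpha b b k)%C).
  { rewrite <- (Bil_plus_l g K M M sig) by (auto; lra).
    apply Bil_ext; intros j; unfold d; ring. }
  rewrite E1, E2.
  replace (Bil alpha a d k + (Bil alpha d b k + Bil alpha b b k) - Bil alpha b b k)%C
    with (Bil alpha a d k + Bil alpha d b k)%C by ring.
  eapply Rle_trans; [apply Cmod_triangle|].
  pose proof (HB alpha a d M K Hal Ha Hd k) as B1. pose proof (HB alpha d b K M Hal Hd Hb k) as B2.
  assert (He : exp (- (sig / 2) * lam g k) <= 1).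
  { rewrite <- exp_0. apply exp_mono. pose proof (lam_ge1 g k ltac:(lra)). nra. }
  assert (0 <= C * M * K) by (repeat apply Rmult_le_pos; assumption).
  assert (0 <= C * K * M) by (repeat apply Rmult_le_pos; assumption).
  nra.
Qed.

(** A quadratic Taylor remainder is a closed condition and survives pointwise limits, which
    differentiability does not; this converts it back. *)
Lemma quadratic_error_derive (F : R -> R) (a r L G : R) : 0 < r ->
  (forall b, Rabs (b - a) < r -> Rabs (F b - F a - (b - a) * G) <= L * (b - a) ^ 2) ->
  is_derive F a G.
Proof.
  intros Hr H. apply is_derive_Reals. intros eps Heps.
  assert (HL : 0 < Rabs L + 1) by (pose proof (Rabs_pos L); lra).
  assert (Hd : 0 < Rmin r (eps / (Rabs L + 1))) by (apply Rmin_glb_lt; [assumption|now apply Rdiv_lt_0_compat]).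
  exists (mkposreal _ Hd). intros h Hh0 Hh. simpl in Hh.
  pose proof (Rmin_l r (eps / (Rabs L + 1))). pose proof (Rmin_r r (eps / (Rabs L + 1))).
  specialize (H (a + h)). replace (a + h - a) with h in H by ring. specialize (H ltac:(lra)).
  replace ((F (a + h) - F a) / h - G) with ((F (a + h) - F a - h * G) / h) by (field; assumption).
  unfold Rdiv. rewrite Rabs_mult, Rabs_inv. pose proof (Rabs_pos_lt h Hh0) as Hp.
  apply Rmult_lt_reg_r with (Rabs h); [assumption|].
  rewrite Rmult_assoc, Rinv_l, Rmult_1_r by lra.
  rewrite <- (pow2_abs h) in H.
  assert (L * Rabs h ^ 2 <= (Rabs L + 1) * Rabs h * Rabs h).
  { pose proof (Rle_abs L). assert (0 < Rabs h * Rabs h) by nra. nra. }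
  assert ((Rabs L + 1) * Rabs h < eps).
  { apply Rlt_le_trans with ((Rabs L + 1) * (eps / (Rabs L + 1))); [apply Rmult_lt_compat_l; lra|].
    right; field; lra. }
  nra.
Qed.

Lemma quadratic_error_right_cont (F : R -> R) (a r L G : R) : 0 < r ->
  (forall b, a <= b < a + r -> Rabs (F b - F a - (b - a) * G) <= L * (b - a) ^ 2) ->
  right_cont F a.
Proof.
  intros Hr H.
  (* Continuing F to the left of a by its tangent line reduces the one-sided case to the two-sided
     one. *)
  set (Fe := fun b => if Rle_dec a b then F b else F a + (b - a) * G).
  assert (HD : is_derive Fe a G).
  { apply (quadratic_error_derive Fe a r (Rabs L) G Hr). intros b Hb. unfold Fe.
    destruct (Rle_dec a a); [|lra]. destruct (Rle_dec a b).
    - apply Rabs_def2 in Hb. eapply Rle_trans; [apply H; lra|].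
      apply Rmult_le_compat_r; [apply pow2_ge_0|apply Rle_abs].
    - replace (F a + (b - a) * G - F a - (b - a) * G) with 0 by ring. rewrite Rabs_R0.
      apply Rmult_le_pos; [apply Rabs_pos|apply pow2_ge_0]. }
  assert (HC : right_cont Fe a).
  { apply right_cont_continuous, (ex_derive_continuous (V := R_NormedModule)). now exists G. }
  unfold right_cont in *.
  replace (Fe a) with (F a) in HC by (unfold Fe; destruct (Rle_dec a a); [reflexivity|lra]).
  eapply filterlim_ext_loc; [|exact HC].
  exists (mkposreal 1 Rlt_0_1). intros b _ Hb. unfold Fe. destruct (Rle_dec a b); [reflexivity|lra].
Qed.

(** A Lipschitz constant for df that is uniform in n yields the remainder L (b - a)^2 for every f n,
    hence for the limit; pointwise convergence of f n and df n then suffices. *)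
Lemma limit_of_derivatives (f df : nat -> R -> R) (F G : R -> R) (T L : R) (n0 : nat) : 0 < T ->
  (forall n t, (n0 <= n)%nat -> 0 <= t < T -> is_derive (f n) t (df n t)) ->
  (forall n a b, (n0 <= n)%nat -> 0 <= a < T -> 0 <= b < T ->
     Rabs (df n a - df n b) <= L * Rabs (a - b)) ->
  (forall t, 0 <= t < T -> is_lim_seq (fun n => f n t) (F t)) ->
  (forall t, 0 <= t < T -> is_lim_seq (fun n => df n t) (G t)) ->
  right_cont F 0 /\ forall t, 0 < t < T -> is_derive F t (G t).
Proof.
  intros HT Hd HLip Hf Hdf.
  assert (HL : 0 <= L).
  { pose proof (HLip n0 0 (T / 2) (le_n _) ltac:(lra) ltac:(lra)) as H.
    pose proof (Rabs_pos (df n0 0 - df n0 (T / 2))).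
    rewrite (Rabs_left (0 - T / 2)) in H by lra.
    apply Rmult_le_reg_r with (T / 2); lra. }
  assert (Hquad : forall n a b, (n0 <= n)%nat -> 0 <= a < T -> 0 <= b < T ->
    Rabs (f n b - f n a - (b - a) * df n a) <= L * (b - a) ^ 2).
  { intros n a b Hn Ha Hb.
    assert (Hab : forall x, Rmin a b <= x <= Rmax a b -> 0 <= x < T).
    { intros x [H1 H2]. split.
      - eapply Rle_trans; [|exact H1]. apply Rmin_glb; lra.
      - eapply Rle_lt_trans; [exact H2|]. apply Rmax_lub_lt; lra. }
    destruct (MVT_gen (f n) a b (df n)) as [c [Hc Ec]].
    - intros x Hx. apply Hd; [assumption|]. apply Hab; lra.
    - intros x Hx. apply continuity_pt_filterlim, (ex_derive_continuous (V := R_NormedModule)).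
      exists (df n x). apply Hd; auto.
    - rewrite Ec. replace (df n c * (b - a) - (b - a) * df n a) with ((df n c - df n a) * (b - a)) by ring.
      rewrite Rabs_mult, <- (pow2_abs (b - a)).
      apply Rle_trans with (L * Rabs (b - a) * Rabs (b - a)); [|right; ring].
      apply Rmult_le_compat_r; [apply Rabs_pos|].
      eapply Rle_trans; [apply HLip; auto|]. apply Rmult_le_compat_l; [assumption|].
      unfold Rmin, Rmax in Hc. destruct (Rle_dec a b);
        unfold Rabs; repeat destruct Rcase_abs; lra. }
  assert (Hlim : forall a b, 0 <= a < T -> 0 <= b < T ->
    Rabs (F b - F a - (b - a) * G a) <= L * (b - a) ^ 2).
  { intros a b Ha Hb.
    assert (Hl : is_lim_seq (fun n => f n b - f n a - (b - a) * df n a) (F b - F a - (b - a) * G a)).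
    { apply is_lim_seq_minus'; [apply is_lim_seq_minus'; auto|].
      apply (is_lim_seq_scal_l _ (b - a) (Finite (G a))). auto. }
    apply (is_lim_seq_abs _ (Finite _)) in Hl.
    assert (Hle := is_lim_seq_le_loc _ (fun _ => L * (b - a) ^ 2) _ (Finite _)
      (ex_intro _ n0 (fun n Hn => Hquad n a b Hn Ha Hb)) Hl (is_lim_seq_const _)).
    exact Hle. }
  split.
  - apply (quadratic_error_right_cont F 0 T L (G 0) HT). intros b Hb. apply Hlim; lra.
  - intros t Ht. apply (quadratic_error_derive F t (Rmin t (T - t)) L (G t)).
    + apply Rmin_glb_lt; lra.
    + intros b Hb. pose proof (Rmin_l t (T - t)). pose proof (Rmin_r t (T - t)).
      apply Rabs_def2 in Hb. apply Hlim; lra.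
Qed.

Lemma is_lim_seq_Cmod (u : nat -> C) (l : C) :
  (forall eps, 0 < eps -> exists n0, forall n, (n0 <= n)%nat -> Cmod (u n - l)%C <= eps) ->
  is_lim_seq (fun n => Re (u n)) (Re l) /\ is_lim_seq (fun n => Im (u n)) (Im l).
Proof.
  intros H. split; apply is_lim_seq_spec; intros eps;
    (destruct (H (eps / 2)) as [n0 Hn0]; [pose proof (cond_pos eps); lra|]);
    exists n0; intros n Hn; specialize (Hn0 n Hn); pose proof (cond_pos eps).
  - pose proof (re_le_Cmod (u n - l)%C) as Hr.
    change (Rabs (Re (u n) - Re l) <= Cmod (u n - l)%C) in Hr.
    change (Rabs (Re (u n) - Re l) < eps). lra.
  - pose proof (im_le_Cmod (u n - l)%C) as Hr.
    change (Rabs (Im (u n) - Im l) <= Cmod (u n - l)%C) in Hr.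
    change (Rabs (Im (u n) - Im l) < eps). lra.
Qed.

Lemma Cmod_cauchy_lim (u : nat -> C) :
  (forall eps, 0 < eps -> exists n0, forall n m, (n0 <= n)%nat -> (n <= m)%nat ->
     Cmod (u n - u m)%C <= eps) ->
  let l := (real (Lim_seq (fun n => Re (u n))), real (Lim_seq (fun n => Im (u n)))) in
  is_lim_seq (fun n => Re (u n)) (Re l) /\ is_lim_seq (fun n => Im (u n)) (Im l).
Proof.
  intros H l. split; apply Lim_seq_correct', ex_lim_seq_cauchy_corr; intros eps;
    (destruct (H (eps / 3)) as [n0 Hn0]; [pose proof (cond_pos eps); lra|]);
    exists n0; intros n m Hn Hm;
    pose proof (Hn0 n0 n (le_n _) Hn) as H1; pose proof (Hn0 n0 m (le_n _) Hm) as H2;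
    pose proof (cond_pos eps).
  - pose proof (re_le_Cmod (u n0 - u n)%C) as R1. pose proof (re_le_Cmod (u n0 - u m)%C) as R2.
    change (Rabs (Re (u n0) - Re (u n)) <= Cmod (u n0 - u n)%C) in R1.
    change (Rabs (Re (u n0) - Re (u m)) <= Cmod (u n0 - u m)%C) in R2.
    apply Rabs_def1; unfold Rabs in R1, R2; repeat destruct Rcase_abs; lra.
  - pose proof (im_le_Cmod (u n0 - u n)%C) as R1. pose proof (im_le_Cmod (u n0 - u m)%C) as R2.
    change (Rabs (Im (u n0) - Im (u n)) <= Cmod (u n0 - u n)%C) in R1.
    change (Rabs (Im (u n0) - Im (u m)) <= Cmod (u n0 - u m)%C) in R2.
    apply Rabs_def1; unfold Rabs in R1, R2; repeat destruct Rcase_abs; lra.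
Qed.

Lemma Cmod_limit_le (u : nat -> C) (l c : C) (B : R) (n0 : nat) :
  is_lim_seq (fun n => Re (u n)) (Re l) -> is_lim_seq (fun n => Im (u n)) (Im l) ->
  (forall n, (n0 <= n)%nat -> Cmod (c - u n)%C <= B) -> Cmod (c - l)%C <= B.
Proof.
  intros HR HI H.
  assert (HB : 0 <= B) by (eapply Rle_trans; [apply Cmod_ge_0|apply (H n0 (le_n _))]).
  assert (Hsq : (Re c - Re l) ^ 2 + (Im c - Im l) ^ 2 <= B ^ 2).
  { assert (Hl : is_lim_seq (fun n => (Re c - Re (u n)) ^ 2 + (Im c - Im (u n)) ^ 2)
      ((Re c - Re l) ^ 2 + (Im c - Im l) ^ 2)).
    { apply is_lim_seq_plus'.
      - apply (is_lim_seq_ext (fun n => (Re c - Re (u n)) * (Re c - Re (u n)))); [intros; ring|].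
        replace ((Re c - Re l) ^ 2) with ((Re c - Re l) * (Re c - Re l)) by ring.
        apply is_lim_seq_mult'; apply is_lim_seq_minus'; auto; apply is_lim_seq_const.
      - apply (is_lim_seq_ext (fun n => (Im c - Im (u n)) * (Im c - Im (u n)))); [intros; ring|].
        replace ((Im c - Im l) ^ 2) with ((Im c - Im l) * (Im c - Im l)) by ring.
        apply is_lim_seq_mult'; apply is_lim_seq_minus'; auto; apply is_lim_seq_const. }
    assert (Hev : forall n, (n0 <= n)%nat -> (Re c - Re (u n)) ^ 2 + (Im c - Im (u n)) ^ 2 <= B ^ 2).
    { intros n Hn. specialize (H n Hn).
      replace ((Re c - Re (u n)) ^ 2 + (Im c - Im (u n)) ^ 2) with (Cmod (c - u n)%C ^ 2).
      - apply pow_incr. split; [apply Cmod_ge_0|assumption].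
      - rewrite Cmod2_alt. reflexivity. }
    exact (is_lim_seq_le_loc _ (fun _ => B ^ 2) _ (Finite _) (ex_intro _ n0 Hev) Hl (is_lim_seq_const _)). }
  assert (E : Cmod (c - l)%C ^ 2 <= B ^ 2) by (rewrite Cmod2_alt; exact Hsq).
  pose proof (Cmod_ge_0 (c - l)%C). apply Rsqr_incr_0_var; [|assumption]. unfold Rsqr. lra.
Qed.

(* Interpolation: smallness in the sup norm and a Gevrey bound give smallness in a Gevrey
   class of half the radius. *)
Lemma Gev_interpolate (g M sig eps : R) (a : coeffs) : 0 <= eps -> 
  Gev g M sig a -> (forall k, Cmod (a k) <= eps) -> Gev g (sqrt (eps * M)) (sig / 2) a.
Proof.
  intros He Ha Hs k. pose proof (Gev_nonneg _ _ _ _ Ha) as HM.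
  assert (HeM : 0 <= eps * M) by (apply Rmult_le_pos; assumption).
  pose proof (sqrt_pos (eps * M)). pose proof (exp_pos (- (sig / 2) * lam g k)).
  apply Rsqr_incr_0_var; [|apply Rmult_le_pos; lra]. unfold Rsqr.
  replace (sqrt (eps * M) * exp (- (sig / 2) * lam g k) * (sqrt (eps * M) * exp (- (sig / 2) * lam g k)))
    with ((sqrt (eps * M) * sqrt (eps * M)) * (exp (- (sig / 2) * lam g k) * exp (- (sig / 2) * lam g k))) by ring.
  rewrite sqrt_sqrt by assumption. rewrite <- exp_plus.
  replace (- (sig / 2) * lam g k + - (sig / 2) * lam g k) with (- sig * lam g k) by field.
  rewrite Rmult_assoc. apply Rmult_le_compat; auto using Cmod_ge_0.
Qed.

Lemma Gev_limit (g M sig : R) (u : nat -> coeffs) (a : coeffs) :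
  (forall n, Gev g M sig (u n)) ->
  (forall k, is_lim_seq (fun n => Re (u n k)) (Re (a k)) /\ is_lim_seq (fun n => Im (u n k)) (Im (a k))) ->
  Gev g M sig a.
Proof.
  intros Hu Hl k. destruct (Hl k) as [HR HI].
  pose proof (Cmod_limit_le (fun n => u n k) (a k) (RtoC 0) (M * exp (- sig * lam g k)) 0 HR HI) as H.
  replace (RtoC 0 - a k)%C with (- a k)%C in H by ring. rewrite Cmod_opp in H. apply H.
  intros n _. replace (RtoC 0 - u n k)%C with (- u n k)%C by ring. rewrite Cmod_opp. apply Hu.
Qed.

(** * Uniqueness in the Gevrey class *)

Definition gev_solution (g alpha T : R) (x : R -> coeffs) : Prop :=
  (forall k, right_cont_C (fun s => x s k) 0) /\
  (forall k t, 0 < t < T -> is_derive_C (fun s => x s k) t (- Bil alpha (x t) (x t) k)%C) /\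
  (forall T', 0 < T' < T -> exists M sig, 0 < sig /\ regular g M sig 0 T' x).

Lemma is_derive_C_right_cont (f : R -> C) (t : R) (l : C) : is_derive_C f t l -> right_cont_C f t.
Proof.
  intros [HR HI]. split; apply right_cont_continuous, (ex_derive_continuous (V := R_NormedModule)).
  - now exists (Re l).
  - now exists (Im l).
Qed.

Lemma regular_weaken (g M M' sig sig' a b a' b' : R) (x : R -> coeffs) : 0 < g ->
  M <= M' -> sig' <= sig -> a <= a' -> b' <= b -> regular g M sig a b x -> regular g M' sig' a' b' x.
Proof.
  intros Hg HM Hs Ha Hb H t Ht. destruct (H t ltac:(lra)) as (H1 & H2 & H3).
  split; [|split; assumption]. now apply (Gev_weaken g M M' sig sig').
Qed.

(** The bounds may degenerate as T' tends to T, so T' is fixed between t and T, and the larger M and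
    the smaller sig of the two solutions give one step length for all of [0, T'). *)
Theorem gevrey_uniqueness (g alpha T : R) (x y : R -> coeffs) : 0 < g <= 1 -> 0 <= alpha <= g ->
  gev_solution g alpha T x -> gev_solution g alpha T y -> (forall k, x 0 k = y 0 k) ->
  forall t k, 0 <= t < T -> x t k = y t k.
Proof.
  intros Hg Hal (Cx & Dx & Rx) (Cy & Dy & Ry) H0 t k Ht. revert k.
  set (T' := (t + T) / 2).
  assert (HT' : t < T' < T) by (unfold T'; lra).
  destruct (Rx T' ltac:(lra)) as (M1 & s1 & Hs1 & Rx1).
  destruct (Ry T' ltac:(lra)) as (M2 & s2 & Hs2 & Ry1).
  set (M := Rmax M1 M2). set (sig := Rmin s1 s2).
  assert (Hsig : 0 < sig) by now apply Rmin_glb_lt.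
  assert (Rx2 : regular g M sig 0 T' x).
  { apply (regular_weaken g M1 M s1 sig 0 T'); try lra; [apply Rmax_l|apply Rmin_l|assumption]. }
  assert (Ry2 : regular g M sig 0 T' y).
  { apply (regular_weaken g M2 M s2 sig 0 T'); try lra; [apply Rmax_r|apply Rmin_r|assumption]. }
  assert (HM : 0 <= M) by (destruct (Rx2 t ltac:(lra)) as [G _]; now apply Gev_nonneg in G).
  destruct (mode_stability g alpha M sig Hg Hal Hsig HM) as (del & Hdel & Hst).
  (* The windows have length del but start at multiples of del / 2: agreement holds on half-open
     windows, and the overlap puts the next starting time strictly inside. *)
  assert (Hstep : forall j s, 0 <= s < T' -> s <= INR j * (del / 2) -> forall k, x s k = y s k).
  { induction j; intros s Hs Hsj.
    - simpl in Hsj. replace s with 0 by lra. assumption.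
    - rewrite S_INR, Rmult_plus_distr_r in Hsj. destruct (Rle_dec s (INR j * (del / 2))) as [|Hn]; [now apply IHj|].
      set (t0 := INR j * (del / 2)) in *.
      assert (Ht0 : 0 <= t0) by (apply Rmult_le_pos; [apply pos_INR|lra]).
      set (t1 := Rmin T' (t0 + del)).
      assert (Hst1 : s < t1) by (apply Rmin_glb_lt; lra).
      assert (Ht1 : t1 <= T' /\ t1 <= t0 + del) by (split; [apply Rmin_l|apply Rmin_r]).
      assert (Hsol : forall z n, (forall k, right_cont_C (fun s => z s k) 0) ->
        (forall k t, 0 < t < T -> is_derive_C (fun s => z s k) t (- Bil alpha (z t) (z t) k)%C) ->
        solves_modes alpha n t0 t1 z).
      { intros z n Cz Dz k _. split.
        - destruct (Rle_lt_or_eq_dec 0 t0 Ht0) as [Hp|E]; [|rewrite <- E; apply Cz].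
          eapply is_derive_C_right_cont, Dz. lra.
        - intros r Hr. apply Dz. lra. }
      intros k.
      assert (Hz : Cmod (x s k - y s k)%C = 0).
      { apply Rle_antisym; [|apply Cmod_ge_0]. apply le_epsilon. intros eps Heps.
        rewrite Rplus_0_l. destruct (Hst eps Heps) as [n0 Hn0].
        apply (Hn0 (Nat.max n0 (zsize k)) x y t0 t1); try lia; try lra; auto.
        - apply (regular_weaken g M M sig sig 0 T'); try lra; assumption.
        - apply (regular_weaken g M M sig sig 0 T'); try lra; assumption.
        - intros j' _. apply IHj; lra.
        - apply in_box_zsize. lia. }
      apply Cmod_eq_0 in Hz. replace (x s k) with ((x s k - y s k) + y s k)%C by ring.
      rewrite Hz. ring. }
  destruct (nfloor_ex (t / (del / 2))) as [j [_ Hj]].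
  { apply Rle_div_r; lra. }
  apply (Hstep (S j)); [lra|]. rewrite S_INR. apply Rlt_div_l in Hj; lra.
Qed.

Lemma derive_bound_lipschitz (f df : R -> R) (T B : R) :
  (forall t, 0 <= t < T -> is_derive f t (df t) /\ Rabs (df t) <= B) ->
  forall a b, 0 <= a < T -> 0 <= b < T -> Rabs (f a - f b) <= B * Rabs (a - b).
Proof.
  intros H a b Ha Hb.
  assert (Hab : forall x, Rmin b a <= x <= Rmax b a -> 0 <= x < T).
  { intros x [H1 H2]. split.
    - eapply Rle_trans; [|exact H1]. apply Rmin_glb; lra.
    - eapply Rle_lt_trans; [exact H2|]. apply Rmax_lub_lt; lra. }
  destruct (MVT_gen f b a df) as [c [Hc Ec]].
  - intros x Hx. apply H. apply Hab; lra.
  - intros x Hx. apply continuity_pt_filterlim, (ex_derive_continuous (V := R_NormedModule)).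
    exists (df x). apply H; auto.
  - rewrite Ec, Rabs_mult. apply Rmult_le_compat_r; [apply Rabs_pos|]. apply H; auto.
Qed.

(** * The limit of the Galerkin truncations *)

Section Limit.
Variables (g alpha M sig T : R) (v : nat -> R -> coeffs) (th0 : coeffs).
Hypotheses (Hg : 0 < g <= 1) (Hal : 0 <= alpha <= g) (Hsig : 0 < sig) (HT : 0 < T)
  (Hv0 : forall N k, In k (box N) -> v N 0 k = th0 k)
  (Hreg : forall N, regular g M sig 0 T (v N))
  (Hsup : forall N t, 0 <= t < T -> supported N (v N t))
  (Hder : forall N t k, 0 <= t < T -> In k (box N) ->
     is_derive_C (fun s => v N s k) t (- Bil alpha (v N t) (v N t) k)%C)
  (Hcauchy : forall eps, 0 < eps -> exists n1, forall m p t k, (n1 <= m)%nat -> (m <= p)%nat ->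
     0 <= t < T -> In k (box m) -> Cmod (v m t k - v p t k)%C <= eps).

Definition galerkin_limit (t : R) (k : Z2) : C :=
  (real (Lim_seq (fun n => Re (v n t k))), real (Lim_seq (fun n => Im (v n t k)))).

Lemma galerkin_limit_correct (t : R) (k : Z2) : 0 <= t < T ->
  is_lim_seq (fun n => Re (v n t k)) (Re (galerkin_limit t k)) /\
  is_lim_seq (fun n => Im (v n t k)) (Im (galerkin_limit t k)).
Proof.
  intros Ht. apply (Cmod_cauchy_lim (fun n => v n t k)). intros eps Heps.
  destruct (Hcauchy eps Heps) as [n1 Hn1]. exists (Nat.max n1 (zsize k)). intros n m Hn Hm.
  apply Hn1; auto; try lia. apply in_box_zsize. lia.
Qed.

Lemma galerkin_limit_init (k : Z2) : galerkin_limit 0 k = th0 k.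
Proof.
  destruct (th0 k) as [a b] eqn:E. unfold galerkin_limit.
  assert (Hev : forall n, (zsize k <= n)%nat -> v n 0 k = (a, b)).
  { intros n Hn. rewrite <- E. apply Hv0. now apply in_box_zsize. }
  f_equal.
  - rewrite (Lim_seq_ext_loc _ (fun _ => a)); [now rewrite Lim_seq_const|].
    exists (zsize k). intros n Hn. now rewrite Hev.
  - rewrite (Lim_seq_ext_loc _ (fun _ => b)); [now rewrite Lim_seq_const|].
    exists (zsize k). intros n Hn. now rewrite Hev.
Qed.

Lemma galerkin_limit_regular : regular g M sig 0 T galerkin_limit.
Proof.
  intros t Ht. split; [|split].
  - apply (Gev_limit g M sig (fun n => v n t)).
    + intros n. now apply Hreg.
    + intros k. now apply galerkin_limit_correct.
  - intros k. unfold galerkin_limit, Cconj; cbn [fst snd]. f_equal.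
    + f_equal. apply Lim_seq_ext. intros n. destruct (Hreg n t Ht) as (_ & Hc & _). now rewrite Hc.
    + rewrite (Lim_seq_ext _ (fun n => - Im (v n t k))).
      * rewrite Lim_seq_opp. destruct (Lim_seq (fun n => Im (v n t k))); simpl; ring.
      * intros n. destruct (Hreg n t Ht) as (_ & Hc & _). now rewrite Hc.
  - unfold galerkin_limit. unfold RtoC. f_equal.
    + rewrite (Lim_seq_ext _ (fun _ => 0)); [now rewrite Lim_seq_const|].
      intros n. destruct (Hreg n t Ht) as (_ & _ & Hz). now rewrite Hz.
    + rewrite (Lim_seq_ext _ (fun _ => 0)); [now rewrite Lim_seq_const|].
      intros n. destruct (Hreg n t Ht) as (_ & _ & Hz). now rewrite Hz.
Qed.

Let HM : 0 <= M.
Proof. destruct (Hreg O 0 ltac:(lra)) as [H _]. now apply Gev_nonneg in H. Qed.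

(** Convergence of single modes does not pass through the infinite sum in [Bil]; convergence in a
    Gevrey class does. Inside the box it comes from the Cauchy property and interpolation, outside
    from the decay of the tails. *)
Lemma galerkin_limit_close (eps : R) : 0 < eps -> exists n2, forall n t, (n2 <= n)%nat ->
  0 <= t < T -> Gev g eps (sig / 2) (fun k => v n t k - galerkin_limit t k)%C.
Proof.
  intros Heps.
  (* Chosen so that sqrt(2 M e1) and 2 M e2, the contributions of the low and high modes, are each
     at most eps / 2; the 1 in the denominators covers M = 0. *)
  set (e1 := (eps / 2) ^ 2 / (M + M + 1)). set (e2 := eps / 2 / (M + M + 1)).
  assert (He1 : 0 < e1) by (apply Rdiv_lt_0_compat; [apply pow_lt|]; lra).
  assert (He2 : 0 < e2) by (apply Rdiv_lt_0_compat; lra).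
  destruct (Hcauchy e1 He1) as [n1 Hn1].
  destruct (tail_rate_small g sig e2 ltac:(lra) Hsig He2) as [n3 Hn3].
  exists (Nat.max n1 n3). intros n t Hn Ht.
  set (D := fun k => (v n t k - galerkin_limit t k)%C).
  assert (HD : Gev g (M + M) sig D).
  { apply Gev_minus; [now apply Hreg|now apply galerkin_limit_regular]. }
  assert (Hlow : Gev g (sqrt (e1 * (M + M))) (sig / 2) (low_modes n D)).
  { apply Gev_interpolate; [lra|now apply low_modes_Gev|].
    intros k. unfold low_modes. destruct (in_dec Z2_eq_dec k (box n)) as [Hk|]; [|rewrite Cmod_0; lra].
    destruct (galerkin_limit_correct t k Ht) as [LR LI].
    apply (Cmod_limit_le (fun p => v p t k) (galerkin_limit t k) (v n t k) e1 n LR LI).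
    intros p Hp. apply Hn1; auto; lia. }
  assert (Hhigh := high_modes_Gev g (M + M) sig n D ltac:(lra) Hsig HD).
  pose proof (Gev_plus _ _ _ _ _ _ Hlow Hhigh) as Hsum.
  specialize (Hn3 n ltac:(lia)).
  assert (Hs1 : sqrt (e1 * (M + M)) <= eps / 2).
  { rewrite <- (sqrt_pow2 (eps / 2)) by lra. apply sqrt_le_1_alt.
    apply Rle_trans with (e1 * (M + M + 1)); [apply Rmult_le_compat_l; lra|].
    unfold e1. right. field. lra. }
  assert (Hs2 : (M + M) * tail_rate g sig n <= eps / 2).
  { apply Rle_trans with ((M + M + 1) * e2).
    - apply Rmult_le_compat; try lra. apply Rlt_le, exp_pos.
    - unfold e2. right. field. lra. }
  intros k. change (Cmod (D k) <= eps * exp (- (sig / 2) * lam g k)).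
  rewrite (low_high_split n D k). eapply Rle_trans; [apply Hsum|].
  apply Rmult_le_compat_r; [apply Rlt_le, exp_pos|lra].
Qed.

(** The transport term is bounded in a Gevrey class uniformly in n, hence so is the time derivative.
    With [Bil_lipschitz] this makes the time derivatives themselves Lipschitz, as
    [limit_of_derivatives] demands. *)
Lemma galerkin_time_lipschitz : exists K, 0 <= K /\ forall n a b, 0 <= a < T -> 0 <= b < T ->
  Gev g (K * Rabs (a - b)) (sig / 2) (fun k => v n a k - v n b k)%C.
Proof.
  destruct (Bil_Gev g sig Hg Hsig) as [C [HC HB]].
  exists (2 * (C * M * M)). split; [repeat apply Rmult_le_pos; lra|].
  intros n a b Ha Hb k. pose proof (Rabs_pos (a - b)) as Hab.
  pose proof (exp_pos (- (sig / 2) * lam g k)) as He.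
  assert (HCM : 0 <= C * M * M) by (repeat apply Rmult_le_pos; lra).
  destruct (in_dec Z2_eq_dec k (box n)) as [Hk|Hk].
  - set (e := C * M * M * exp (- (sig / 2) * lam g k)).
    assert (Hbound : forall t, 0 <= t < T -> Cmod (- Bil alpha (v n t) (v n t) k)%C <= e).
    { intros t Ht. rewrite Cmod_opp. apply HB; [lra| |]; now apply Hreg. }
    pose proof (derive_bound_lipschitz (fun s => Re (v n s k))
      (fun t => Re (- Bil alpha (v n t) (v n t) k)%C) T e
      (fun t Ht => conj (proj1 (Hder n t k Ht Hk))
         (Rle_trans _ _ _ (re_le_Cmod _) (Hbound t Ht))) a b Ha Hb) as LR.
    pose proof (derive_bound_lipschitz (fun s => Im (v n s k))
      (fun t => Im (- Bil alpha (v n t) (v n t) k)%C) T e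
      (fun t Ht => conj (proj2 (Hder n t k Ht Hk))
         (Rle_trans _ _ _ (im_le_Cmod _) (Hbound t Ht))) a b Ha Hb) as LI.
    eapply Rle_trans; [apply Cmod_le_abs|].
    change (Rabs (Re (v n a k) - Re (v n b k)) + Rabs (Im (v n a k) - Im (v n b k)) <=
      2 * (C * M * M) * Rabs (a - b) * exp (- (sig / 2) * lam g k)).
    unfold e in LR, LI. lra.
  - rewrite !Hsup by assumption. replace (RtoC 0 - RtoC 0)%C with (RtoC 0) by ring.
    rewrite Cmod_0. repeat apply Rmult_le_pos; lra.
Qed.

Lemma galerkin_limit_solution : gev_solution g alpha T galerkin_limit.
Proof.
  destruct (Bil_lipschitz g (sig / 2) Hg ltac:(lra)) as [C [HC HB]].
  destruct galerkin_time_lipschitz as [K [HK HKl]].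
  assert (Hhalf : forall t, 0 <= t < T -> forall n, Gev g M (sig / 2) (v n t)).
  { intros t Ht n. apply (Gev_weaken g M M sig); try lra. now apply Hreg. }
  assert (Hhalf' : forall t, 0 <= t < T -> Gev g M (sig / 2) (galerkin_limit t)).
  { intros t Ht. apply (Gev_weaken g M M sig); try lra. now apply galerkin_limit_regular. }
  assert (HCM : 0 <= C * M) by (apply Rmult_le_pos; assumption).
  assert (Hlim : forall t k, 0 <= t < T ->
    is_lim_seq (fun n => Re (- Bil alpha (v n t) (v n t) k)%C)
      (Re (- Bil alpha (galerkin_limit t) (galerkin_limit t) k)%C) /\
    is_lim_seq (fun n => Im (- Bil alpha (v n t) (v n t) k)%C)
      (Im (- Bil alpha (galerkin_limit t) (galerkin_limit t) k)%C)).
  { intros t k Ht. apply is_lim_seq_Cmod. intros eps Heps.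
    destruct (galerkin_limit_close (eps / (C * M + 1))) as [n2 Hn2]; [apply Rdiv_lt_0_compat; lra|].
    exists n2. intros n Hn.
    replace (- Bil alpha (v n t) (v n t) k - - Bil alpha (galerkin_limit t) (galerkin_limit t) k)%C
      with (- (Bil alpha (v n t) (v n t) k - Bil alpha (galerkin_limit t) (galerkin_limit t) k))%C by ring.
    rewrite Cmod_opp. eapply Rle_trans.
    - apply (HB alpha _ _ M (eps / (C * M + 1))); auto. lra.
    - apply Rle_trans with ((C * M + 1) * (eps / (C * M + 1))).
      + apply Rmult_le_compat_r; [|lra]. apply Rlt_le, Rdiv_lt_0_compat; lra.
      + right; field; lra. }
  assert (Hlip : forall n a b k, 0 <= a < T -> 0 <= b < T ->
    Cmod (- Bil alpha (v n a) (v n a) k - - Bil alpha (v n b) (v n b) k)%C <=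
    C * M * K * Rabs (a - b)).
  { intros n a b k Ha Hb.
    replace (- Bil alpha (v n a) (v n a) k - - Bil alpha (v n b) (v n b) k)%C
      with (- (Bil alpha (v n a) (v n a) k - Bil alpha (v n b) (v n b) k))%C by ring.
    rewrite Cmod_opp, Rmult_assoc. apply HB; auto. lra. }
  assert (Hmain : forall k,
    (right_cont (fun t => Re (galerkin_limit t k)) 0 /\
     forall t, 0 < t < T -> is_derive (fun t => Re (galerkin_limit t k)) t
       (Re (- Bil alpha (galerkin_limit t) (galerkin_limit t) k)%C)) /\
    (right_cont (fun t => Im (galerkin_limit t k)) 0 /\
     forall t, 0 < t < T -> is_derive (fun t => Im (galerkin_limit t k)) t
       (Im (- Bil alpha (galerkin_limit t) (galerkin_limit t) k)%C))).
  { intros k. split.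
    - apply (limit_of_derivatives (fun n t => Re (v n t k))
        (fun n t => Re (- Bil alpha (v n t) (v n t) k)%C) _
        (fun t => Re (- Bil alpha (galerkin_limit t) (galerkin_limit t) k)%C) T (C * M * K) (zsize k) HT).
      + intros n t Hn Ht. apply Hder; [assumption|]. now apply in_box_zsize.
      + intros n a b _ Ha Hb. eapply Rle_trans; [|now apply (Hlip n a b k)].
        exact (re_le_Cmod (- Bil alpha (v n a) (v n a) k - - Bil alpha (v n b) (v n b) k)%C).
      + intros t Ht. exact (proj1 (galerkin_limit_correct t k Ht)).
      + intros t Ht. exact (proj1 (Hlim t k Ht)).
    - apply (limit_of_derivatives (fun n t => Im (v n t k))
        (fun n t => Im (- Bil alpha (v n t) (v n t) k)%C) _
        (fun t => Im (- Bil alpha (galerkin_limit t) (galerkin_limit t) k)%C) T (C * M * K) (zsize k) HT).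
      + intros n t Hn Ht. apply Hder; [assumption|]. now apply in_box_zsize.
      + intros n a b _ Ha Hb. eapply Rle_trans; [|now apply (Hlip n a b k)].
        exact (im_le_Cmod (- Bil alpha (v n a) (v n a) k - - Bil alpha (v n b) (v n b) k)%C).
      + intros t Ht. exact (proj2 (galerkin_limit_correct t k Ht)).
      + intros t Ht. exact (proj2 (Hlim t k Ht)). }
  split; [|split].
  - intros k. destruct (Hmain k) as [[H1 _] [H2 _]]. now split.
  - intros k t Ht. destruct (Hmain k) as [[_ H1] [_ H2]]. split; auto.
  - intros T' HT'. exists M, sig. split; [assumption|].
    apply (regular_weaken g M M sig sig 0 T); try lra. apply galerkin_limit_regular.
Qed.

End Limit.

(** The radius is spent in two halvings: tau0 to tau0 / 2, so that the pointwise bound makes the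
    initial energy finite uniformly in N, and then to tau0 / 4 during the Galerkin evolution. *)
Theorem gevrey_existence (g alpha K0 tau0 : R) : 0 < g <= 1 -> 0 <= alpha <= g ->
  0 <= K0 -> 0 < tau0 ->
  exists T, 0 < T /\ forall th0, conj_sym th0 -> th0 (0, 0)%Z = RtoC 0 -> Gev g K0 tau0 th0 ->
    exists th, (forall k, th 0 k = th0 k) /\ gev_solution g alpha T th /\
      exists M sig, 0 < sig /\ regular g M sig 0 T th.
Proof.
  intros Hg Hal HK Htau.
  destruct (lsum_pow_exp g tau0 8 ltac:(lra) Htau) as [S8 [HS8 HS8b]].
  set (E0 := K0 ^ 2 * S8).
  assert (HE0 : 0 <= E0) by (apply Rmult_le_pos; [apply pow2_ge_0|lra]).
  destruct (galerkin_solutions g alpha (tau0 / 2) E0 Hg Hal ltac:(lra) HE0) as (T1 & HT1 & Hgal).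
  set (sig := tau0 / 2 / 2). set (M := 1 + E0).
  destruct (mode_stability g alpha M sig Hg Hal ltac:(unfold sig; lra) ltac:(unfold M; lra))
    as (del & Hdel & Hst).
  (* One window of [mode_stability] covers [0, T), so the Cauchy property needs no iteration. *)
  set (T := Rmin T1 del). assert (HT : 0 < T) by now apply Rmin_glb_lt.
  assert (HTT1 : T <= T1) by apply Rmin_l. assert (HTdel : T <= del) by apply Rmin_r.
  exists T. split; [assumption|]. intros th0 Hsym Hz HG.
  assert (Hen : forall N, energy g (tau0 / 2) (box N) th0 <= E0).
  { intros N. unfold energy, E0. apply Rle_trans with (lsum (box N) (fun k => K0 ^ 2 *
      (knorm k ^ 8 * exp (- tau0 * lam g k)))).
    - apply lsum_le. intros k _. rewrite Rpow_mult_distr, Wt_sqr.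
      assert (Hk : Cmod (th0 k) ^ 2 <= (K0 * exp (- tau0 * lam g k)) ^ 2)
        by (apply pow_incr; split; [apply Cmod_ge_0|apply HG]).
      apply Rle_trans with (knorm k ^ 8 * exp (2 * (tau0 / 2) * lam g k) *
        (K0 * exp (- tau0 * lam g k)) ^ 2).
      + apply Rmult_le_compat_l; [|assumption].
        apply Rmult_le_pos; [apply pow_le, knorm_nonneg|apply Rlt_le, exp_pos].
      + right. replace (2 * (tau0 / 2) * lam g k) with (tau0 * lam g k) by field.
        replace (- tau0 * lam g k) with (- (tau0 * lam g k)) by ring.
        rewrite exp_Ropp. field. apply Rgt_not_eq, exp_pos.
    - rewrite lsum_scal. apply Rmult_le_compat_l; [apply pow2_ge_0|]. apply HS8b, NoDup_box. }
  destruct (functional_choice (fun N v =>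
    (forall k, In k (box N) -> v 0 k = th0 k) /\
    forall t, 0 <= t < T1 ->
      supported N (v t) /\ conj_sym (v t) /\ v t (0, 0)%Z = RtoC 0 /\
      Gev g (1 + E0) (tau0 / 2 / 2) (v t) /\
      (forall k, In k (box N) ->
         is_derive_C (fun s => v s k) t (- Bil alpha (v t) (v t) k)%C))
    (fun N => Hgal N th0 Hsym Hz (Hen N))) as [v Hv].
  assert (Hreg : forall N, regular g M sig 0 T (v N)).
  { intros N t Ht. destruct (Hv N) as [_ H]. destruct (H t ltac:(lra)) as (_ & H1 & H2 & H3 & _).
    split; [exact H3|now split]. }
  assert (Hder : forall N t k, 0 <= t < T -> In k (box N) ->
    is_derive_C (fun s => v N s k) t (- Bil alpha (v N t) (v N t) k)%C).
  { intros N t k Ht Hk. destruct (Hv N) as [_ H]. destruct (H t ltac:(lra)) as (_ & _ & _ & _ & H4). auto. }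
  assert (Hv0 : forall N k, In k (box N) -> v N 0 k = th0 k) by (intros N; apply (Hv N)).
  assert (Hsup : forall N t, 0 <= t < T -> supported N (v N t)).
  { intros N t Ht. destruct (Hv N) as [_ H]. now destruct (H t ltac:(lra)). }
  assert (Hsol : forall m p, (m <= p)%nat -> solves_modes alpha m 0 T (v p)).
  { intros m p Hmp k Hk. apply (box_mono m p Hmp) in Hk. split.
    - eapply is_derive_C_right_cont, Hder; [lra|assumption].
    - intros t Ht. apply Hder; [lra|assumption]. }
  assert (Hcauchy : forall eps, 0 < eps -> exists n1, forall m p t k, (n1 <= m)%nat -> (m <= p)%nat ->
    0 <= t < T -> In k (box m) -> Cmod (v m t k - v p t k)%C <= eps).
  { intros eps Heps. destruct (Hst eps Heps) as [n0 Hn0]. exists n0.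
    intros m p t k Hm Hmp Ht Hk. apply (Hn0 m (v m) (v p) 0 T); auto; try lra.
    intros j Hj. rewrite !Hv0; auto. now apply (box_mono m p). }
  exists (galerkin_limit v). split; [|split].
  - intros k. now apply galerkin_limit_init.
  - apply (galerkin_limit_solution g alpha M sig T v); auto. unfold sig; lra.
  - exists M, sig. split; [unfold sig; lra|]. now apply (galerkin_limit_regular g M sig T v).
Qed.

(** * Gevrey norms and the equation on the torus *)

Lemma is_derive_C_iff (f : R -> C) (t : R) (l : C) : is_derive f t l <-> is_derive_C f t l.
Proof.
  split.
  - intros H. split.
    + apply (filterdiff_comp' (U := R_NormedModule) (V := C_R_NormedModule) (W := R_NormedModule)
        f (fun z : C => fst z) t (fun y => scal y l) (fun z : C => fst z)); [exact H|].
      apply filterdiff_linear, (is_linear_fst (U := R_NormedModule) (V := R_NormedModule)).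
    + apply (filterdiff_comp' (U := R_NormedModule) (V := C_R_NormedModule) (W := R_NormedModule)
        f (fun z : C => snd z) t (fun y => scal y l) (fun z : C => snd z)); [exact H|].
      apply filterdiff_linear, (is_linear_snd (U := R_NormedModule) (V := R_NormedModule)).
  - intros [HR HI].
    assert (H : filterdiff (K := R_AbsRing) (U := R_NormedModule) (V := C_R_NormedModule)
      (fun s => (Re (f s), Im (f s)) : C) (locally t) (fun y => (scal y (Re l), scal y (Im l)) : C)).
    { apply (filterdiff_comp'_2 (fun s => Re (f s)) (fun s => Im (f s)) (fun u v => (u, v) : C)
        t _ _ (fun u v => (u, v) : C) HR HI).
      apply filterdiff_linear, is_linear_prod; [apply is_linear_fst|apply is_linear_snd]. }
    apply (filterdiff_ext (fun s => (Re (f s), Im (f s)) : C)); [|exact H].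
    intros s. now destruct (f s).
Qed.

Lemma right_cont_C_iff (f : R -> C) (a : R) :
  filterlim f (at_right a) (locally (f a)) <-> right_cont_C f a.
Proof.
  split.
  - intros H. split.
    + apply (filterlim_comp _ _ _ f (fun z : C => fst z) _ _ _ H).
      apply (continuous_fst (U := R_UniformSpace) (V := R_UniformSpace)).
    + apply (filterlim_comp _ _ _ f (fun z : C => snd z) _ _ _ H).
      apply (continuous_snd (U := R_UniformSpace) (V := R_UniformSpace)).
  - intros [HR HI]. apply filterlim_locally. intros eps.
    pose proof (proj1 (filterlim_locally _ _) HR eps) as H1.
    pose proof (proj1 (filterlim_locally _ _) HI eps) as H2.
    generalize (filter_and _ _ H1 H2). apply filter_imp. intros s [B1 B2]. now split.
Qed.

Lemma real_meanfree_iff (th : coeffs) : real_meanfree th <-> conj_sym th /\ th (0, 0)%Z = RtoC 0.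
Proof. unfold real_meanfree, conj_sym. tauto. Qed.

Lemma gterm_nonneg (r s tau : R) (th : coeffs) (k : Z2) : 0 <= gterm r s tau th k.
Proof.
  unfold gterm. destruct (zero_mode k); [lra|].
  apply Rmult_le_pos; [|apply pow2_ge_0]. apply Rmult_le_pos; apply Rlt_le, exp_pos.
Qed.

Lemma gterm_le_Gnorm (r s tau B : R) (th : coeffs) (k : Z2) :
  Rbar_le (Gnorm_sq r s tau th) (Finite B) -> gterm r s tau th k <= B.
Proof.
  intros H.
  assert (Hle : Rbar_le (Lim_seq (fun _ => gterm r s tau th k)) (Gnorm_sq r s tau th)).
  { apply Lim_seq_le_loc. exists (zsize k). intros N HN.
    change (gterm r s tau th k <= lsum (box N) (gterm r s tau th)).
    apply lsum_term_le; [intros; apply gterm_nonneg|now apply in_box_zsize]. }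
  rewrite Lim_seq_const in Hle. exact (Rbar_le_trans _ _ _ Hle H).
Qed.

(** A single term of the series already gives the bound, with the same radius, because |k|^(2r) >=
    1. *)
Lemma Gnorm_Gev (r s tau B : R) (th : coeffs) : 0 <= r -> 0 <= B -> th (0, 0)%Z = RtoC 0 ->
  Rbar_le (Gnorm_sq r s tau th) (Finite (B ^ 2)) -> Gev (1 / s) B tau th.
Proof.
  intros Hr HB Hz H k. pose proof (exp_pos (- tau * lam (1 / s) k)) as He.
  destruct (Z2_eq_dec k (0, 0)%Z) as [->|Hk].
  { rewrite Hz, Cmod_0. apply Rmult_le_pos; lra. }
  apply (gterm_le_Gnorm r s tau _ th k) in H. unfold gterm in H.
  rewrite (proj2 (zero_mode_false k) Hk) in H. fold (lam (1 / s) k) in H.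
  assert (H1 : 1 <= Rpower (knorm k) (2 * r)).
  { apply knorm_ge1 in Hk. rewrite <- (Rpower_O (knorm k)) by lra. apply Rle_Rpower; lra. }
  set (e := exp (- tau * lam (1 / s) k)) in *.
  assert (Hee : exp (2 * tau * lam (1 / s) k) * e ^ 2 = 1).
  { unfold e. replace (exp (- tau * lam (1 / s) k) ^ 2)
      with (exp (- tau * lam (1 / s) k) * exp (- tau * lam (1 / s) k)) by ring.
    rewrite <- !exp_plus.
    replace (_ + _) with 0 by ring. apply exp_0. }
  set (p := exp (2 * tau * lam (1 / s) k)) in *.
  assert (Hp : 0 < p) by apply exp_pos.
  pose proof (Cmod_ge_0 (th k)) as Hc. set (c := Cmod (th k)) in *.
  assert (Hpc : p * c ^ 2 <= B ^ 2).
  { eapply Rle_trans; [|exact H]. apply Rmult_le_compat_r; [apply pow2_ge_0|nra]. }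
  apply Rsqr_incr_0_var; [|apply Rmult_le_pos; lra]. unfold Rsqr.
  replace (c * c) with (p * e ^ 2 * c ^ 2) by (rewrite Hee; ring).
  replace (B * e * (B * e)) with (B ^ 2 * e ^ 2) by ring.
  replace (p * e ^ 2 * c ^ 2) with ((p * c ^ 2) * e ^ 2) by ring.
  apply Rmult_le_compat_r; [apply pow2_ge_0|assumption].
Qed.

(** At radius sig / 2 the squared weight exp(sig lam) meets exp(-2 sig lam); the remaining exp(-sig
    lam) absorbs |k|^(2r) and the summation. *)
Lemma Gev_Gnorm (r s sig M : R) : 0 < 1 / s -> 0 < sig -> exists B : R, forall th,
  Gev (1 / s) M sig th -> Rbar_le (Gnorm_sq r s (sig / 2) th) (Finite B).
Proof.
  intros Hg Hs. set (g := 1 / s) in *.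
  destruct (nfloor_ex (Rabs (2 * r)) (Rabs_pos _)) as [m [_ Hm]].
  destruct (lsum_pow_exp g sig (S m) Hg Hs) as [C [HC HCb]].
  exists (M ^ 2 * C). intros th H.
  assert (Hle : forall N, boxsumR N (gterm r s (sig / 2) th) <= M ^ 2 * C).
  { intros N. change (lsum (box N) (gterm r s (sig / 2) th) <= M ^ 2 * C).
    apply Rle_trans with (lsum (box N) (fun k => M ^ 2 * (knorm k ^ S m * exp (- sig * lam g k)))).
    2:{ rewrite lsum_scal. apply Rmult_le_compat_l; [apply pow2_ge_0|apply HCb, NoDup_box]. }
    apply lsum_le. intros k _. unfold gterm. destruct (zero_mode k) eqn:E.
    { apply Rmult_le_pos; [apply pow2_ge_0|].
      apply Rmult_le_pos; [apply pow_le, knorm_nonneg|apply Rlt_le, exp_pos]. }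
    apply zero_mode_false, knorm_ge1 in E. fold g. fold (lam g k).
    assert (H1 : Rpower (knorm k) (2 * r) <= knorm k ^ S m).
    { rewrite <- Rpower_pow by lra. apply Rle_Rpower; [assumption|].
      rewrite S_INR. pose proof (Rle_abs (2 * r)). lra. }
    assert (H2 : Cmod (th k) ^ 2 <= (M * exp (- sig * lam g k)) ^ 2)
      by (apply pow_incr; split; [apply Cmod_ge_0|apply H]).
    apply Rle_trans with (knorm k ^ S m * exp (2 * (sig / 2) * lam g k) *
      (M * exp (- sig * lam g k)) ^ 2).
    - apply Rmult_le_compat; [|apply pow2_ge_0| |exact H2].
      + apply Rmult_le_pos; apply Rlt_le, exp_pos.
      + apply Rmult_le_compat_r; [apply Rlt_le, exp_pos|exact H1].
    - right. replace (2 * (sig / 2) * lam g k) with (sig * lam g k) by field.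
      replace (- sig * lam g k) with (- (sig * lam g k)) by ring.
      rewrite exp_Ropp. field. apply Rgt_not_eq, exp_pos. }
  unfold Gnorm_sq. rewrite <- (Lim_seq_const (M ^ 2 * C)).
  apply Lim_seq_le_loc. exists O. intros N _. apply Hle.
Qed.

Lemma IPM_solution_gev (alpha r s T : R) (th0 : coeffs) (th : R -> coeffs) :
  0 <= r -> 0 < 1 / s -> IPM_solution alpha r s T th0 th -> gev_solution (1 / s) alpha T th.
Proof.
  intros Hr Hg (H0 & Hreal & Hnorm & Hlim & Hder). split; [|split].
  - intros k. apply right_cont_C_iff. rewrite H0. apply Hlim.
  - intros k t Ht. apply is_derive_C_iff. rewrite <- transport_Bil. now apply Hder.
  - intros T' HT'. destruct (Hnorm T' ltac:(lra)) as (tau & Htau & B & HB).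
    exists (1 + Rabs B), tau. split; [assumption|]. intros t Ht.
    destruct (proj1 (real_meanfree_iff _) (Hreal t ltac:(lra))) as [Hc Hz].
    split; [|split; assumption].
    apply (Gnorm_Gev r s); auto.
    + pose proof (Rabs_pos B). lra.
    + eapply Rbar_le_trans; [apply HB; lra|]. simpl.
      pose proof (Rle_abs B). pose proof (Rabs_pos B). nra.
Qed.

Lemma gev_solution_IPM (alpha r s T M sig : R) (th : R -> coeffs) :
  0 < 1 / s -> 0 < sig -> gev_solution (1 / s) alpha T th -> regular (1 / s) M sig 0 T th ->
  IPM_solution alpha r s T (th 0) th.
Proof.
  intros Hg Hsig (Hlim & Hder & _) Hreg. split; [reflexivity|split; [|split; [|split]]].
  - intros t Ht. apply real_meanfree_iff. destruct (Hreg t Ht) as (_ & Hc & Hz). now split.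
  - intros T' HT'. destruct (Gev_Gnorm r s sig M Hg Hsig) as [B HB].
    exists (sig / 2). split; [lra|]. exists B. intros t Ht. apply HB. apply Hreg. lra.
  - intros k. apply right_cont_C_iff. apply Hlim.
  - intros k t Ht. apply is_derive_C_iff. rewrite transport_Bil. now apply Hder.
Qed.

(** Both parts of the theorem enter through alpha <= 1/s: for alpha > 0 this is s <= 1/alpha, for
    alpha = 0 it holds for every s >= 1. *)
Lemma local_wellposedness (alpha s r K0 tau0 : R) :
  0 < 1 / s <= 1 -> 0 <= alpha <= 1 / s -> 0 <= r -> 0 <= K0 -> 0 < tau0 ->
  exists Tstar : R, 0 < Tstar /\
    forall th0 : coeffs,
      real_meanfree th0 ->
      Rbar_le (Gnorm_sq r s tau0 th0) (Finite (K0 ^ 2)) ->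
      exists th : R -> coeffs,
        IPM_solution alpha r s Tstar th0 th /\
        forall th' : R -> coeffs, IPM_solution alpha r s Tstar th0 th' ->
          forall t, 0 <= t < Tstar -> th' t = th t.
Proof.
  intros Hg Hal Hr HK Htau.
  destruct (gevrey_existence (1 / s) alpha K0 tau0 Hg Hal HK Htau) as (T & HT & Hex).
  exists T. split; [assumption|]. intros th0 Hrm Hnorm.
  apply real_meanfree_iff in Hrm. destruct Hrm as [Hc Hz].
  destruct (Hex th0 Hc Hz (Gnorm_Gev r s tau0 K0 th0 Hr HK Hz Hnorm))
    as (th & H0 & Hsol & M & sig & Hsig & Hreg).
  assert (E0 : th 0 = th0) by (apply functional_extensionality; exact H0).
  exists th. split.
  - rewrite <- E0. apply (gev_solution_IPM alpha r s T M sig); auto. lra.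
  - intros th' H' t Ht. apply functional_extensionality. intros k.
    pose proof (IPM_solution_gev alpha r s T th0 th' Hr ltac:(lra) H') as Hsol'.
    apply (gevrey_uniqueness (1 / s) alpha T th' th Hg Hal Hsol' Hsol); [|assumption].
    intros j. destruct H' as [-> _]. now rewrite H0.
Qed.

Theorem theorem5p3 :
  (forall (alpha s r K0 tau0 : R),
     0 < alpha <= 1 -> 1 <= s <= 1 / alpha -> 3 < r -> 0 < K0 -> 0 < tau0 ->
     exists Tstar : R, 0 < Tstar /\
       forall th0 : coeffs,
         real_meanfree th0 ->
         Rbar_le (Gnorm_sq r s tau0 th0) (Finite (K0 ^ 2)) ->
         exists th : R -> coeffs,
           IPM_solution alpha r s Tstar th0 th /\
           forall th' : R -> coeffs, IPM_solution alpha r s Tstar th0 th' ->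
             forall t, 0 <= t < Tstar -> th' t = th t)
  /\
  (forall (s r K0 tau0 : R),
     1 <= s -> 3 < r -> 0 < K0 -> 0 < tau0 ->
     exists Tstar : R, 0 < Tstar /\
       forall th0 : coeffs,
         real_meanfree th0 ->
         Rbar_le (Gnorm_sq r s tau0 th0) (Finite (K0 ^ 2)) ->
         exists th : R -> coeffs,
           IPM_solution 0 r s Tstar th0 th /\
           forall th' : R -> coeffs, IPM_solution 0 r s Tstar th0 th' ->
             forall t, 0 <= t < Tstar -> th' t = th t).
Proof.
  split.
  - intros alpha s r K0 tau0 Hal Hs Hr HK Htau.
    assert (H1 : 0 < 1 / s <= 1).
    { split; [apply Rdiv_lt_0_compat; lra|]. apply Rle_div_l; lra. }
    assert (H2 : alpha <= 1 / s).
    { apply Rle_div_r; [lra|]. rewrite Rmult_comm. apply Rle_div_r; lra. }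
    apply local_wellposedness; lra.
  - intros s r K0 tau0 Hs Hr HK Htau.
    assert (H1 : 0 < 1 / s <= 1).
    { split; [apply Rdiv_lt_0_compat; lra|]. apply Rle_div_l; lra. }
    apply local_wellposedness; lra.
Qed.
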